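(* Let $\varrho_1,\varrho_2$ be proximate orders with orders $\rho_1=\lim_{r\to\infty}\varrho_1(r)>0$ and $\rho_2=\lim_{r\to\infty}\varrho_2(r)>0$, such that $r^{\varrho_1(r)}=O(r^{\varrho_2(r)})$ as $r\to\infty$. Let $\hat\varrho_1$ be a normalized proximate order with $\hat\varrho_1(r)=\varrho_1(r)$ for all sufficiently large $r$, and let $G_{\hat\varrho_1,\ell}$ be the associated numbers. Then: (a) If $\{u_\ell\}_{\ell\in\mathbb{N}_0}\subseteq\mathcal{SM}_L(\mathbb{R}^{n+1})$ satisfies $$\forall\varepsilon>0\ \exists\sigma,C>0\ \forall\ell\in\mathbb{N}_0:\quad \|u_\ell\|_{\varrho_2,\sigma}\le C\frac{G_{\hat\varrho_1,\ell}}{\ell!}\varepsilon^\ell,$$ then for every $f\in A_{\varrho_1}$ the series $Tf:=\sum_{\ell=0}^\infty u_\ell\star_L\partial_{x_0}^\ell f$ converges in $A_{\varrho_2}$, and $T:A_{\varrho_1}\to A_{\varrho_2}$ is a continuous operator. (b) Conversely, every continuous right $\mathbb{R}_n$-linear operator $T:A_{\varrho_1}\to A_{\varrho_2}$ is of the form $Tf=\sum_{\ell=0}^\infty u_\ell\star_L\partial_{x_0}^\ell f$ for some sequence $\{u_\ell\}_{\ell\in\mathbb{N}_0}\subseteq\mathcal{SM}_L(\mathbb{R}^{n+1})$ satisfying the condition in (a).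
   Context: $\mathbb{R}_n$ is the real Clifford algebra generated by $e_1,\dots,e_n$ with $e_ie_j=-e_je_i$ ($i\neq j$), $e_i^2=-1$; each $a\in\mathbb{R}_n$ is $a=\sum_Aa_Ae_A$ (sum over ordered subsets $A\subseteq\{1,\dots,n\}$, $e_A=e_{i_1}\cdots e_{i_r}$, $e_\emptyset=1$), with norm $|a|^2=\sum_A a_A^2$. Paravectors $x=x_0+\sum_{\ell=1}^nx_\ell e_\ell$ are identified with $\mathbb{R}^{n+1}$, and $\mathbb{S}=\{\sum_{\ell=1}^n x_\ell e_\ell:\sum x_\ell^2=1\}$. A function $f:\mathbb{R}^{n+1}\to\mathbb{R}_n$ is (entire) left slice monogenic, $f\in\mathcal{SM}_L(\mathbb{R}^{n+1})$, if $f(u+jv)=f_0(u,v)+jf_1(u,v)$ for all $u,v\in\mathbb{R}$, $j\in\mathbb{S}$, where $f_0,f_1:\mathbb{R}^2\to\mathbb{R}_n$ are continuously differentiable, $f_0(u,-v)=f_0(u,v)$, $f_1(u,-v)=-f_1(u,v)$, $\partial_uf_0=\partial_vf_1$ and $\partial_vf_0=-\partial_uf_1$. The star product is $f\star_Lg=f_0g_0-f_1g_1+j(f_1g_0+f_0g_1)$; for power series $\sum x^ka_k$, $\sum x^kb_k$ it equals $\sum_\ell x^\ell\sum_{k\le\ell}a_kb_{\ell-k}$. $\partial_{x_0}$ is the partial derivative in $x_0$ (the slice derivative). A proximate order is a differentiable $\varrho:[0,\infty)\to[0,\infty)$ with $\lim_{r\to\infty}\varrho(r)=\rho>0$ (its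 order) and $\lim_{r\to\infty}\varrho'(r)r\ln r=0$. It is normalized if $r\mapsto r^{\varrho(r)}$ is strictly increasing on $(0,\infty)$ and tends to $0$ as $r\to0^+$; then $\varphi:(0,\infty)\to(0,\infty)$ denotes the inverse of $r\mapsto r^{\varrho(r)}$, and $G_{\varrho,0}=1$, $G_{\varrho,\ell}=\varphi(\ell)^\ell/(e\rho)^{\ell/\rho}$ for $\ell\in\mathbb{N}$. For $\sigma>0$, $A_{\varrho,\sigma}=\{f\in\mathcal{SM}_L(\mathbb{R}^{n+1}):\|f\|_{\varrho,\sigma}:=\sup_x|f(x)|e^{-\sigma|x|^{\varrho(|x|)}}<\infty\}$ (a Banach space). $A_\varrho=\bigcup_{\sigma>0}A_{\varrho,\sigma}$ with the inductive limit locally convex topology (a sequence converges iff it lies in some $A_{\varrho,\sigma}$ together with its limit and converges in $\|\cdot\|_{\varrho,\sigma}$). *)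

(* Defs.v *)
From HB Require Import structures.
From mathcomp Require Import all_boot all_order all_algebra.
From mathcomp Require Import all_classical all_reals all_analysis.
Set Implicit Arguments. Unset Strict Implicit. Unset Printing Implicit Defensive.
Import Order.TTheory GRing.Theory Num.Theory.
Import numFieldNormedType.Exports.

Local Open Scope classical_set_scope.
Local Open Scope ring_scope.

Section Defs.
Variable R : realType.

(* a = sum_A a_A e_A, A ranging over subsets of {1..n} (here 'I_n). *)
Definition Cl (n : nat) := {ffun {set 'I_n} -> R}.

Definition symdiff n (A B : {set 'I_n}) : {set 'I_n} := ((A :\: B) :|: (B :\: A))%SET.

(* e_A e_B = clsign A B * e_(A Δ B), with e_i e_j = - e_j e_i (i<>j), e_i^2 = -1:
   sign = (-1)^(#{(a,b) in A x B | b < a} + #(A ∩ B)). *)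
Definition clsign n (A B : {set 'I_n}) : R :=
  (-1) ^+ (#|[set p : 'I_n * 'I_n | (p.1 \in A) && (p.2 \in B) && (p.2 < p.1)%N]%SET|
           + #|(A :&: B)%SET|).

Definition clmul n (a b : Cl n) : Cl n :=
  [ffun C => \sum_(A : {set 'I_n}) \sum_(B : {set 'I_n} | symdiff A B == C)
               clsign A B * a A * b B].

Definition clhalf n (a : Cl n) : Cl n := [ffun A => a A / 2].

Definition clnorm n (a : Cl n) : R := Num.sqrt (\sum_(A : {set 'I_n}) a A ^+ 2).

Definition vec_to_cl n (v : 'I_n -> R) : Cl n :=
  [ffun A => \sum_(i : 'I_n | A == [set i]%SET) v i].

(* ---------- Paravectors x = x0 + sum_l x_l e_l, identified with R^(n+1) ---------- *)
Definition Pt (n : nat) := (R * ('I_n -> R))%type.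

Definition vnorm n (x : Pt n) : R := Num.sqrt (\sum_(i : 'I_n) x.2 i ^+ 2).
Definition ptnorm n (x : Pt n) : R := Num.sqrt (x.1 ^+ 2 + \sum_(i : 'I_n) x.2 i ^+ 2).

Definition ptof n (u v : R) (j : 'I_n -> R) : Pt n := (u, fun i => v * j i).

Definition in_sphere n (j : 'I_n -> R) : Prop := \sum_(i : 'I_n) j i ^+ 2 = 1.

Definition C1_2 (g : R -> R -> R) : Prop :=
  (forall u v : R, derivable (fun t : R => g t v) u 1 /\ derivable (fun t : R => g u t) v 1) /\
  continuous (fun p : R * R => derive1 (fun t => g t p.2) p.1) /\
  continuous (fun p : R * R => derive1 (fun t => g p.1 t) p.2).

Definition slice_monogenic n (f : Pt n -> Cl n) : Prop :=
  exists f0 f1 : R -> R -> Cl n,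
    (forall (u v : R) (j : 'I_n -> R), in_sphere j ->
        f (ptof u v j) = f0 u v + clmul (vec_to_cl j) (f1 u v)) /\
    (forall A, C1_2 (fun u v => f0 u v A) /\ C1_2 (fun u v => f1 u v A)) /\
    (forall u v, f0 u (- v) = f0 u v /\ f1 u (- v) = - f1 u v) /\
    (forall u v A,
        derive1 (fun t => f0 t v A) u = derive1 (fun t => f1 u t A) v /\
        derive1 (fun t => f0 u t A) v = - derive1 (fun t => f1 t v A) u).

(* For x = u + j v (v = |x_vec| >= 0, j = x_vec / v), with the slice components
   f0(u,v) = (f(x) + f(xbar))/2 and f1(u,v) = -j (f(x) - f(xbar))/2
   (the unique components of a slice function; f1(u,0) = 0), the star product is
   f0 g0 - f1 g1 + j (f1 g0 + f0 g1). *)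
Definition pconj n (x : Pt n) : Pt n := (x.1, fun i => - x.2 i).

Definition jdir n (x : Pt n) : Cl n :=
  if vnorm x == 0 then 0 else vec_to_cl (fun i => x.2 i / vnorm x).

Definition star n (f g : Pt n -> Cl n) (x : Pt n) : Cl n :=
  let j := jdir x in
  let f0 := clhalf (f x + f (pconj x)) in
  let f1 := - clmul j (clhalf (f x - f (pconj x))) in
  let g0 := clhalf (g x + g (pconj x)) in
  let g1 := - clmul j (clhalf (g x - g (pconj x))) in
  clmul f0 g0 - clmul f1 g1 + clmul j (clmul f1 g0 + clmul f0 g1).

Definition pdx0 n (f : Pt n -> Cl n) : Pt n -> Cl n :=
  fun x => [ffun A => derive1 (fun t => f (t, x.2) A) x.1].

Definition growth (rho : R -> R) (r : R) : R := r `^ rho r.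

Definition proximate_order (rho : R -> R) (ord : R) : Prop :=
  (forall r, 0 <= r -> 0 <= rho r) /\
  (forall r, 0 < r -> derivable rho r 1) /\
  cvg (h^-1 * (rho h - rho 0) @[h --> at_right 0])%classic /\
  0 < ord /\
  rho r @[r --> +oo] --> ord /\
  derive1 rho r * r * ln r @[r --> +oo] --> 0.

Definition normalized_po (rho : R -> R) (ord : R) : Prop :=
  proximate_order rho ord /\
  (forall r s, 0 < r -> r < s -> growth rho r < growth rho s) /\
  growth rho r @[r --> at_right 0] --> 0.

Definition phi (rho : R -> R) (s : R) : R :=
  xget 0 [set r | 0 < r /\ growth rho r = s]%classic.

Definition Gnum (rho : R -> R) (ord : R) (l : nat) : R :=
  if l == 0%N then 1
  else phi rho l%:R ^+ l / (expR 1 * ord) `^ (l%:R / ord).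

Definition weighted n (rho : R -> R) (sigma : R) (f : Pt n -> Cl n) (x : Pt n) : R :=
  clnorm (f x) * expR (- (sigma * growth rho (ptnorm x))).

Definition inA n (rho : R -> R) (sigma : R) (f : Pt n -> Cl n) : Prop :=
  slice_monogenic f /\ exists M : R, forall x, weighted rho sigma f x <= M.

Definition normA n (rho : R -> R) (sigma : R) (f : Pt n -> Cl n) : R :=
  sup [set weighted rho sigma f x | x in [set: Pt n]]%classic.

Definition inAU n (rho : R -> R) (f : Pt n -> Cl n) : Prop :=
  exists sigma, 0 < sigma /\ inA rho sigma f.

(* convergence of sequences in the inductive limit A_rho *)
Definition cvgA n (rho : R -> R) (fs : nat -> Pt n -> Cl n) (f : Pt n -> Cl n) : Prop :=
  exists sigma, 0 < sigma /\ inA rho sigma f /\ (forall k, inA rho sigma (fs k)) /\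
    normA rho sigma (fun x => fs k x - f x) @[k --> \oo] --> 0.

Definition series_cvgA n (rho : R -> R) (u : nat -> Pt n -> Cl n)
    (f g : Pt n -> Cl n) : Prop :=
  cvgA rho (fun N x => \sum_(l < N) star (u l) (iter l (@pdx0 n) f) x) g.

Definition contA n (rho1 rho2 : R -> R) (T : (Pt n -> Cl n) -> (Pt n -> Cl n)) : Prop :=
  forall fs f, cvgA rho1 fs f -> cvgA rho2 (fun k => T (fs k)) (T f).

Definition right_linear n (rho1 : R -> R) (T : (Pt n -> Cl n) -> (Pt n -> Cl n)) : Prop :=
  forall (f g : Pt n -> Cl n) (a b : Cl n), inAU rho1 f -> inAU rho1 g ->
    T (fun x => clmul (f x) a + clmul (g x) b) =
    (fun x => clmul (T f x) a + clmul (T g x) b).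

Definition coef_cond n (rho2 rhohat : R -> R) (ord1 : R) (u : nat -> Pt n -> Cl n) : Prop :=
  forall eps : R, 0 < eps -> exists sigma C : R, 0 < sigma /\ 0 < C /\
    forall l : nat, inA rho2 sigma (u l) /\
      normA rho2 sigma (u l) <= C * Gnum rhohat ord1 l / (l`!)%:R * eps ^+ l.

End Defs.

(* Main.v *)
Require Import Defs.
From HB Require Import structures.
From mathcomp Require Import all_boot all_order all_algebra.
From mathcomp Require Import all_classical all_reals all_analysis.
From mathcomp Require Import complex ring lra.

(** Write [f(u + jv) = Re F(u + iv) + j Im F(u + iv)], where the components [F_A]
    are entire with real Taylor coefficients, so that [f(x) = \sum_k x^k a_k]. The
    star product becomes the Clifford product of these families and the slice
    derivative the complex one. Cauchy's estimates for [a_k] come from averages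
    over the [N]-th roots of unity instead of contour integrals.

    Two estimates link the growth [g] of [rho1] to the numbers [G_k]:
    [r^k <= M eps^k G_k exp(s g(r))] for all [eps], and, for all [s],
    [exp(s g(r)) <= M B^k r^k / G_k] at a suitable radius [r]. Hence [f] lies in
    [A_rho1] iff [|a_k| <= M B^k / G_k] for some [B].

    (a) Then the [l]-th derivative of [f] is at most [M l! (2B)^l / G_l] times an
    exponential weight, and the condition on [u_l] with [eps = 1/(4B)] makes the
    series converge geometrically, with constants uniform on bounded sets.

    (b) Applying the continuity of [T] to multiples of [x^k] that tend to [0] bounds
    [T(x^k)] by [C eps^k G_k]. Therefore
    [u_l = \sum_(k <= l) (-1)^(l-k) / ((l-k)! k!) x^(l-k) * T(x^k)] satisfies the
    condition, and by binomial inversion its operator agrees with [T] on all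
    [x^m a]. Taylor polynomials converge in [A_rho1], so the two are equal. *)

Set Implicit Arguments. Unset Strict Implicit. Unset Printing Implicit Defensive.
Import Order.TTheory GRing.Theory Num.Theory.
Import numFieldNormedType.Exports.
Local Open Scope ring_scope.

(** * Roots of unity *)

(** Uniformity shapes the estimates. Complex differentiability is used uniformly on a closed disc;
    continuity of the partial derivatives on a compact square supplies this, and then a circle of
    sample points can be contracted to its centre in finitely many controlled steps. Series converge
    by one device: a bound at twice the radius gives ratio 1/2. Hence the spare powers of 2 in
    constants such as [1/(4B)]. In the inductive limit the type [sigma] may grow under each
    operation, but it must not depend on the function or the index, so types and constants are
    chosen before [f], [k] and [l]. Continuity of [T] is sequential; all scaled monomials are
    therefore put into one null sequence, whose image lies in a single [A_{rho2,sigma}]. The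
    inequality [G j * G k <= G (j + k)] is used twice: in (a) it splits the bound on [a_(k+l)], in
    (b) it merges [x^(l-k)] with [T(x^k)]. The inverse [phi] exists for the normalized [rhohat], not
    for [rho1]; the two growth functions differ by a bounded amount, which costs a constant factor
    in the weight. *)

Section Modulus.
Variable R : realType.
Local Notation C := (complex R).
Implicit Types z w : C.

Definition cmod z : R := Normc.normc z.

Lemma cmodE z : cmod z = Num.sqrt (complex.Re z ^+ 2 + complex.Im z ^+ 2).
Proof. by case: z. Qed.

Lemma cmod_ge0 z : 0 <= cmod z.
Proof. by rewrite cmodE sqrtr_ge0. Qed.

Lemma cmod0 : cmod 0 = 0. Proof. exact: Normc.normc0. Qed.
Lemma cmod1 : cmod 1 = 1. Proof. exact: Normc.normc1. Qed.
Lemma cmodM z w : cmod (z * w) = cmod z * cmod w.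
Proof. exact: Normc.normcM. Qed.
Lemma cmodV z : cmod z^-1 = (cmod z)^-1.
Proof. exact: Normc.normcV. Qed.
Lemma cmodD z w : cmod (z + w) <= cmod z + cmod w.
Proof. exact: le_normcD. Qed.
Lemma cmodN z : cmod (- z) = cmod z.
Proof. exact: normcN. Qed.
Lemma cmodB z w : cmod (z - w) <= cmod z + cmod w.
Proof. by rewrite -(cmodN w); apply: cmodD. Qed.
Lemma cmod_distC z w : cmod (z - w) = cmod (w - z).
Proof. by rewrite -cmodN opprB. Qed.
Lemma cmod_tri v z w : cmod (z - w) <= cmod (z - v) + cmod (v - w).
Proof. by apply: le_trans (cmodD _ _); rewrite addrA subrK. Qed.
Lemma cmodX z k : cmod (z ^+ k) = cmod z ^+ k.
Proof. by elim: k => [|k IH]; rewrite ?expr0 ?cmod1 // !exprS cmodM IH. Qed.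
Lemma cmod_eq0 z : cmod z = 0 -> z = 0.
Proof. exact: Normc.eq0_normc. Qed.

Lemma cmod_sum (I : Type) (r : seq I) (P : pred I) (F : I -> C) :
  cmod (\sum_(i <- r | P i) F i) <= \sum_(i <- r | P i) cmod (F i).
Proof.
elim/big_rec2: _ => [|i x y _ IH]; first by rewrite cmod0.
by apply: le_trans (cmodD _ _) _; rewrite lerD2l.
Qed.

Lemma cmodR (x : R) : cmod x%:C%C = `|x|.
Proof. by rewrite cmodE /= expr0n addr0 sqrtr_sqr. Qed.

Lemma cmod_nat (n : nat) : cmod n%:R = n%:R.
Proof. by rewrite -(rmorph_nat (real_complex R)) cmodR ger0_norm. Qed.

Lemma Re_le_cmod z : `|complex.Re z| <= cmod z.
Proof. by rewrite cmodE -sqrtr_sqr ler_wsqrtr // lerDl sqr_ge0. Qed.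

Lemma Im_le_cmod z : `|complex.Im z| <= cmod z.
Proof. by rewrite cmodE -sqrtr_sqr ler_wsqrtr // lerDr sqr_ge0. Qed.

Lemma cmod_le_ReIm z : cmod z <= `|complex.Re z| + `|complex.Im z|.
Proof.
rewrite cmodE -[leRHS]ger0_norm ?addr_ge0 // -sqrtr_sqr ler_wsqrtr //.
by rewrite sqrrD !real_normK ?num_real // -addrA lerD2l lerDr mulrn_wge0 // mulr_ge0.
Qed.

Lemma cmodJ z : cmod (z^*)%C = cmod z.
Proof. by rewrite !cmodE; case: z => a b /=; rewrite sqrrN. Qed.

Lemma cmod_le0 z : (forall e : R, 0 < e -> cmod z <= e) -> z = 0.
Proof.
move=> h; apply: cmod_eq0; apply/eqP; rewrite eq_le cmod_ge0 andbT.
by apply/ler_addgt0Pl => e e0; rewrite addr0 h.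
Qed.

End Modulus.
Arguments cmod : simpl never.

Section Unity.
Variable R : realType.
Local Notation C := (complex R).
Local Open Scope classical_set_scope.

Definition cexpi (t : R) : C := (cos t +i* sin t)%C.

Lemma cexpiD s t : cexpi (s + t) = cexpi s * cexpi t.
Proof.
by apply/eqP; rewrite eq_complex /= cosD sinD eqxx [sin s * _ + _]addrC eqxx.
Qed.

Lemma cexpi0 : cexpi 0 = 1.
Proof. by rewrite /cexpi cos0 sin0. Qed.

Lemma cexpiX t k : cexpi t ^+ k = cexpi (t *+ k).
Proof. by elim: k => [|k IH]; rewrite ?cexpi0 // mulrSr exprSr IH cexpiD. Qed.

Lemma cmod_cexpi t : cmod (cexpi t) = 1.
Proof. by rewrite cmodE /= cos2Dsin2 sqrtr1. Qed.

(** Half angle: [cos t = 1 - 2 sin^2 (t/2)], and [sin] is positive on the open interval from 0 to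
    [pi]. *)
Lemma cexpi_eq1 t : 0 < t -> t < pi *+ 2 -> cexpi t <> 1.
Proof.
move=> t0 t2 [c1 _].
have : sin (t / 2) > 0.
  by apply: sin_gt0_pi; rewrite divr_gt0 // ltr_pdivrMr // mulr_natr.
have : cos t = 1 - sin (t / 2) ^+ 2 *+ 2.
  have tE : t = t / 2 + t / 2 by field.
  rewrite {1}tE cosD -!expr2 cos2sin2; ring.
rewrite c1 => h1 h2; have := exprn_gt0 2 h2; lra.
Qed.

Definition omega (N : nat) : C := cexpi (pi *+ 2 / N%:R).

Lemma omega_expr N : (0 < N)%N -> omega N ^+ N = 1.
Proof.
move=> N0; rewrite cexpiX -[_ *+ N]mulr_natr divfK ?pnatr_eq0 -?lt0n //.
by apply/eqP; rewrite eq_complex /= cos2pi sin2pi !eqxx.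
Qed.

Lemma omega_neq1 N k : (0 < k < N)%N -> omega N ^+ k != 1.
Proof.
move=> /andP[k0 kN]; apply/eqP; rewrite cexpiX -[_ *+ k]mulr_natr.
have N0 : 0 < N%:R :> R by rewrite ltr0n (leq_trans _ kN).
have p0 : 0 < pi *+ 2 :> R by rewrite mulr2n addr_gt0 ?pi_gt0.
apply: cexpi_eq1.
  by apply: mulr_gt0; rewrite ?ltr0n //; apply: divr_gt0.
by rewrite mulrAC ltr_pdivrMr // ltr_pM2l ?ltr_nat.
Qed.

Lemma cmod_omega N : cmod (omega N) = 1. Proof. exact: cmod_cexpi. Qed.

(** The edges of the regular [N]-gon become short; this turns uniform differentiability into an
    estimate along the polygon. *)
Lemma omega_cvg (d : R) : 0 < d ->
  exists N0, forall N, (N0 <= N)%N -> cmod (omega N - 1) < d.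
Proof.
move=> d0.
have h : (pi *+ 2 / n%:R : R) @[n --> \oo]%classic --> (0 : R).
  rewrite -(mulr0 (pi *+ 2)); apply: cvgM; first exact: cvg_cst.
  apply/gtr0_cvgV0; last exact: cvgr_idn.
  by near=> n; rewrite ltr0n; near: n; exists 1%N.
have hc : (cos (pi *+ 2 / n%:R : R) @[n --> \oo] --> (1 : R))%classic.
  by have := cvg_comp _ _ h (@continuous_cos R 0); rewrite cos0.
have hs : (sin (pi *+ 2 / n%:R : R) @[n --> \oo] --> (0 : R))%classic.
  by have := cvg_comp _ _ h (@continuous_sin R 0); rewrite sin0.
have d2 : 0 < d / 2 by rewrite divr_gt0.
have /cvgrPdist_lt /(_ _ d2) [N1 _ H1] := hc.
have /cvgrPdist_lt /(_ _ d2) [N2 _ H2] := hs.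
exists (maxn N1 N2) => N; rewrite geq_max => /andP[/H1 a1 /H2 a2].
apply: le_lt_trans (cmod_le_ReIm _) _ => /=.
move: a1 a2 => /=; rewrite distrC sub0r normrN oppr0 addr0; lra.
Unshelve. all: by end_near.
Qed.

(** Orthogonality of characters: for [i != k] the ratio [q = omega^i / omega^k] satisfies [q^N = 1]
    and [q != 1], so its geometric sum vanishes. The radius [r] is kept so that the lemma applies to
    the nodes directly. *)
Lemma omega_orth N r i k : (0 < N)%N -> (i < N)%N -> (k < N)%N -> r != 0 ->
  \sum_(j < N) (r * omega N ^+ j) ^+ i / (r * omega N ^+ j) ^+ k
  = (if i == k then N%:R else 0) :> C.
Proof.
move=> N0 iN kN r0.
have w0 : omega N != 0.
  by apply/eqP => h; have := cmod_omega N; rewrite h cmod0 => /eqP; rewrite eq_sym oner_eq0.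
set q := omega N ^+ i / omega N ^+ k.
have qE (j : nat) : (r * omega N ^+ j) ^+ i / (r * omega N ^+ j) ^+ k
    = (r ^+ i / r ^+ k) * q ^+ j.
  rewrite /q !exprMn !exprVn -!exprM ![(j * _)%N]mulnC.
  by rewrite invfM mulrACA.
under eq_bigr do rewrite qE.
rewrite -mulr_sumr; have [ik|ik] := eqVneq i k.
  have q1 : q = 1 by rewrite /q ik divff ?expf_neq0.
  rewrite ik.
  rewrite divff ?expf_neq0 // mul1r.
  under eq_bigr do rewrite q1 expr1n.
  by rewrite sumr_const card_ord.
have qn1 : q != 1.
  apply: contra_neq ik => q1.
  have e : omega N ^+ i = omega N ^+ k.
    by rewrite -[LHS](divfK (expf_neq0 k w0)) -/q q1 mul1r.
  wlog lt : i k iN kN {qE q q1} e / (i <= k)%N.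
    move=> H; have [|/ltnW] := leqP i k; first exact: H.
    by move=> /H -> //.
  move: lt; rewrite leq_eqVlt => /orP[/eqP //|lt].
  have : omega N ^+ (k - i) = 1.
    apply: (mulfI (expf_neq0 i w0)).
    by rewrite -exprD subnKC ?(ltnW lt) // mulr1.
  by move/eqP; rewrite (negbTE (omega_neq1 _)) // subn_gt0 lt /= (leq_ltn_trans _ kN) ?leq_subr.
have : (q - 1) * \sum_(j < N) q ^+ j = 0.
  rewrite -subrX1 /q exprMn exprVn -!exprM ![(_ * N)%N]mulnC !exprM omega_expr //.
  by rewrite !expr1n divr1 subrr.
by move/eqP; rewrite mulf_eq0 subr_eq0 (negbTE qn1) => /eqP ->; rewrite mulr0.
Qed.

End Unity.

(** * Power series expansion of complex functions *)

Section Cauchy.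
Variable R : realType.
Local Notation C := (complex R).
Local Open Scope classical_set_scope.
Implicit Types (F G : C -> C) (a b : nat -> C) (z w : C).

Definition node (r : R) (N j : nat) : C := r%:C%C * omega R N ^+ j.

Lemma cmod_node r N j : 0 < r -> cmod (node r N j) = r.
Proof.
by move=> r0; rewrite cmodM cmodX cmod_omega expr1n mulr1 cmodR gtr0_norm.
Qed.

Lemma node_neq0 r N j : 0 < r -> node r N j != 0.
Proof.
move=> r0; apply/eqP => h; have := cmod_node N j r0; rewrite h cmod0 => e.
by rewrite -e ltxx in r0.
Qed.

Lemma real_complex_neq0 (r : R) : 0 < r -> r%:C%C != 0 :> C.
Proof. by move=> r0; rewrite eq_complex /= eqxx andbT gt_eqF. Qed.

(** The Riemann sum, over [N] equidistant nodes, of Cauchy's integral for the [k]-th Taylor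
    coefficient. *)
Definition dcoef F (r : R) (N k : nat) : C :=
  (\sum_(j < N) F (node r N j) / node r N j ^+ k) / N%:R.

Lemma dcoef_le F (r M : R) N k : 0 < r -> (0 < N)%N ->
  (forall z, cmod z = r -> cmod (F z) <= M) -> cmod (dcoef F r N k) * r ^+ k <= M.
Proof.
move=> r0 N0 hM; have n0 : 0 < N%:R :> R by rewrite ltr0n.
rewrite /dcoef cmodM cmodV cmod_nat -mulrA [_^-1 * _]mulrC mulrA ler_pdivrMr //.
have -> : M * N%:R = \sum_(j < N) M by rewrite sumr_const card_ord mulr_natr.
apply: le_trans (ler_wpM2r _ (cmod_sum _ _ _)) _; first by rewrite exprn_ge0 ?ltW.
rewrite mulr_suml; apply: ler_sum => j _.
rewrite cmodM cmodV cmodX cmod_node // divfK ?expf_neq0 ?gt_eqF //.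
by apply: hM; rewrite cmod_node.
Qed.

Lemma natC_neq0 N : (0 < N)%N -> N%:R != 0 :> C.
Proof.
move=> N0; apply/eqP => h; have := cmod_nat R N; rewrite h cmod0 => /eqP.
by rewrite eq_sym pnatr_eq0 -leqn0 leqNgt N0.
Qed.

(** The discrete coefficients are exact below degree [N]: no two exponents less than [N] agree
    modulo [N]. Cauchy's estimate for polynomials follows without any limit. *)
Lemma dcoef_poly a (r : R) N k : 0 < r -> (k < N)%N ->
  dcoef (fun z => \sum_(i < N) a i * z ^+ i) r N k = a k.
Proof.
move=> r0 kN; have N0 : (0 < N)%N by apply: leq_trans kN.
rewrite /dcoef; under eq_bigr do rewrite mulr_suml.
rewrite exchange_big /= (bigD1 (Ordinal kN)) //= [X in _ + X]big1 ?addr0.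
  under eq_bigr do rewrite -mulrA.
  rewrite -mulr_sumr omega_orth ?real_complex_neq0 // eqxx mulfK //.
  exact: natC_neq0.
move=> i; rewrite -val_eqE /= => ik.
under eq_bigr do rewrite -mulrA.
by rewrite -mulr_sumr omega_orth ?real_complex_neq0 // (negbTE ik) mulr0.
Qed.

Lemma poly_coef_le a (r M : R) N k : 0 < r -> (k < N)%N ->
  (forall z, cmod z = r -> cmod (\sum_(i < N) a i * z ^+ i) <= M) ->
  cmod (a k) * r ^+ k <= M.
Proof.
move=> r0 kN hM; rewrite -(dcoef_poly a r0 kN).
by apply: dcoef_le => //; apply: leq_trans kN.
Qed.

(** One [d] must serve every edge of a polygon and every step of its contraction. *)
Definition unif_diff F (F' : C -> C) (r : R) := forall e : R, 0 < e ->
  exists2 d : R, 0 < d & forall z w, cmod z <= r -> cmod w <= r ->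
    cmod (w - z) < d -> cmod (F w - F z - F' z * (w - z)) <= e * cmod (w - z).

Lemma cmod_segment (r t : R) z w : 0 <= t <= 1 -> cmod z <= r -> cmod w <= r ->
  cmod (z + t%:C%C * (w - z)) <= r.
Proof.
move=> /andP[t0 t1] zr wr.
have -> : z + t%:C%C * (w - z) = (1 - t)%:C%C * z + t%:C%C * w.
  by rewrite rmorphB rmorph1; ring.
apply: le_trans (cmodD _ _) _; rewrite !cmodM !cmodR !ger0_norm ?subr_ge0 //.
have := ler_wpM2l t0 wr; have t1' : 0 <= 1 - t by lra.
have := ler_wpM2l t1' zr; lra.
Qed.

(* Along the polygon w_j = z + t (g_j - z) the increments of F sum up to zero. *)
Lemma polygon_sum F F' (r e d t : R) N z :
  0 < r -> 0 < t <= 1 -> (1 < N)%N -> cmod z <= r -> cmod (omega R N - 1) * r < d ->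
  (forall u v, cmod u <= r -> cmod v <= r -> cmod (v - u) < d ->
     cmod (F v - F u - F' u * (v - u)) <= e * cmod (v - u)) ->
  cmod (\sum_(j < N) F' (z + t%:C%C * (node r N j - z)) * node r N j)
    <= N%:R * (e * r).
Proof.
move=> r0 /andP[t0 t1] N1 zr wd hF.
pose w j := z + t%:C%C * (node r N j - z).
have N0 : (0 < N)%N by apply: leq_trans N1.
have wr j : cmod (w j) <= r by rewrite cmod_segment ?cmod_node // t1 ltW.
have wS j : w j.+1 - w j = t%:C%C * (omega R N - 1) * node r N j.
  by rewrite /w /node exprS; ring.
have wSd j : cmod (w j.+1 - w j) = t * cmod (omega R N - 1) * r.
  by rewrite wS 2!cmodM cmodR cmod_node // gtr0_norm.
have wlt j : cmod (w j.+1 - w j) < d.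
  rewrite wSd; apply: le_lt_trans wd; apply: ler_wpM2r; first exact: ltW.
  by rewrite -[leRHS]mul1r ler_wpM2r ?cmod_ge0.
(* The polygon is closed because [omega^N = 1]. *)
have tel : \sum_(j < N) (F (w j.+1) - F (w j)) = 0.
  rewrite -(big_mkord xpredT (fun j => F (w j.+1) - F (w j))) telescope_sumr //.
  by rewrite /w /node omega_expr // expr0 subrr.
have om : 0 < cmod (omega R N - 1).
  rewrite lt_def cmod_ge0 andbT; apply/eqP => /cmod_eq0 /eqP.
  by rewrite subr_eq0; apply/negP; apply: (@omega_neq1 R N 1); rewrite N1.
(* Up to the common factor [t (omega - 1)], the node [g_j] is the edge from [w_j] to [w_(j+1)].
   Dividing by this factor requires [t > 0] and [N > 1]. *)
rewrite -(ler_pM2l (mulr_gt0 t0 om)).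
have -> : t * cmod (omega R N - 1) * cmod (\sum_(j < N) F' (w j) * node r N j)
    = cmod (\sum_(j < N) F' (w j) * (w j.+1 - w j)).
  rewrite -[X in X * _ * _](gtr0_norm t0) -cmodR -!cmodM mulr_sumr; congr cmod.
  by apply: eq_bigr => j _; rewrite wS; ring.
have -> : \sum_(j < N) F' (w j) * (w j.+1 - w j)
    = - \sum_(j < N) (F (w j.+1) - F (w j) - F' (w j) * (w j.+1 - w j)).
  by rewrite sumrB tel sub0r opprK.
rewrite cmodN; apply: le_trans (cmod_sum _ _ _) _.
have -> : t * cmod (omega R N - 1) * (N%:R * (e * r)) =
    \sum_(j < N) e * (t * cmod (omega R N - 1) * r).
  by rewrite sumr_const card_ord -mulr_natr; ring.
by apply: ler_sum => j _; rewrite -(wSd j); apply: hF.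
Qed.

Lemma node_expr r N j : (0 < N)%N -> node r N j ^+ N = r%:C%C ^+ N.
Proof.
by move=> N0; rewrite exprMn -exprM mulnC exprM omega_expr // expr1n mulr1.
Qed.

(** The inner sum is the truncated Cauchy kernel [g_j / (g_j - z)]; by orthogonality only [k = 0]
    survives averaging over the nodes. *)
Lemma kernel_sum r N z : 0 < r -> (0 < N)%N ->
  \sum_(j < N) \sum_(k < N) (z / node r N j) ^+ k = N%:R.
Proof.
move=> r0 N0; rewrite exchange_big /= (bigD1 (Ordinal N0)) //= [X in _ + X]big1 ?addr0.
  by under eq_bigr do rewrite expr0; rewrite sumr_const card_ord.
move=> k; rewrite -val_eqE /= => k0.
under eq_bigr => j _.
  rewrite exprMn exprVn -[_^-1]mul1r -[X in _ * (X / _)](expr0 (node r N j)); over.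
rewrite -mulr_sumr omega_orth ?real_complex_neq0 //.
by rewrite eq_sym (negbTE k0) mulr0.
Qed.

(** Finite geometric sum. All nodes have the same [N]-th power, so the truncation error does not
    depend on [j] and can be pulled out of sums over the nodes. *)
Lemma kernelM r N j z : 0 < r -> (0 < N)%N ->
  (node r N j - z) * (\sum_(k < N) (z / node r N j) ^+ k)
  = node r N j * (1 - z ^+ N / r%:C%C ^+ N).
Proof.
move=> r0 N0; have g0 := node_neq0 N j r0.
have -> : node r N j - z = - (node r N j * (z / node r N j - 1)) by field.
rewrite mulNr -mulrA -subrX1 exprMn exprVn node_expr //; ring.
Qed.

(* The Cauchy sum of F over the contracted nodes z + t (g_j - z) is N F(z) at t = 0 and
   the polynomial at t = 1; moving t in small steps hardly changes it, by
   [polygon_sum]. *)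
Lemma dcoef_cvg F F' (r : R) : 0 < r -> unif_diff F F' r ->
  forall e : R, 0 < e -> exists N0, forall N, (N0 <= N)%N ->
    forall z, cmod z <= r ->
      cmod (\sum_(k < N) dcoef F r N k * z ^+ k - F z) <= e.
Proof.
(* Each of the [L] contraction steps makes two errors of size [N e1 (2r) / L]; with [e1 = e / (4r)]
   they add up to [N e]. *)
move=> r0 hF e e0; pose e1 := e / (r *+ 4).
have r4 : 0 < r *+ 4 by rewrite pmulrn_lgt0.
have e10 : 0 < e1 by rewrite divr_gt0.
have [d d0 {}hF] := hF e1 e10.
have [N0 hN0] := omega_cvg (divr_gt0 d0 r0).
exists (maxn 2 N0) => N; rewrite geq_max => /andP[N1 NN0] z zr.
have NN : (0 < N)%N by apply: leq_trans N1.
have om : cmod (omega R N - 1) * r < d by rewrite -ltr_pdivlMr // hN0.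
(* A node moves by at most [2r / L] in one step, which has to stay below [d]. *)
pose L := (Num.bound (r *+ 2 / d)).+1.
have L0 : 0 < L%:R :> R by rewrite ltr0n.
have Ld : r *+ 2 / L%:R < d.
  rewrite ltr_pdivrMr // -ltr_pdivrMl // mulrC.
  apply: lt_trans (_ : (Num.bound (r *+ 2 / d))%:R < _); last by rewrite ltr_nat.
  by apply: archi_boundP; rewrite divr_ge0 ?ltW // pmulrn_lgt0.
pose c j := \sum_(k < N) (z / node r N j) ^+ k.
pose w (m j : nat) := z + (m%:R / L%:R)%:C%C * (node r N j - z).
pose P m := \sum_(j < N) F (w m j) * c j.
have wr m j : (m <= L)%N -> cmod (w m j) <= r.
  move=> mL; rewrite cmod_segment ?cmod_node //.
  by rewrite divr_ge0 //= ler_pdivrMr // mul1r ler_nat.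
have P0 : P 0%N = N%:R * F z.
  rewrite -(kernel_sum z r0 NN) mulr_suml; apply: eq_bigr => j _.
  by rewrite /w mul0r mul0r addr0 mulrC.
have PL : P L = N%:R * \sum_(k < N) dcoef F r N k * z ^+ k.
  rewrite mulr_sumr; under [RHS]eq_bigr => k _.
    rewrite mulrA [_ * dcoef _ _ _ _]mulrC divfK ?natC_neq0 // mulr_suml; over.
  rewrite exchange_big /=; apply: eq_bigr => j _.
  rewrite mulr_sumr; apply: eq_bigr => k _.
  rewrite /w divff ?gt_eqF // rmorph1 mul1r addrC subrK exprMn exprVn; ring.
have kap : cmod (1 - z ^+ N / r%:C%C ^+ N) <= 2.
  apply: le_trans (cmodB _ _) _; rewrite cmod1 cmodM cmodV !cmodX cmodR gtr0_norm //.
  have : cmod z ^+ N / r ^+ N <= 1.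
    by rewrite ler_pdivrMr ?exprn_gt0 // mul1r lerXn2r ?nnegrE ?cmod_ge0 // ltW.
  lra.
have step m : (m < L)%N -> cmod (P m - P m.+1) <= N%:R * e / L%:R.
  move=> mL.
  have wS j : w m j - w m.+1 j = - (L%:R^-1)%:C%C * (node r N j - z).
    rewrite /w -[m.+1]addn1 natrD mulrDl mul1r rmorphD /=; ring.
  have cg j : cmod (node r N j - z) <= r *+ 2.
    by apply: le_trans (cmodB _ _) _; rewrite cmod_node // mulr2n lerD2l.
  have wSc j : cmod (w m j - w m.+1 j) = cmod (node r N j - z) / L%:R.
    by rewrite wS cmodM cmodN cmodR ger0_norm ?invr_ge0 // mulrC.
  pose err j := F (w m j) - F (w m.+1 j) - F' (w m.+1 j) * (w m j - w m.+1 j).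
  (* Linearize [F] at the later points [w m.+1 j], since [polygon_sum] excludes [t = 0]. By
     [kernelM] the linear part is a [j]-independent factor times the sum that [polygon_sum]
     bounds. *)
  have -> : P m - P m.+1 = \sum_(j < N) err j * c j
      - (1 - z ^+ N / r%:C%C ^+ N) / L%:R *
        \sum_(j < N) F' (w m.+1 j) * node r N j.
    rewrite -sumrB mulr_sumr -sumrB; apply: eq_bigr => j _.
    have := kernelM j z r0 NN; rewrite -/(c j) => k1.
    have -> : (1 - z ^+ N / r%:C%C ^+ N) / L%:R * (F' (w m.+1 j) * node r N j)
       = F' (w m.+1 j) / L%:R * ((node r N j - z) * c j).
      by rewrite k1; ring.
    rewrite /err wS fmorphV /= rmorph_nat; ring.
  apply: le_trans (cmodB _ _) _.
  have b1 : cmod (\sum_(j < N) err j * c j) <= N%:R * (e1 * (r *+ 2) / L%:R).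
    apply: le_trans (cmod_sum _ _ _) _.
    rewrite mulr_natl -[N in leRHS]card_ord -sumr_const; apply: ler_sum => j _.
    rewrite cmodM.
    have h1 : cmod (err j) <= e1 * (cmod (node r N j - z) / L%:R).
      rewrite -wSc; apply: hF; rewrite ?wr // ?(ltnW mL) //.
      rewrite wSc; apply: le_lt_trans Ld; rewrite ler_wpM2r // invr_ge0 ltW //.
    apply: le_trans (ler_wpM2r (cmod_ge0 _) h1) _.
    have -> : e1 * (cmod (node r N j - z) / L%:R) * cmod (c j)
       = e1 / L%:R * (cmod ((node r N j - z) * c j)) by rewrite cmodM; ring.
    rewrite kernelM // cmodM cmod_node //.
    have -> : e1 * (r *+ 2) / L%:R = e1 / L%:R * (r * 2) by ring.
    by apply: ler_wpM2l; [rewrite divr_ge0 // ltW | rewrite ler_pM2l].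
  have b2 : cmod ((1 - z ^+ N / r%:C%C ^+ N) / L%:R *
        \sum_(j < N) F' (w m.+1 j) * node r N j) <= N%:R * (e1 * (r *+ 2) / L%:R).
    rewrite !cmodM cmodV cmod_nat.
    have t01 : 0 < (m.+1%:R / L%:R : R) <= 1.
      by rewrite divr_gt0 ?ltr0n //= ler_pdivrMr // mul1r ler_nat.
    have := polygon_sum r0 t01 N1 zr om hF => h.
    apply: le_trans (ler_wpM2l _ h) _.
      by rewrite mulr_ge0 ?cmod_ge0 // invr_ge0 ltW.
    have -> : N%:R * (e1 * (r *+ 2) / L%:R) = 2 / L%:R * (N%:R * (e1 * r)) by ring.
    apply: ler_wpM2r; first by rewrite mulr_ge0 // mulr_ge0 // ltW.
    by apply: ler_wpM2r => //; rewrite invr_ge0 ltW.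
  apply: le_trans (lerD b1 b2) _.
  have -> : e = e1 * (r *+ 4) by rewrite divfK // gt_eqF.
  by rewrite le_eqVlt; apply/orP; left; apply/eqP; ring.
have tot : cmod (P 0%N - P L) <= N%:R * e.
  have h m : (m <= L)%N -> cmod (P 0%N - P m) <= m%:R * (N%:R * e / L%:R).
    elim: m => [|m IH] mL; first by rewrite subrr cmod0 mul0r.
    apply: le_trans (cmod_tri (P m) _ _) _.
    rewrite -natr1 mulrDl mul1r; apply: lerD; last exact: step.
    by apply: IH; apply: ltnW.
  by apply: le_trans (h L (leqnn _)) _; rewrite mulrC divfK // gt_eqF.
have n0 : 0 < N%:R :> R by rewrite ltr0n.
rewrite -(ler_pM2l n0) -{1}(cmod_nat R N) -cmodM mulrBr -PL -P0 cmod_distC.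
exact: tot.
Qed.

Definition ccvg (s : nat -> C) (l : C) := forall e : R, 0 < e ->
  exists N0, forall N, (N0 <= N)%N -> cmod (s N - l) <= e.

Lemma ccvg_cst l : ccvg (fun=> l) l.
Proof. by move=> e e0; exists 0%N => N _; rewrite subrr cmod0 ltW. Qed.

Lemma ccvgD s t k l : ccvg s k -> ccvg t l -> ccvg (fun n => s n + t n) (k + l).
Proof.
move=> hs ht e e0; have e2 : 0 < e / 2 by rewrite divr_gt0.
have [N1 h1] := hs _ e2; have [N2 h2] := ht _ e2.
exists (maxn N1 N2) => N; rewrite geq_max => /andP[/h1 a1 /h2 a2].
have -> : s N + t N - (k + l) = (s N - k) + (t N - l) by ring.
by apply: le_trans (cmodD _ _) _; lra.
Qed.

Lemma ccvgZ s c l : ccvg s l -> ccvg (fun n => c * s n) (c * l).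
Proof.
move=> hs e e0; have c0 : 0 < cmod c + 1 by have := cmod_ge0 c; lra.
have [N0 h] := hs _ (divr_gt0 e0 c0); exists N0 => N /h {}h.
rewrite -mulrBr cmodM.
apply: le_trans (_ : (cmod c + 1) * (e / (cmod c + 1)) <= _); last first.
  by rewrite mulrC divfK ?gt_eqF.
by apply: ler_pM; rewrite ?cmod_ge0 ?lerDl.
Qed.

Lemma ccvgN s l : ccvg s l -> ccvg (fun n => - s n) (- l).
Proof. by move=> h e /h[N0 H]; exists N0 => N /H; rewrite -opprD cmodN. Qed.

Lemma ccvgB s t k l : ccvg s k -> ccvg t l -> ccvg (fun n => s n - t n) (k - l).
Proof. by move=> hs ht; apply: ccvgD hs (ccvgN ht). Qed.

Lemma ccvg_sum (I : Type) (r : seq I) (P : pred I) (s : I -> nat -> C) l :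
  (forall i, P i -> ccvg (s i) (l i)) ->
  ccvg (fun n => \sum_(i <- r | P i) s i n) (\sum_(i <- r | P i) l i).
Proof.
move=> h; elim: r => [|i r IH].
  by move=> e e0; exists 0%N => N _; rewrite !big_nil subrr cmod0 ltW.
have [Pi|nPi] := boolP (P i); last first.
  by move=> e /IH[N0 H]; exists N0 => N /H; rewrite !big_cons (negbTE nPi).
move=> e e0; have [N0 H] := ccvgD (h i Pi) IH e0.
by exists N0 => N /H; rewrite !big_cons Pi.
Qed.

Lemma ccvg_le s l (B : R) n0 : ccvg s l ->
  (forall n, (n0 <= n)%N -> cmod (s n) <= B) -> cmod l <= B.
Proof.
move=> hs hB; apply/ler_addgt0Pl => e e0.
have [N0 h] := hs _ e0; have := h _ (leq_maxl N0 n0).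
have := hB _ (leq_maxr N0 n0); set N := maxn _ _ => h1 h2.
have -> : l = s N - (s N - l) by ring.
by apply: le_trans (cmodB _ _) _; lra.
Qed.

Lemma ccvg_unique s k l : ccvg s k -> ccvg s l -> k = l.
Proof.
move=> hk hl; apply/eqP; rewrite -subr_eq0; apply/eqP/cmod_le0 => e e0.
apply: (@ccvg_le (fun n => s n - s n) _ _ 0); first exact: ccvgB.
by move=> n _; rewrite subrr cmod0 ltW.
Qed.

Lemma ccvg_ext s t l n0 : (forall n, (n0 <= n)%N -> s n = t n) ->
  ccvg s l -> ccvg t l.
Proof.
move=> st h e /h[N0 H]; exists (maxn N0 n0) => N.
by rewrite geq_max => /andP[/H + /st <-].
Qed.

Lemma cauchy_real (s : nat -> R) :
  (forall e : R, 0 < e -> exists N0, forall N, (N0 <= N)%N -> `|s N - s N0| <= e) ->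
  exists l, forall e : R, 0 < e ->
    exists N0, forall N, (N0 <= N)%N -> `|s N - l| <= e.
Proof.
move=> h; have c : cauchy (s n @[n --> \oo]).
  apply: cauchy_exP => e e0; have [N0 H] := h _ (divr_gt0 e0 (ltr0n R 2)).
  exists (s N0); exists N0 => // n /= /H H'.
  by rewrite /ball /= distrC (le_lt_trans H') // ltr_pdivrMr // mulr_natr mulr2n ltrDl.
move/cauchy_cvgP : c => c; exists (lim (s n @[n --> \oo])) => e e0.
move/cvgrPdist_le : c => /(_ _ e0)[N0 _ H]; exists N0 => N /H.
by rewrite distrC.
Qed.

Lemma ccauchy_cvg (s : nat -> C) :
  (forall e : R, 0 < e -> exists N0, forall N, (N0 <= N)%N -> cmod (s N - s N0) <= e) ->
  exists l, ccvg s l.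
Proof.
move=> h.
have [|x hx] := @cauchy_real (fun n => complex.Re (s n)).
  move=> e /h[N0 H]; exists N0 => N /H; apply: le_trans.
  by apply: le_trans (Re_le_cmod _); case: (s N) (s N0) => [? ?] [? ?].
have [|y hy] := @cauchy_real (fun n => complex.Im (s n)).
  move=> e /h[N0 H]; exists N0 => N /H; apply: le_trans.
  by apply: le_trans (Im_le_cmod _); case: (s N) (s N0) => [? ?] [? ?].
exists (x +i* y)%C => e e0; have e2 : 0 < e / 2 by rewrite divr_gt0.
have [N1 h1] := hx _ e2; have [N2 h2] := hy _ e2.
exists (maxn N1 N2) => N; rewrite geq_max => /andP[/h1 a1 /h2 a2].
apply: le_trans (cmod_le_ReIm _) _; case: (s N) a1 a2 => a b /=; lra.
Qed.

Lemma geo_tail (M : R) K N : 0 <= M ->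
  \sum_(K <= k < N) M / 2 ^+ k <= M * 2 / 2 ^+ K.
Proof.
move=> M0; have [NK|/ltnW KN] := leqP N K.
  by rewrite big_geq // divr_ge0 ?mulr_ge0 ?exprn_ge0.
suff -> : \sum_(K <= k < N) M / 2 ^+ k = M * 2 / 2 ^+ K - M * 2 / 2 ^+ N.
  by rewrite lerBlDr lerDl divr_ge0 ?mulr_ge0 ?exprn_ge0.
elim: N KN => [|N IH]; first by rewrite leqn0 => /eqP ->; rewrite big_geq // subrr.
rewrite leq_eqVlt => /orP[/eqP <-|KN]; first by rewrite big_geq // subrr.
rewrite big_nat_recr //= IH // exprS; field.
by rewrite !expf_neq0 // pnatr_eq0.
Qed.

Lemma sub_psum a z K N : (K <= N)%N ->
  \sum_(k < N) a k * z ^+ k - \sum_(k < K) a k * z ^+ k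
  = \sum_(K <= k < N) a k * z ^+ k.
Proof.
move=> KN; rewrite -!(big_mkord xpredT (fun k => a k * z ^+ k)).
by rewrite (@big_cat_nat _ _ _ K) //=; ring.
Qed.

(** Doubling the radius buys the factor [2^-k]; the convergence arguments below rest on this. *)
Lemma term_le a (r M : R) z k : 0 < r -> cmod z <= r ->
  (forall k, cmod (a k) * (r *+ 2) ^+ k <= M) -> cmod (a k * z ^+ k) <= M / 2 ^+ k.
Proof.
move=> r0 zr h; rewrite cmodM cmodX ler_pdivlMr ?exprn_gt0 //.
apply: le_trans (h k); rewrite -mulrA ler_wpM2l ?cmod_ge0 // -exprMn.
have zr2 : cmod z * 2 <= r *+ 2 by rewrite mulr_natr lerMn2r.
have z0 : 0 <= cmod z * 2 by rewrite mulr_ge0 ?cmod_ge0.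
by rewrite lerXn2r // nnegrE // (le_trans z0).
Qed.

Lemma psum_tail a (r M : R) z K N : 0 < r -> cmod z <= r ->
  (forall k, cmod (a k) * (r *+ 2) ^+ k <= M) -> (K <= N)%N ->
  cmod (\sum_(k < N) a k * z ^+ k - \sum_(k < K) a k * z ^+ k) <= M * 2 / 2 ^+ K.
Proof.
move=> r0 zr h KN; rewrite sub_psum //; apply: le_trans (cmod_sum _ _ _) _.
have M0 : 0 <= M by apply: le_trans (h 0%N); rewrite expr0 mulr1 cmod_ge0.
apply: le_trans (geo_tail K N M0); apply: ler_sum => k _.
exact: term_le r0 zr h.
Qed.

Lemma series_tail a (r M : R) z w K : 0 < r -> cmod z <= r ->
  (forall k, cmod (a k) * (r *+ 2) ^+ k <= M) ->
  ccvg (fun N => \sum_(k < N) a k * z ^+ k) w ->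
  cmod (\sum_(k < K) a k * z ^+ k - w) <= M * 2 / 2 ^+ K.
Proof.
move=> r0 zr h hw; rewrite cmod_distC.
apply: (ccvg_le (ccvgB hw (ccvg_cst _)) (n0 := K)) => N KN.
exact: psum_tail r0 zr h KN.
Qed.

Lemma pow2_small (M e : R) : 0 < e -> exists N0, forall N, (N0 <= N)%N -> M / 2 ^+ N <= e.
Proof.
move=> e0; exists (Num.bound `|M / e|) => N hN.
rewrite ler_pdivrMr ?exprn_gt0 // mulrC -ler_pdivrMr //.
apply: le_trans (ler_norm _) _.
apply: le_trans (_ : (Num.bound `|M / e|)%:R <= _); first by rewrite ltW // archi_boundP.
apply: le_trans (_ : N%:R <= _); first by rewrite ler_nat.
by rewrite -natrX ler_nat ltnW // ltn_expl.
Qed.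

Lemma le_pow2_small (x M B : R) N0 :
  (forall N, (N0 <= N)%N -> x <= B + M / 2 ^+ N) -> x <= B.
Proof.
move=> h; apply/ler_addgt0Pl => e e0; have [N1 H] := pow2_small M e0.
have := h _ (leq_maxl N0 N1); have := H _ (leq_maxr N0 N1); lra.
Qed.

(** Cauchy's estimate holds exactly for the partial sums, whose distance to [F] on the circle is
    [O(2^-N)]; let [N] grow. *)
Lemma series_coef_le F a (r M B : R) k : 0 < r ->
  (forall k, cmod (a k) * (r *+ 2) ^+ k <= M) ->
  (forall z, cmod z = r -> ccvg (fun N => \sum_(k < N) a k * z ^+ k) (F z)) ->
  (forall z, cmod z = r -> cmod (F z) <= B) ->
  cmod (a k) * r ^+ k <= B.
Proof.
move=> r0 h hF hB; apply: (@le_pow2_small _ (M * 2) _ k.+1) => N kN.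
apply: (@poly_coef_le a r _ N) => // z zr.
have zr' : cmod z <= r by rewrite zr.
have := series_tail N r0 zr' h (hF z zr); have := hB z zr => h1 h2.
have -> : \sum_(i < N) a i * z ^+ i = F z + (\sum_(i < N) a i * z ^+ i - F z) by ring.
by apply: le_trans (cmodD _ _) _; lra.
Qed.

Lemma series_unique F a b (r M M' : R) : 0 < r ->
  (forall k, cmod (a k) * (r *+ 2) ^+ k <= M) ->
  (forall k, cmod (b k) * (r *+ 2) ^+ k <= M') ->
  (forall z, cmod z = r -> ccvg (fun N => \sum_(k < N) a k * z ^+ k) (F z)) ->
  (forall z, cmod z = r -> ccvg (fun N => \sum_(k < N) b k * z ^+ k) (F z)) ->
  forall k, a k = b k.
Proof.
move=> r0 ha hb hF hG k.
have : cmod (a k - b k) * r ^+ k <= 0.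
  apply: (@series_coef_le (fun=> 0) (fun k => a k - b k) r (M + M') 0 k) => //.
  - move=> i; apply: le_trans (ler_wpM2r _ (cmodB _ _)) _.
      by rewrite exprn_ge0 // mulrn_wge0 // ltW.
    by rewrite mulrDl lerD.
  - move=> z zr; have := ccvgB (hF z zr) (hG z zr); rewrite subrr.
    by apply: (ccvg_ext (n0 := 0)) => N _; rewrite -sumrB; apply: eq_bigr => i _; rewrite mulrBl.
  - by move=> z _; rewrite cmod0.
rewrite pmulr_lle0 ?exprn_gt0 // => h.
apply/eqP; rewrite -subr_eq0; apply/eqP/cmod_eq0/eqP.
by rewrite eq_le h cmod_ge0.
Qed.

(** The Taylor coefficients are limits of [dcoef F r N k] in [N]. For two large values of [N] both
    discrete polynomials are near [F] on the circle, so [poly_coef_le] makes their coefficients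
    close. The bound at radius [r] yields convergence on the half disc. *)
Lemma local_series F F' (r M : R) : 0 < r -> unif_diff F F' r ->
  (forall z, cmod z = r -> cmod (F z) <= M) ->
  exists2 a, forall k, cmod (a k) * r ^+ k <= M &
    forall z, cmod z <= r / 2 -> ccvg (fun N => \sum_(k < N) a k * z ^+ k) (F z).
Proof.
move=> r0 hF hM; have conv := dcoef_cvg r0 hF.
have /choice[a ha] : forall k, exists l, ccvg (fun N => dcoef F r N k) l.
  move=> k; apply: ccauchy_cvg => e e0.
  have rk : 0 < r ^+ k by rewrite exprn_gt0.
  have [N1 h1] := conv (e * r ^+ k / 2) (divr_gt0 (mulr_gt0 e0 rk) (ltr0n R 2)).
  exists (maxn N1 k.+1); set N0 := maxn N1 k.+1 => N NN.
  have kN0 : (k < N0)%N by apply: leq_maxr.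
  have kN : (k < N)%N by apply: leq_trans NN.
  rewrite -(ler_pM2r rk).
  (* The coefficients of the difference of the two discrete polynomials, the shorter one padded with
     zeros; [N0 > k] ensures that index [k] occurs in both. *)
  pose c i := dcoef F r N i - (if (i < N0)%N then dcoef F r N0 i else 0).
  have -> : dcoef F r N k - dcoef F r N0 k = c k by rewrite /c kN0.
  apply: (poly_coef_le r0 kN) => z zr.
  have -> : \sum_(i < N) c i * z ^+ i = (\sum_(i < N) dcoef F r N i * z ^+ i - F z)
      - (\sum_(i < N0) dcoef F r N0 i * z ^+ i - F z).
    rewrite (big_ord_widen N (fun i => dcoef F r N0 i * z ^+ i) NN) [\sum_(i < N | (i < N0)%N) _]big_mkcond /=.
    have -> : forall x y w : C, x - y - (w - y) = x - w by move=> *; ring.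
    rewrite -sumrB; apply: eq_bigr => i _; rewrite /c; case: ifP => _; ring.
  have N1N0 : (N1 <= N0)%N by apply: leq_maxl.
  have zr' : cmod z <= r by rewrite zr.
  have := h1 _ N1N0 z zr'; have := h1 _ (leq_trans N1N0 NN) z zr' => h2 h3.
  by apply: le_trans (cmodB _ _) _; lra.
have bnd k : cmod (a k) * r ^+ k <= M.
  have c0 : ccvg (fun N => r%:C%C ^+ k * dcoef F r N k) (r%:C%C ^+ k * a k) by apply: ccvgZ.
  have rk : cmod (r%:C%C ^+ k : C) = r ^+ k by rewrite cmodX cmodR gtr0_norm.
  rewrite mulrC -rk -cmodM; apply: (ccvg_le c0 (n0 := 1)) => N N0.
  by rewrite cmodM rk mulrC; apply: dcoef_le.
exists a => // z zr.
have r20 : 0 < r / 2 by rewrite divr_gt0.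
have r2 : (r / 2) *+ 2 = r by rewrite -mulr_natr divfK.
(* For fixed [K], let [N] grow: the first [K] discrete coefficients converge, the whole discrete
   polynomial tends to [F z], and its part beyond [K] is at most [M * 2 / 2^K]. *)
have key K : cmod (\sum_(k < K) a k * z ^+ k - F z) <= M * 2 / 2 ^+ K.
  have hc : ccvg (fun N => \sum_(k < K) (z ^+ k * a k - z ^+ k * dcoef F r N k))
      (\sum_(k < K) (z ^+ k * a k - z ^+ k * a k)).
    by apply: ccvg_sum => i _; apply: ccvgB; [exact: ccvg_cst | exact: ccvgZ].
  apply/ler_addgt0Pl => e e0; have e2 : 0 < e / 2 by rewrite divr_gt0.
  have [N1 h1] := hc _ e2; have [N2 h2] := conv _ e2.
  pose N := (maxn (maxn N1 N2) K).+1.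
  have hN1 : (N1 <= N)%N by rewrite /N leqW // !leq_max leqnn.
  have hN2 : (N2 <= N)%N by rewrite /N leqW // !leq_max leqnn orbT.
  have hK : (K <= N)%N by rewrite /N leqW // leq_max leqnn orbT.
  have := h1 _ hN1; rewrite [X in _ - X]big1 ?subr0 => [{}h1|i _]; last by rewrite subrr.
  have zr' : cmod z <= r by apply: le_trans zr _; lra.
  have {}h2 := h2 _ hN2 z zr'.
  have h3 : cmod (\sum_(k < N) dcoef F r N k * z ^+ k - \sum_(k < K) dcoef F r N k * z ^+ k)
      <= M * 2 / 2 ^+ K.
    apply: (psum_tail r20 zr) => // k; rewrite r2; exact: dcoef_le.
  have -> : \sum_(k < K) a k * z ^+ k - F z =
     \sum_(k < K) (z ^+ k * a k - z ^+ k * dcoef F r N k)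
     + (\sum_(k < N) dcoef F r N k * z ^+ k - F z)
     - (\sum_(k < N) dcoef F r N k * z ^+ k - \sum_(k < K) dcoef F r N k * z ^+ k).
    rewrite sumrB; under [X in _ = X - _ + _ - _]eq_bigr do rewrite mulrC.
    under [X in _ = _ - X + _ - _]eq_bigr do rewrite mulrC.
    by ring.
  apply: le_trans (cmodB _ _) _; have := cmodD (\sum_(k < K) (z ^+ k * a k - z ^+ k * dcoef F r N k)) (\sum_(k < N) dcoef F r N k * z ^+ k - F z).
  lra.
move=> e e0; have [N0 h] := pow2_small (M * 2) e0.
by exists N0 => N /h; apply: le_trans.
Qed.

(** Infinite radius of convergence, expressed by Cauchy's estimates at all radii. *)
Definition entire a := forall r : R, 0 < r ->
  exists M, forall k, cmod (a k) * r ^+ k <= M.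

(** The expansion obtained at any radius at least 1 coincides with the one at radius 1, by
    uniqueness on the circle of radius 1/2, whose double is still covered by both coefficient
    bounds. *)
Lemma entire_series F F' : (forall r, 0 < r -> unif_diff F F' r) ->
  (forall r : R, 0 < r -> exists M, forall z, cmod z = r -> cmod (F z) <= M) ->
  exists2 a, entire a & forall z, ccvg (fun N => \sum_(k < N) a k * z ^+ k) (F z).
Proof.
move=> hF hM.
have loc (r : R) : 0 < r -> exists a M, (forall k, cmod (a k) * r ^+ k <= M) /\
    forall z, cmod z <= r / 2 -> ccvg (fun N => \sum_(k < N) a k * z ^+ k) (F z).
  move=> r0; have [M hMr] := hM r r0.
  by have [a] := local_series r0 (hF r r0) hMr; exists a, M.
have [a [M [ha hFa]]] := loc 1 ltr01.
have h20 : 0 < 1 / 2 :> R by rewrite divr_gt0.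
have h21 : (1 / 2) *+ 2 = 1 :> R by rewrite -mulr_natr divfK.
have eqa (r : R) : 1 <= r -> exists M, (forall k, cmod (a k) * r ^+ k <= M) /\
    forall z, cmod z <= r / 2 -> ccvg (fun N => \sum_(k < N) a k * z ^+ k) (F z).
  move=> r1; have r0 : 0 < r by apply: lt_le_trans r1.
  have [b [M' [hb hFb]]] := loc r r0.
  suff ab k : a k = b k.
    exists M'; split=> [k|z zr]; first by rewrite ab.
    by apply: (ccvg_ext (n0 := 0)) (hFb z zr) => N _; apply: eq_bigr => i _; rewrite ab.
  apply: (@series_unique F a b (1 / 2) M M') => // [i|i|z zr|z zr].
  - by rewrite h21.
  - rewrite h21; apply: le_trans (hb i); rewrite ler_wpM2l ?cmod_ge0 //.
    by rewrite expr1n exprn_ege1.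
  - by apply: hFa; rewrite zr.
  - by apply: hFb; rewrite zr ler_wpM2r // invr_ge0.
exists a => [r r0|z].
  have r1 : 1 <= r + 1 by lra.
  have [M' [h _]] := eqa _ r1; exists M' => k; apply: le_trans (h k).
  by rewrite ler_wpM2l ?cmod_ge0 // lerXn2r ?nnegrE ?ltW //; lra.
have r1 : 1 <= cmod z *+ 2 + 1 by rewrite lerDr mulrn_wge0 ?cmod_ge0.
have [M' [_ h]] := eqa _ r1; apply: h.
by rewrite ler_pdivlMr // mulr_natr lerDl.
Qed.

End Cauchy.

(** * Power series from the Cauchy-Riemann equations *)

Section RealAnalysis.
Variable R : realType.
Local Open Scope classical_set_scope.

Lemma mean_value (f : R -> R) a b : (forall t, derivable f t 1) ->
  exists c, [/\ f b - f a = derive1 f c * (b - a), `|c - a| <= `|b - a| &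
    forall r, `|a| <= r -> `|b| <= r -> `|c| <= r].
Proof.
move=> df; have dr x : is_derive x (1 : R) f (derive1 f x).
  by rewrite derive1E; apply/derivableP.
have cf (i : interval R) : {within [set` i], continuous f}.
  by apply: derivable_within_continuous => x _.
have [ab|ba] := leP a b.
  have [c /[!in_itv] /= /andP[ac cb] e] := MVT_segment ab (fun x _ => dr x) (cf _).
  exists c; split=> //; first by rewrite !ger0_norm ?subr_ge0 ?lerD2r.
  by move=> r; rewrite !ler_norml => *; lra.
have [c /[!in_itv] /= /andP[ac cb] e] := MVT_segment (ltW ba) (fun x _ => dr x) (cf _).
exists c; split=> //; first by lra.
  by rewrite !ler0_norm ?subr_le0 ?(ltW ba) // lerN2 lerD2r.
by move=> r; rewrite !ler_norml => *; lra.
Qed.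

Lemma box_compact (r : R) : compact ([set p | `|p.1| <= r /\ `|p.2| <= r] : set (R * R)).
Proof.
have -> : [set p : R * R | `|p.1| <= r /\ `|p.2| <= r] = `[- r, r] `*` `[- r, r].
  by apply/seteqP; split => -[x y] /=; rewrite !in_itv /= -!ler_norml.
by apply: compact_setX; apply: segment_compact.
Qed.

Lemma unif_cont_box (h : R * R -> R) (r e : R) : continuous h -> 0 < e ->
  exists2 d : R, 0 < d & forall p q : R * R, `|p.1| <= r -> `|p.2| <= r ->
    `|q.1 - p.1| < d -> `|q.2 - p.2| < d -> `|h q - h p| <= e.
Proof.
move=> ch e0; have e2 : 0 < e / 2 by rewrite divr_gt0.
pose P (d : R) (p : R * R) := forall q : R * R,
  `|q.1 - p.1| < d -> `|q.2 - p.2| < d -> `|h q - h p| <= e.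
have : \forall d \near (0 : R)^'+, [set p : R * R | `|p.1| <= r /\ `|p.2| <= r] `<=` P d.
  have /compact_near_coveringP := @box_compact r; apply => x _.
  have /cvgrPdist_lt /(_ _ e2) := ch x.
  rewrite -nbhs_ballE => -[d /= d0 hd].
  have d2 : 0 < d / 2 by rewrite divr_gt0.
  exists (ball x (d / 2), [set t | t < d / 2]).
    by split => /=; [exact: nbhsx_ballx | exact: nbhs_right_lt].
  move=> [y t] [/= [y1 y2] /= td] q q1 q2.
  have xq : ball x d q.
    split; rewrite /ball /=.
      have := ler_distD y.1 x.1 q.1; rewrite /ball /= in y1.
      by rewrite [`|y.1 - q.1|]distrC; move: y1 q1 td; lra.
    have := ler_distD y.2 x.2 q.2; rewrite /ball /= in y2.
    by rewrite [`|y.2 - q.2|]distrC; move: y2 q2 td; lra.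
  have xy : ball x d y.
    by split; apply: (@le_ball _ _ _ (d / 2)) => //; lra.
  have h1 := hd _ xq; have h2 := hd _ xy.
  have := ler_distD (h x) (h q) (h y); rewrite [`|h q - h x|]distrC.
  by move: h1 h2 => /=; lra.
rewrite /at_right /within /= -nbhs_ballE => -[d /= d0 hd].
have d2 : 0 < d / 2 by rewrite divr_gt0.
exists (d / 2) => // p q p1 p2; apply: (hd (d / 2)) => //.
by rewrite /ball /= sub0r normrN gtr0_norm //; lra.
Qed.

Lemma bounded_box (h : R * R -> R) (r : R) : continuous h ->
  exists M, forall p, `|p.1| <= r -> `|p.2| <= r -> `|h p| <= M.
Proof.
move=> ch; have := continuous_compact (continuous_subspaceT ch) (@box_compact r).
move/compact_bounded => [M [_ /(_ (M + 1)) hM]]; exists (M + 1) => p p1 p2.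
by apply: hM; [lra | exists p].
Qed.

(** Go from [(u, v)] through [(u, v')] to [(u', v')] and apply the mean value theorem on each leg;
    uniform continuity of the partial derivatives on the square makes the error uniform. *)
Lemma C1_diff (g : R -> R -> R) (r e : R) : C1_2 g -> 0 < e ->
  exists2 d : R, 0 < d & forall u v u' v', `|u| <= r -> `|v| <= r -> `|u'| <= r -> `|v'| <= r ->
    `|u' - u| < d -> `|v' - v| < d ->
    `|g u' v' - g u v - derive1 (fun t => g t v) u * (u' - u)
      - derive1 (fun t => g u t) v * (v' - v)| <= e * (`|u' - u| + `|v' - v|).
Proof.
move=> [dg [cu cv]] e0.
have [d1 d10 h1] := unif_cont_box r cu e0.
have [d2 d20 h2] := unif_cont_box r cv e0.
exists (Num.min d1 d2); first by rewrite lt_min d10.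
move=> u v u' v' ur vr ur' vr'; rewrite !lt_min => /andP[u1 u2] /andP[v1 v2].
have [c [ec c1 c2]] := mean_value u u' (fun t => (dg t v').1).
have [k [ek k1 k2]] := mean_value v v' (fun t => (dg u t).2).
have -> : g u' v' - g u v - derive1 (fun t => g t v) u * (u' - u)
      - derive1 (fun t => g u t) v * (v' - v)
  = (derive1 (fun t => g t v') c - derive1 (fun t => g t v) u) * (u' - u)
   + (derive1 (fun t => g u t) k - derive1 (fun t => g u t) v) * (v' - v).
  rewrite [in RHS]mulrBl [in RHS]mulrBl -ec -ek; ring.
apply: le_trans (ler_normD _ _) _; rewrite !normrM mulrDr.
apply: lerD; apply: ler_wpM2r => //.
  by apply: (h1 (u, v) (c, v')) => //=; apply: le_lt_trans c1 _.
by apply: (h2 (u, v) (u, k)) => //=; [rewrite subrr normr0 | apply: le_lt_trans k1 _].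
Qed.

Lemma C1_bounded (g : R -> R -> R) (r : R) : C1_2 g ->
  exists M, forall u v, `|u| <= r -> `|v| <= r -> `|g u v| <= M.
Proof.
move=> [dg [cu cv]].
have [M1 h1] := bounded_box r cu; have [M2 h2] := bounded_box r cv.
exists (`|g 0 0| + M1 * r + M2 * r) => u v ur vr.
have r0 : 0 <= r by apply: le_trans ur.
have z0 : `|0 : R| <= r by rewrite normr0.
have [c [ec c1 /(_ r z0 ur) c2]] := mean_value 0 u (fun t => (dg t v).1).
have [k [ek k1 /(_ r z0 vr) k2]] := mean_value 0 v (fun t => (dg 0 t).2).
have -> : g u v = g 0 0 + (g u v - g 0 v) + (g 0 v - g 0 0) by ring.
rewrite ec ek !subr0.
apply: le_trans (ler_normD _ _) _; apply: lerD; last first.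
  by rewrite normrM ler_pM //; exact: (h2 (0, k)).
apply: le_trans (ler_normD _ _) _; rewrite lerD2l.
by rewrite normrM ler_pM //; exact: (h1 (c, v)).
Qed.

Lemma quad_derive (f : R -> R) (u l K d : R) : 0 < d ->
  (forall h, `|h| < d -> `|f (u + h) - f u - l * h| <= K * h ^+ 2) ->
  is_derive u (1 : R) f l.
Proof.
move=> d0 hf.
have c : (h^-1 *: ((f \o shift u) (h *: 1) - f u) @[h --> 0^'] --> l).
  apply/cvgrPdist_le => e e0.
  have K0 : 0 < `|K| + 1 by rewrite ltr_wpDl.
  near=> h.
  have h0 : h != 0 by near: h; exact: nbhs_dnbhs_neq.
  have hd : `|h| < d by near: h; exact: dnbhs0_lt.
  have he : `|h| < e / (`|K| + 1) by near: h; apply: dnbhs0_lt; rewrite divr_gt0.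
  have hp : 0 < `|h| by rewrite normr_gt0.
  rewrite /= /shift /= -[h *: 1]/(h * 1) -[_ *: _]/(_ * _) mulr1 [h + u]addrC.
  have -> : l - h^-1 * (f (u + h) - f u) = - (h^-1 * (f (u + h) - f u - l * h)) by field.
  rewrite normrN normrM normfV mulrC ler_pdivrMr //.
  apply: le_trans (hf h hd) _; rewrite -(real_normK (num_real h)) expr2 mulrA ler_pM2r //.
  apply: le_trans (_ : (`|K| + 1) * `|h| <= _); last by rewrite mulrC -ler_pdivlMr // ltW.
  by rewrite ler_wpM2r // (le_trans (ler_norm _)) // lerDl.
by apply: DeriveDef; [apply/cvg_ex; exists l | apply/cvg_lim].
Unshelve. all: by end_near.
Qed.

End RealAnalysis.

(** * Sums of everywhere convergent power series *)

Section Holo.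
Variable R : realType.
Local Notation C := (complex R).
Local Open Scope classical_set_scope.
Implicit Types (F G : C -> C) (a b : nat -> C) (z w : C).

Lemma CR_unif_diff (f0 f1 : R -> R -> R) (r : R) : C1_2 f0 -> C1_2 f1 ->
  (forall u v, derive1 (fun t => f0 t v) u = derive1 (fun t => f1 u t) v) ->
  (forall u v, derive1 (fun t => f0 u t) v = - derive1 (fun t => f1 t v) u) ->
  unif_diff (fun z => (f0 (complex.Re z) (complex.Im z) +i* f1 (complex.Re z) (complex.Im z))%C)
    (fun z => (derive1 (fun t => f0 t (complex.Im z)) (complex.Re z)
       +i* derive1 (fun t => f1 t (complex.Im z)) (complex.Re z))%C) r.
Proof.
(* Two real components, and both [|u' - u|] and [|v' - v|] are at most the modulus: four
   contributions. *)
move=> c0 c1 cr1 cr2 e e0; have e4 : 0 < e / 4 by rewrite divr_gt0.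
have [d0 d00 h0] := C1_diff r c0 e4; have [d1 d10 h1] := C1_diff r c1 e4.
exists (Num.min d0 d1); first by rewrite lt_min d00.
move=> [u v] [u' v'] zr wr hd.
have du := le_lt_trans (Re_le_cmod _) hd; have dv := le_lt_trans (Im_le_cmod _) hd.
move: du dv; rewrite /= !lt_min => /andP[du0 du1] /andP[dv0 dv1].
have ur := le_trans (Re_le_cmod _) zr; have vr := le_trans (Im_le_cmod _) zr.
have ur' := le_trans (Re_le_cmod _) wr; have vr' := le_trans (Im_le_cmod _) wr.
move: ur vr ur' vr' => /= ur vr ur' vr'.
have := h0 u v u' v' ur vr ur' vr' du0 dv0.
have := h1 u v u' v' ur vr ur' vr' du1 dv1.
rewrite cr2 -cr1.
move: (derive1 _ u) (derive1 _ u) => p q H1 H0.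
apply: le_trans (cmod_le_ReIm _) _ => /=.
have ha : `|u' - u| <= cmod ((u' +i* v')%C - (u +i* v)%C).
  exact: (Re_le_cmod ((u' +i* v')%C - (u +i* v)%C)).
have hb : `|v' - v| <= cmod ((u' +i* v')%C - (u +i* v)%C).
  exact: (Im_le_cmod ((u' +i* v')%C - (u +i* v)%C)).
set m := cmod _ in ha hb *.
have ab : e / 4 * (`|u' - u| + `|v' - v|) <= e / 4 * (m *+ 2).
  by apply: ler_wpM2l; [exact: ltW | rewrite mulr2n; apply: lerD].
have -> : f0 u' v' - f0 u v - (p * (u' - u) - q * (v' - v))
   = f0 u' v' - f0 u v - p * (u' - u) - - q * (v' - v) by ring.
have -> : f1 u' v' - f1 u v - (p * (v' - v) + q * (u' - u))
   = f1 u' v' - f1 u v - q * (u' - u) - p * (v' - v) by ring.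
apply: le_trans (lerD H0 H1) _.
by apply: le_trans (lerD ab ab) _; rewrite le_eqVlt; apply/orP; left; apply/eqP; field.
Qed.

(* The sum of the series; [0] where it diverges. *)
Definition cser a z : C := xget 0 [set l | ccvg (fun N => \sum_(k < N) a k * z ^+ k) l].

Lemma cser_eq a z l : ccvg (fun N => \sum_(k < N) a k * z ^+ k) l -> cser a z = l.
Proof. by move=> h; apply: ccvg_unique (xgetPex 0 (ex_intro _ l h)) h. Qed.

Lemma cser_cvg a z : entire a -> ccvg (fun N => \sum_(k < N) a k * z ^+ k) (cser a z).
Proof.
move=> ha; have r0 : 0 < cmod z + 1 by rewrite ltr_wpDl ?cmod_ge0.
have [M hM] := ha _ (mulr_gt0 (ltr0n R 2) r0).
have [l hl] : exists l, ccvg (fun N => \sum_(k < N) a k * z ^+ k) l.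
  apply: ccauchy_cvg => e e0; have [N0 h] := pow2_small (M * 2) e0.
  exists N0 => N NN; apply: le_trans (h N0 (leqnn _)).
  apply: (psum_tail r0) => //; first by rewrite lerDl.
  by move=> k; apply: le_trans (hM k); rewrite [2 * _]mulrC mulr_natr.
by rewrite (cser_eq hl).
Qed.

Lemma entire_shift (r : R) a : entire a -> 0 < r ->
  exists M, 0 <= M /\ forall k, cmod (a k) * r ^+ k <= M.
Proof.
move=> ha /ha[M h]; exists M; split=> //.
by apply: le_trans (h 0%N); rewrite expr0 mulr1 cmod_ge0.
Qed.

Lemma entireD a b : entire a -> entire b -> entire (fun k => a k + b k).
Proof.
move=> ha hb r r0; have [M h] := ha r r0; have [M' h'] := hb r r0.
exists (M + M') => k; apply: le_trans (ler_wpM2r _ (cmodD _ _)) _.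
  by rewrite exprn_ge0 ?ltW.
by rewrite mulrDl lerD.
Qed.

Lemma entireZ c a : entire a -> entire (fun k => c * a k).
Proof.
move=> ha r r0; have [M h] := ha r r0; exists (cmod c * M) => k.
by rewrite cmodM -mulrA ler_wpM2l ?cmod_ge0.
Qed.

Lemma cserD a b z : entire a -> entire b ->
  cser (fun k => a k + b k) z = cser a z + cser b z.
Proof.
move=> ha hb; apply: cser_eq.
apply: (ccvg_ext (n0 := 0)) (ccvgD (cser_cvg z ha) (cser_cvg z hb)) => N _.
by rewrite -big_split; apply: eq_bigr => i _; rewrite mulrDl.
Qed.

Lemma cserZ c a z : entire a -> cser (fun k => c * a k) z = c * cser a z.
Proof.
move=> ha; apply: cser_eq; apply: (ccvg_ext (n0 := 0)) (ccvgZ c (cser_cvg z ha)) => N _.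
by rewrite mulr_sumr; apply: eq_bigr => i _; rewrite mulrA.
Qed.

Definition dcoefs a : nat -> C := fun k => k.+1%:R * a k.+1.

Lemma entire_dcoefs a : entire a -> entire (dcoefs a).
Proof.
move=> ha r r0; have r2 : 0 < r *+ 2 by rewrite pmulrn_lgt0.
have [M h] := ha _ r2.
exists (M / r) => k; rewrite ler_pdivlMr // cmodM cmod_nat.
apply: le_trans (h k.+1); rewrite -[r *+ 2]mulr_natr exprMn [r ^+ k.+1]exprSr.
rewrite [k.+1%:R * _]mulrC -!mulrA ler_wpM2l ?cmod_ge0 // !mulrA.
rewrite -[_ * _ * r]mulrA.
have -> : r ^+ k * r * 2 ^+ k.+1 = 2 ^+ k.+1 * (r ^+ k * r) by rewrite mulrC.
rewrite ler_wpM2r ?mulr_ge0 ?exprn_ge0 ?ltW //.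
by rewrite -natrX ltr_nat ltn_expl.
Qed.

(** Induction through [w (w^k - z^k - k z^(k-1) (w - z)) + k z^(k-1) (w - z)^2]. The constant is
    crude: [k^2 + k <= (k+1)^2] closes the induction, and [r >= 1] allows exponents to be raised. *)
Lemma pow_quad (r : R) z w k : 1 <= r -> cmod z <= r -> cmod w <= r ->
  cmod (w ^+ k - z ^+ k - k%:R * z ^+ k.-1 * (w - z)) <= k%:R ^+ 2 * r ^+ k * cmod (w - z) ^+ 2.
Proof.
move=> r1 zr wr; have r0 : 0 <= r by lra.
elim: k => [|k IH].
  by rewrite !expr0 subrr mul0r mul0r subrr cmod0 expr0n /= mul0r mul0r.
have -> : w ^+ k.+1 - z ^+ k.+1 - k.+1%:R * z ^+ k.+1.-1 * (w - z)
  = w * (w ^+ k - z ^+ k - k%:R * z ^+ k.-1 * (w - z)) + k%:R * z ^+ k.-1 * (w - z) ^+ 2.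
  case: k {IH} => [|k] /=; first by rewrite !expr1 !expr0; ring.
  by rewrite -[k.+2%:R]natr1 !exprS; ring.
apply: le_trans (cmodD _ _) _; rewrite !cmodM !cmodX cmod_nat.
set m := cmod (w - z) in IH *.
have h1 := ler_pM (cmod_ge0 w) (cmod_ge0 _) wr IH.
have h2 : cmod z ^+ k.-1 <= r ^+ k.+1.
  apply: le_trans (_ : r ^+ k.-1 <= _); first by rewrite lerXn2r ?nnegrE ?cmod_ge0.
  by apply: ler_weXn2l => //; case: k {IH h1} => //= k; rewrite -addn2 leq_addr.
have m0 : 0 <= m ^+ 2 by rewrite sqr_ge0.
have h3 : k%:R * cmod z ^+ k.-1 * m ^+ 2 <= k%:R * r ^+ k.+1 * m ^+ 2.
  by rewrite ler_wpM2r // ler_wpM2l.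
apply: le_trans (lerD h1 h3) _.
have -> : r * (k%:R ^+ 2 * r ^+ k * m ^+ 2) + k%:R * r ^+ k.+1 * m ^+ 2
  = (k%:R ^+ 2 + k%:R) * r ^+ k.+1 * m ^+ 2 by rewrite [r ^+ k.+1]exprS; ring.
rewrite ler_wpM2r // ler_wpM2r ?exprn_ge0 // -natr1.
have : 0 <= k%:R :> R by []; set x : R := k%:R; move=> x0.
by rewrite sqrrD expr1n mulr1; lra.
Qed.

(** A quadratic remainder, uniform on discs; it yields the partial derivatives, continuity, and
    [unif_diff] of products. *)
Lemma cser_quad a (r : R) : entire a -> 0 < r ->
  exists K, forall z w, cmod z <= r -> cmod w <= r ->
    cmod (cser a w - cser a z - cser (dcoefs a) z * (w - z)) <= K * cmod (w - z) ^+ 2.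
Proof.
move=> ha r0; have r1 : 1 <= r + 1 by lra.
(* Of the three factors [2^k] in [8^k], two absorb [k^2] and the third makes the series
   geometric. *)
have r8 : 0 < (r + 1) * 8 by rewrite mulr_gt0 //; lra.
have [M [M0 h]] := entire_shift ha r8.
exists (M * 2) => z w zr wr.
have hs : ccvg (fun N => \sum_(k < N.+1) a k * (w ^+ k - z ^+ k - k%:R * z ^+ k.-1 * (w - z)))
    (cser a w - cser a z - cser (dcoefs a) z * (w - z)).
  have shift (s : nat -> C) l : ccvg s l -> ccvg (fun n => s n.+1) l.
    by move=> hs e /hs[N0 H]; exists N0 => N hN; apply: H; apply: leqW.
  have c1 := shift _ _ (cser_cvg w ha); have c2 := shift _ _ (cser_cvg z ha).
  have c3 := ccvgZ (w - z) (cser_cvg z (entire_dcoefs ha)).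
  have := ccvgB (ccvgB c1 c2) c3; rewrite [(w - z) * _]mulrC.
  apply: (ccvg_ext (n0 := 0)) => N _.
  under [RHS]eq_bigr do rewrite 2!mulrBr.
  rewrite !sumrB; congr (_ - _); rewrite [RHS]big_ord_recl /= mul0r mul0r mulr0 add0r mulr_sumr.
  by apply: eq_bigr => i _; rewrite /dcoefs /bump /= add1n; ring.
apply: (ccvg_le hs (n0 := 0)) => N _.
apply: le_trans (cmod_sum _ _ _) _.
apply: le_trans (_ : \sum_(k < N.+1) M / 2 ^+ k * cmod (w - z) ^+ 2 <= _); last first.
  rewrite -mulr_suml ler_wpM2r ?sqr_ge0 //.
  have := geo_tail 0 N.+1 M0; rewrite expr0 divr1; apply: le_trans.
  by rewrite big_mkord.
apply: ler_sum => k _; rewrite cmodM.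
have zr' : cmod z <= r + 1 by lra.
have wr' : cmod w <= r + 1 by lra.
apply: le_trans (ler_wpM2l (cmod_ge0 _) (pow_quad k r1 zr' wr')) _.
rewrite mulrA ler_wpM2r ?sqr_ge0 // ler_pdivlMr ?exprn_gt0 //.
apply: le_trans (h k); rewrite -mulrA ler_wpM2l ?cmod_ge0 //.
have -> : ((r + 1) * 8) ^+ k = (r + 1) ^+ k * (2 ^+ k * (2 ^+ k * 2 ^+ k)).
  by rewrite -!exprMn; congr (_ ^+ _); ring.
have -> : k%:R ^+ 2 * (r + 1) ^+ k * 2 ^+ k = (r + 1) ^+ k * (2 ^+ k * k%:R ^+ 2) by ring.
have r10 : 0 <= r + 1 by lra.
rewrite ler_wpM2l ?exprn_ge0 // ler_wpM2l ?exprn_ge0 // expr2.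
by rewrite -natrX -!natrM ler_nat leq_mul // ltnW // ltn_expl.
Qed.

Lemma cser_bounded a (r : R) : entire a -> exists M, forall z, cmod z <= r -> cmod (cser a z) <= M.
Proof.
move=> ha; have r0 : 0 < `|r| + 1 by rewrite ltr_wpDl.
have [M h] := ha _ (mulr_gt0 (ltr0n R 2) r0); exists (M * 2) => z zr.
have zr' : cmod z <= `|r| + 1.
  by apply: le_trans zr (le_trans (ler_norm _) _); rewrite lerDl.
have h' k : cmod (a k) * ((`|r| + 1) *+ 2) ^+ k <= M.
  by apply: le_trans (h k); rewrite [2 * _]mulrC mulr_natr.
have := series_tail 0 r0 zr' h' (cser_cvg z ha).
by rewrite big_ord0 sub0r cmodN expr0 divr1.
Qed.

Definition holo F := exists2 a, entire a & forall z, F z = cser a z.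

Lemma quad_unif_diff F F' (r : R) K : 0 < r ->
  (forall z w, cmod z <= r -> cmod w <= r ->
    cmod (F w - F z - F' z * (w - z)) <= K * cmod (w - z) ^+ 2) -> unif_diff F F' r.
Proof.
move=> r0 h e e0; have K0 : 0 < `|K| + 1 by rewrite ltr_wpDl.
exists (e / (`|K| + 1)); first by rewrite divr_gt0.
move=> z w zr wr hd; apply: le_trans (h z w zr wr) _; rewrite expr2 mulrA.
rewrite ler_wpM2r ?cmod_ge0 //.
apply: le_trans (_ : (`|K| + 1) * cmod (w - z) <= _); last by rewrite mulrC -ler_pdivlMr // ltW.
by rewrite ler_wpM2r ?cmod_ge0 // (le_trans (ler_norm _)) // lerDl.
Qed.

(** The product is expanded afresh by [entire_series], its quadratic remainder coming from those of
    the factors; no Cauchy product of coefficients is computed. *)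
Lemma holoM F G : holo F -> holo G -> holo (fun z => F z * G z).
Proof.
move=> [a ha Fa] [b hb Gb].
have [c hc cc] : exists2 c, entire c &
    forall z, ccvg (fun N => \sum_(k < N) c k * z ^+ k) (cser a z * cser b z).
  apply: (@entire_series _ _ (fun z => cser (dcoefs a) z * cser b z + cser a z * cser (dcoefs b) z)).
    move=> r r0.
    have [Ka ka] := cser_quad ha r0; have [Kb kb] := cser_quad hb r0.
    have [A hA] := cser_bounded r ha; have [B hB] := cser_bounded r hb.
    have [A' hA'] := cser_bounded r (entire_dcoefs ha).
    have [B' hB'] := cser_bounded r (entire_dcoefs hb).
    have c0 : cmod (0 : C) <= r by rewrite cmod0 ltW.
    have A0 := le_trans (cmod_ge0 _) (hA _ c0); have B0 := le_trans (cmod_ge0 _) (hB _ c0).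
    have A0' := le_trans (cmod_ge0 _) (hA' _ c0); have B0' := le_trans (cmod_ge0 _) (hB' _ c0).
    apply: (@quad_unif_diff _ _ _ (Ka * B + A' * (B' + `|Kb| * (r *+ 2)) + A * Kb) r0).
    move=> z w zr wr; have dr : cmod (w - z) <= r *+ 2.
      by apply: le_trans (cmodB _ _) _; rewrite mulr2n lerD.
    have := ka z w zr wr; have := kb z w zr wr; have m0 := cmod_ge0 (w - z).
    set p := _ - _ - _ * _; set q := _ - _ - _ * _ => hp hq.
    have -> : cser a w * cser b w - cser a z * cser b z
       - (cser (dcoefs a) z * cser b z + cser a z * cser (dcoefs b) z) * (w - z)
       = q * cser b w + cser (dcoefs a) z * (w - z) * (cser (dcoefs b) z * (w - z) + p) + cser a z * p.
      rewrite /p /q; move: (cser a w) (cser b w) (cser a z) (cser b z).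
      by move: (cser (dcoefs a) z) (cser (dcoefs b) z) => *; ring.
    set m := cmod (w - z) in hp hq m0 dr *.
    apply: le_trans (cmodD _ _) _; rewrite [leRHS]mulrDl; apply: lerD; last first.
      by rewrite cmodM -[A * _ * _]mulrA ler_pM ?cmod_ge0 // hA.
    apply: le_trans (cmodD _ _) _; rewrite [leRHS]mulrDl; apply: lerD.
      rewrite cmodM mulrAC ler_pM ?cmod_ge0 //; exact: hB.
    rewrite cmodM.
    have -> : A' * (B' + `|Kb| * (r *+ 2)) * m ^+ 2 = (A' * m) * (B' * m + `|Kb| * ((r *+ 2) * m)) by ring.
    apply: ler_pM; rewrite ?cmod_ge0 //.
      by rewrite cmodM ler_wpM2r ?hA'.
    apply: le_trans (cmodD _ _) _; apply: lerD; first by rewrite cmodM ler_wpM2r ?hB'.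
    apply: le_trans hp _; apply: le_trans (ler_wpM2r (sqr_ge0 _) (ler_norm Kb)) _.
    by rewrite ler_wpM2l // expr2 ler_wpM2r.
  move=> r r0; have [A hA] := cser_bounded r ha; have [B hB] := cser_bounded r hb.
  exists (A * B) => z zr; rewrite cmodM ler_pM ?cmod_ge0 //; [apply: hA | apply: hB]; by rewrite zr.
by exists c => // z; rewrite Fa Gb (cser_eq (cc z)).
Qed.

End Holo.

(** * Real and imaginary parts; reality of the coefficients *)

Section Components.
Variable R : realType.
Local Notation C := (complex R).
Local Open Scope classical_set_scope.
Implicit Types (F G : C -> C) (a b : nat -> C) (z w : C).

Lemma cser_derive a (u v : R) : entire a ->
  [/\ is_derive u (1 : R) (fun t => complex.Re (cser a (t +i* v)%C)) (complex.Re (cser (dcoefs a) (u +i* v)%C)),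
     is_derive u (1 : R) (fun t => complex.Im (cser a (t +i* v)%C)) (complex.Im (cser (dcoefs a) (u +i* v)%C)),
     is_derive v (1 : R) (fun t => complex.Re (cser a (u +i* t)%C)) (- complex.Im (cser (dcoefs a) (u +i* v)%C)) &
     is_derive v (1 : R) (fun t => complex.Im (cser a (u +i* t)%C)) (complex.Re (cser (dcoefs a) (u +i* v)%C))].
Proof.
move=> ha; pose r := cmod (u +i* v)%C + 1.
have r0 : 0 < r by rewrite ltr_wpDl ?cmod_ge0.
have [K hK] := cser_quad ha r0.
have zr : cmod (u +i* v)%C <= r by rewrite lerDl.
(* Real increments with [c = 1] and [c = i] give the two partial derivatives from the one complex
   derivative [p + iq]. *)
have key (h c : C) : cmod c = 1 -> cmod h < 1 ->
    cmod (cser a ((u +i* v)%C + c * h) - cser a (u +i* v)%C - cser (dcoefs a) (u +i* v)%C * (c * h))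
    <= K * cmod h ^+ 2.
  move=> c1 h1; have e : (u +i* v)%C + c * h - (u +i* v)%C = c * h by ring.
  have := hK (u +i* v)%C ((u +i* v)%C + c * h) zr; rewrite e cmodM c1 mul1r; apply.
  by apply: le_trans (cmodD _ _) _; rewrite cmodM c1 mul1r lerD2l ltW.
move: (cser (dcoefs a) (u +i* v)%C) key => [p q] key.
have kR (h : R) : `|h| < 1 -> cmod (cser a ((u + h) +i* v)%C - cser a (u +i* v)%C - (p +i* q)%C * h%:C%C)
    <= K * h ^+ 2.
  move=> h1; have := key h%:C%C 1 (cmod1 R); rewrite mul1r cmodR real_normK ?num_real // => /(_ h1).
  have -> // : (u +i* v)%C + h%:C%C = ((u + h) +i* v)%C.
  by apply/eqP; rewrite eq_complex /= addr0 !eqxx.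
have ki1 : cmod (0 +i* 1)%C = 1 :> R by rewrite cmodE /= expr0n add0r expr1n sqrtr1.
have kI (h : R) : `|h| < 1 -> cmod (cser a (u +i* (v + h))%C - cser a (u +i* v)%C - (- q +i* p)%C * h%:C%C)
    <= K * h ^+ 2.
  move=> h1; have := key h%:C%C (0 +i* 1)%C ki1; rewrite cmodR real_normK ?num_real // => /(_ h1).
  have -> : (u +i* v)%C + (0 +i* 1)%C * h%:C%C = (u +i* (v + h))%C.
    by apply/eqP; rewrite eq_complex /=; apply/andP; split; apply/eqP; ring.
  have -> : (p +i* q)%C * ((0 +i* 1)%C * h%:C%C) = (- q +i* p)%C * h%:C%C.
    by apply/eqP; rewrite eq_complex /=; apply/andP; split; apply/eqP; ring.
  by [].
split; apply: (@quad_derive _ _ _ _ K 1) => // h h1.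
- apply: le_trans (kR h h1); apply: le_trans (Re_le_cmod _).
  by case: (cser _ _) (cser _ _) => ? ? [? ?] /=; rewrite mulr0 subr0.
- apply: le_trans (kR h h1); apply: le_trans (Im_le_cmod _).
  by case: (cser _ _) (cser _ _) => ? ? [? ?] /=; rewrite mulr0 add0r.
- apply: le_trans (kI h h1); apply: le_trans (Re_le_cmod _).
  by case: (cser _ _) (cser _ _) => ? ? [? ?] /=; rewrite mulr0 subr0.
- apply: le_trans (kI h h1); apply: le_trans (Im_le_cmod _).
  by case: (cser _ _) (cser _ _) => ? ? [? ?] /=; rewrite mulr0 add0r.
Qed.

Lemma cser_continuous a z (e : R) : entire a -> 0 < e ->
  exists2 d : R, 0 < d & forall w, cmod (w - z) < d -> cmod (cser a w - cser a z) <= e.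
Proof.
move=> ha e0; pose r := cmod z + 1.
have r0 : 0 < r by rewrite ltr_wpDl ?cmod_ge0.
have [K hK] := cser_quad ha r0.
have zr : cmod z <= r by rewrite lerDl.
set B := cmod (cser (dcoefs a) z).
have B0 : 0 <= B by exact: cmod_ge0.
have D0 : 0 < `|K| + B + 1 by rewrite ltr_wpDl // addr_ge0.
exists (Num.min 1 (e / (`|K| + B + 1))); first by rewrite lt_min ltr01 divr_gt0.
move=> w; rewrite lt_min => /andP[m1 m2].
have wr : cmod w <= r.
  have -> : w = z + (w - z) by ring.
  by apply: le_trans (cmodD _ _) _; rewrite lerD2l ltW.
have := hK z w zr wr; set m := cmod (w - z) in m1 m2 * => h.
have m0 : 0 <= m by exact: cmod_ge0.
have -> : cser a w - cser a z = (cser a w - cser a z - cser (dcoefs a) z * (w - z)) + cser (dcoefs a) z * (w - z).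
  by rewrite subrK.
apply: le_trans (cmodD _ _) _; rewrite cmodM -/m -/B.
apply: le_trans (lerD h (lexx _)) _.
apply: le_trans (_ : (`|K| + B + 1) * m <= _); last by rewrite mulrC -ler_pdivlMr // ltW.
have : K * m ^+ 2 <= `|K| * m.
  apply: le_trans (ler_wpM2r (sqr_ge0 _) (ler_norm K)) _.
  by rewrite ler_wpM2l // expr2 ler_piMl // ltW.
by rewrite !mulrDl mul1r; move: m0; lra.
Qed.

Lemma cser_part_continuous (P : C -> R) a : entire a ->
  (forall z w, `|P z - P w| <= cmod (z - w)) ->
  continuous (fun p : R * R => P (cser a (p.1 +i* p.2)%C)).
Proof.
move=> ha hP -[u v]; apply/cvgrPdist_le => e e0.
have [d d0 hd] := cser_continuous (u +i* v)%C ha e0.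
have d2 : 0 < d / 2 by rewrite divr_gt0.
have := nbhsx_ballx ((u, v) : R * R) _ d2; apply: filterS => -[u' v'] [/= h1 h2].
apply: le_trans (hP _ _) _; rewrite cmod_distC; apply: hd.
apply: le_lt_trans (cmod_le_ReIm _) _ => /=.
move: h1 h2; rewrite /ball /= ![`|_ - u'|]distrC ![`|_ - v'|]distrC; lra.
Qed.

Lemma Re_dist z w : `|complex.Re z - complex.Re w| <= cmod (z - w).
Proof. by apply: le_trans (Re_le_cmod _); case: z w => ? ? [? ?]. Qed.

Lemma Im_dist z w : `|complex.Im z - complex.Im w| <= cmod (z - w).
Proof. by apply: le_trans (Im_le_cmod _); case: z w => ? ? [? ?]. Qed.

Lemma is_derive1E (f : R -> R) (x l : R) : is_derive x (1 : R) f l -> derive1 f x = l.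
Proof. by move=> h; rewrite derive1E; apply: derive_val. Qed.

Lemma cser_C1 a : entire a ->
  C1_2 (fun u v => complex.Re (cser a (u +i* v)%C)) /\
  C1_2 (fun u v => complex.Im (cser a (u +i* v)%C)).
Proof.
move=> ha; have ha' := entire_dcoefs ha.
have hN z w : `|- complex.Im z - - complex.Im w| <= cmod (z - w).
  by rewrite -opprD normrN; exact: Im_dist.
split; split.
- by move=> u v; have [? ? ? ?] := cser_derive u v ha; split; apply: ex_derive.
- split.
    have -> : (fun p : R * R => derive1 (fun t => complex.Re (cser a (t +i* p.2)%C)) p.1) =
       (fun p : R * R => complex.Re (cser (dcoefs a) (p.1 +i* p.2)%C)).
      by apply/funext => -[u v]; have [/is_derive1E] := cser_derive u v ha.
    exact: cser_part_continuous ha' Re_dist.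
  have -> : (fun p : R * R => derive1 (fun t => complex.Re (cser a (p.1 +i* t)%C)) p.2) =
     (fun p : R * R => - complex.Im (cser (dcoefs a) (p.1 +i* p.2)%C)).
    by apply/funext => -[u v]; have [_ _ /is_derive1E] := cser_derive u v ha.
  exact: (@cser_part_continuous (fun z => - complex.Im z)).
- by move=> u v; have [? ? ? ?] := cser_derive u v ha; split; apply: ex_derive.
- split.
    have -> : (fun p : R * R => derive1 (fun t => complex.Im (cser a (t +i* p.2)%C)) p.1) =
       (fun p : R * R => complex.Im (cser (dcoefs a) (p.1 +i* p.2)%C)).
      by apply/funext => -[u v]; have [_ /is_derive1E] := cser_derive u v ha.
    exact: cser_part_continuous ha' Im_dist.
  have -> : (fun p : R * R => derive1 (fun t => complex.Im (cser a (p.1 +i* t)%C)) p.2) =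
     (fun p : R * R => complex.Re (cser (dcoefs a) (p.1 +i* p.2)%C)).
    by apply/funext => -[u v]; have [_ _ _ /is_derive1E] := cser_derive u v ha.
  exact: cser_part_continuous ha' Re_dist.
Qed.

Lemma CR_holo (f0 f1 : R -> R -> R) : C1_2 f0 -> C1_2 f1 ->
  (forall u v, derive1 (fun t => f0 t v) u = derive1 (fun t => f1 u t) v) ->
  (forall u v, derive1 (fun t => f0 u t) v = - derive1 (fun t => f1 t v) u) ->
  holo (fun z => (f0 (complex.Re z) (complex.Im z) +i* f1 (complex.Re z) (complex.Im z))%C).
Proof.
move=> c0 c1 cr1 cr2; have [|a ha hF] := entire_series (fun r _ => CR_unif_diff r c0 c1 cr1 cr2).
  move=> r r0; have [M0 h0] := C1_bounded r c0; have [M1 h1] := C1_bounded r c1.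
  exists (M0 + M1) => z zr; apply: le_trans (cmod_le_ReIm _) _ => /=.
  have ur : `|complex.Re z| <= r by rewrite -zr Re_le_cmod.
  have vr : `|complex.Im z| <= r by rewrite -zr Im_le_cmod.
  by apply: lerD; [apply: h0 | apply: h1].
by exists a => // z; rewrite (cser_eq (hF z)).
Qed.

Lemma conj_sum (I : Type) (r : seq I) (P : pred I) (f : I -> C) :
  ((\sum_(i <- r | P i) f i)^*)%C = \sum_(i <- r | P i) ((f i)^*)%C.
Proof. exact: (raddf_sum (@conjc R)). Qed.

Lemma entire_conj a : entire a -> entire (fun k => ((a k)^*)%C).
Proof. by move=> ha r /ha[M h]; exists M => k; rewrite cmodJ. Qed.

Lemma cser_conj a z : entire a -> ((cser a z)^*)%C = cser (fun k => ((a k)^*)%C) (z^*)%C.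
Proof.
move=> ha; apply/esym/cser_eq => e e0; have [N0 h] := cser_cvg z ha e0.
exists N0 => N /h; rewrite -cmodJ rmorphB /= conj_sum.
rewrite (eq_bigr (fun i : 'I_N => ((a i)^*)%C * (z^*)%C ^+ i)) // => i _.
by rewrite rmorphM rmorphXn.
Qed.

Lemma cser_inj a b : entire a -> entire b -> (forall z, cser a z = cser b z) ->
  forall k, a k = b k.
Proof.
move=> ha hb h; have [M hM] := ha _ (ltr0n R 2); have [M' hM'] := hb _ (ltr0n R 2).
apply: (@series_unique _ (cser a) a b 1 M M') => // z _; first exact: cser_cvg.
by rewrite h; apply: cser_cvg.
Qed.

(** Conjugating the coefficients gives a series for the reflected function, here the same one; apply
    uniqueness. *)
Lemma cser_real_coefs a : entire a -> (forall z, cser a (z^*)%C = ((cser a z)^*)%C) ->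
  forall k, ((a k)^*)%C = a k.
Proof.
move=> ha h; apply: cser_inj => //; first exact: entire_conj.
by move=> z; rewrite -[z in LHS]conjcK -cser_conj // -h conjcK.
Qed.

Lemma cser_coef_le a (r M : R) k : entire a -> 0 < r ->
  (forall z, cmod z = r -> cmod (cser a z) <= M) -> cmod (a k) * r ^+ k <= M.
Proof.
move=> ha r0 h; have r2 : 0 < r *+ 2 by rewrite pmulrn_lgt0.
have [M' hM'] := ha _ r2.
by apply: (@series_coef_le _ (cser a) a r M' M) => // z _; apply: cser_cvg.
Qed.

End Components.

(** * Clifford algebra *)

Section Symdiff.
Variable n : nat.
Implicit Types A B D : {set 'I_n}.

Lemma in_symdiff A B i : (i \in symdiff A B) = (i \in A) (+) (i \in B).
Proof. by rewrite !inE; case: (i \in A); case: (i \in B). Qed.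

Lemma symdiffC A B : symdiff A B = symdiff B A.
Proof. by apply/setP => i; rewrite !in_symdiff addbC. Qed.

Lemma symdiffA A B D : symdiff A (symdiff B D) = symdiff (symdiff A B) D.
Proof. by apply/setP => i; rewrite !in_symdiff addbA. Qed.

Lemma symdiffK A : involutive (symdiff A).
Proof. by move=> B; apply/setP => i; rewrite !in_symdiff addKb. Qed.

Lemma symdiffv A : symdiff A A = finset.set0.
Proof. by apply/setP => i; rewrite in_symdiff addbb inE. Qed.

Lemma symdiff0 A : symdiff A finset.set0 = A.
Proof. by apply/setP => i; rewrite in_symdiff inE addbF. Qed.

Lemma symdiff_eq A B D : (symdiff A B == D) = (B == symdiff A D).
Proof. by apply/eqP/eqP => [<-|->]; rewrite symdiffK. Qed.

Lemma symdiff_cancel A B D : symdiff (symdiff A B) (symdiff A D) = symdiff B D.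
Proof. by apply/setP => i; rewrite !in_symdiff; case: (i \in A); case: (i \in B); case: (i \in D). Qed.

End Symdiff.

Section Clifford.
Variables (R : realType) (n : nat).
Local Notation Cl := (Cl R n).
Implicit Types (a b c : Cl) (A B D : {set 'I_n}).

Local Notation sg2 i k := (if (k <= i)%N then -1 else 1 : R).

(** The inversions ([k < i]) and the squares ([k = i]) merge into a single sign per pair, so the
    sign becomes a product over pairs. *)
Lemma clsignE A B : clsign R A B = \prod_(i in A) \prod_(k in B) sg2 i k.
Proof.
rewrite /clsign exprD -!prodr_const.
have -> : \prod_(i in [set p : 'I_n * 'I_n | (p.1 \in A) && (p.2 \in B) && (p.2 < p.1)%N]%SET) (-1 : R)
   = \prod_i \prod_k (if (i \in A) && (k \in B) && (k < i)%N then -1 else 1).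
  by rewrite big_mkcond pair_big /=; apply: eq_bigr => -[i k] _; rewrite inE.
have -> : \prod_(i in (A :&: B)%SET) (-1 : R)
   = \prod_i \prod_k (if (i \in A) && (k \in B) && (k == i) then -1 else 1).
  rewrite big_mkcond; apply: eq_bigr => i _; rewrite (bigD1 i) //= big1 => [|k ki].
    by rewrite mulr1 inE eqxx andbT.
  by rewrite (negbTE ki) andbF.
rewrite -big_split [RHS]big_mkcond; apply: eq_bigr => i _.
rewrite /= -big_split; case: (i \in A) => /=; last by apply: big1 => k _; rewrite mulr1.
rewrite [RHS]big_mkcond; apply: eq_bigr => k _ /=.
case: (k \in B) => /=; last by rewrite mulr1.
rewrite [(k <= i)%N]leq_eqVlt -val_eqE /=.
by case: ltngtP => //= _; rewrite ?mulr1 ?mul1r.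
Qed.

Lemma sg2_sqr (i k : 'I_n) : (sg2 i k) * (sg2 i k) = 1.
Proof. by case: ifP; rewrite ?mulrNN mulr1. Qed.

Lemma prod_symdiff (g : 'I_n -> R) A B : (forall i, g i * g i = 1) ->
  \prod_(i in symdiff A B) g i = (\prod_(i in A) g i) * \prod_(i in B) g i.
Proof.
move=> g2; rewrite big_mkcond [X in X * _]big_mkcond [X in _ * X]big_mkcond -big_split.
apply: eq_bigr => i _ /=; rewrite in_symdiff.
by case: (i \in A); case: (i \in B); rewrite /= ?mulr1 ?mul1r ?g2.
Qed.

(** Indices common to both sets would contribute twice, and signs square to 1. The sign is thus
    bimultiplicative on the group of subsets under symmetric difference. *)
Lemma clsignDl A B D : clsign R (symdiff A B) D = clsign R A D * clsign R B D.
Proof.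
rewrite !clsignE prod_symdiff // => i.
by rewrite -big_split big1 // => k _ /=; rewrite sg2_sqr.
Qed.

Lemma clsignDr A B D : clsign R D (symdiff A B) = clsign R D A * clsign R D B.
Proof.
rewrite !clsignE -big_split; apply: eq_bigr => i _ /=.
by rewrite prod_symdiff // => k; rewrite sg2_sqr.
Qed.

Lemma clsign_sqr A B : clsign R A B * clsign R A B = 1.
Proof. by rewrite -clsignDl symdiffv clsignE big_set0. Qed.

Lemma clsign0 A : clsign R finset.set0 A = 1.
Proof. by rewrite clsignE big_set0. Qed.

Lemma clsign_norm A B : `|clsign R A B| = 1.
Proof. by rewrite /clsign normrX normrN1 expr1n. Qed.

Lemma clsign1 (i k : 'I_n) : clsign R [set i]%SET [set k]%SET = sg2 i k.
Proof. by rewrite clsignE !big_set1. Qed.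

Lemma clmulE a b D : clmul a b D = \sum_A clsign R A (symdiff A D) * a A * b (symdiff A D).
Proof.
rewrite ffunE; apply: eq_bigr => A _; under eq_bigl do rewrite symdiff_eq.
by rewrite big_pred1_eq.
Qed.

(** The algebra is a twisted group algebra of the group of subsets, and a bimultiplicative sign is a
    2-cocycle. Reindexing [B] by [symdiff A] aligns the two double sums. *)
Lemma clmulA a b c : clmul a (clmul b c) = clmul (clmul a b) c.
Proof.
apply/ffunP => D; rewrite !clmulE.
under [RHS]eq_bigr do rewrite clmulE mulr_sumr mulr_suml.
rewrite exchange_big; apply: eq_bigr => A _ /=.
rewrite clmulE mulr_sumr (reindex_inj (can_inj (symdiffK A))) /=.
apply: eq_bigr => B _; rewrite symdiff_cancel clsignDl.
have e : clsign R A (symdiff A D) * clsign R A (symdiff B D) = clsign R A (symdiff A B).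
  by rewrite -clsignDr [symdiff A D]symdiffC [symdiff B D]symdiffC symdiff_cancel.
rewrite -e.
by move: (clsign _ _ _) (clsign _ _ _) (clsign _ _ _) => x y t; ring.
Qed.

Lemma clmulDl a b c : clmul (a + b) c = clmul a c + clmul b c.
Proof.
apply/ffunP => D; rewrite [RHS]ffunE !clmulE -big_split; apply: eq_bigr => A _ /=.
by rewrite ffunE mulrDr mulrDl.
Qed.

Lemma clmulDr a b c : clmul a (b + c) = clmul a b + clmul a c.
Proof.
apply/ffunP => D; rewrite [RHS]ffunE !clmulE -big_split; apply: eq_bigr => A _ /=.
by rewrite ffunE mulrDr.
Qed.

Definition clscale (t : R) a : Cl := [ffun A => t * a A].
Definition clone : Cl := [ffun A => (A == finset.set0)%:R].

Lemma clscaleE t a A : clscale t a A = t * a A. Proof. by rewrite ffunE. Qed.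

Lemma clmulZl t a b : clmul (clscale t a) b = clscale t (clmul a b).
Proof.
apply/ffunP => D; rewrite clscaleE !clmulE mulr_sumr; apply: eq_bigr => A _.
by rewrite clscaleE; ring.
Qed.

Lemma clmulZr t a b : clmul a (clscale t b) = clscale t (clmul a b).
Proof.
apply/ffunP => D; rewrite clscaleE !clmulE mulr_sumr; apply: eq_bigr => A _.
by rewrite clscaleE; ring.
Qed.

Lemma clscaleN1 a : clscale (-1) a = - a.
Proof. by apply/ffunP => A; rewrite !ffunE mulN1r. Qed.

Lemma clscale0 a : clscale 0 a = 0.
Proof. by apply/ffunP => A; rewrite !ffunE mul0r. Qed.

Lemma clscale1 a : clscale 1 a = a.
Proof. by apply/ffunP => A; rewrite !ffunE mul1r. Qed.

Lemma clscaleA s t a : clscale s (clscale t a) = clscale (s * t) a.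
Proof. by apply/ffunP => A; rewrite !ffunE mulrA. Qed.

Lemma clscaleD t a b : clscale t (a + b) = clscale t a + clscale t b.
Proof. by apply/ffunP => A; rewrite !ffunE mulrDr. Qed.

Lemma clmulNl a b : clmul (- a) b = - clmul a b.
Proof. by rewrite -!clscaleN1 clmulZl. Qed.

Lemma clmulNr a b : clmul a (- b) = - clmul a b.
Proof. by rewrite -!clscaleN1 clmulZr. Qed.

Lemma clmul0l a : clmul 0 a = 0.
Proof. by rewrite -(clscale0 0) clmulZl !clscale0. Qed.

Lemma clmul0r a : clmul a 0 = 0.
Proof. by rewrite -(clscale0 0) clmulZr !clscale0. Qed.

Lemma clmul1l a : clmul clone a = a.
Proof.
apply/ffunP => D; rewrite clmulE (bigD1 finset.set0) //= big1 ?addr0.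
  by rewrite ffunE eqxx clsign0 !mul1r symdiffC symdiff0.
by move=> A /negbTE A0; rewrite ffunE A0 mulr0 mul0r.
Qed.

Lemma clmul1r a : clmul a clone = a.
Proof.
apply/ffunP => D; rewrite clmulE (bigD1 D) //= big1 ?addr0.
  by rewrite symdiffv ffunE eqxx mulr1 clsignE big1 ?mul1r // => i _; rewrite big_set0.
move=> A AD; rewrite ffunE; case: eqP => [e|_]; last by rewrite mulr0.
by case/eqP: AD; rewrite -[A]symdiff0 -e symdiffK.
Qed.

Lemma clmul_suml (I : Type) (r : seq I) (P : pred I) (F : I -> Cl) b :
  clmul (\sum_(i <- r | P i) F i) b = \sum_(i <- r | P i) clmul (F i) b.
Proof. by elim/big_rec2: _ => [|i x y _ <-]; rewrite ?clmul0l ?clmulDl. Qed.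

Lemma clmul_vec (v : 'I_n -> R) b D : clmul (vec_to_cl v) b D =
  \sum_i clsign R [set i]%SET (symdiff [set i]%SET D) * v i * b (symdiff [set i]%SET D).
Proof.
rewrite clmulE.
under eq_bigr do rewrite ffunE mulr_sumr mulr_suml.
rewrite (exchange_big_dep predT) //=; apply: eq_bigr => i _.
by rewrite big_pred1_eq.
Qed.

(** The mixed terms are antisymmetric in the two indices and cancel; the diagonal ones contribute
    [-v_i^2]. Stating it as an action on [b] suits its use on slice components. *)
Lemma vec_sqr (v : 'I_n -> R) b : \sum_i v i ^+ 2 = 1 ->
  clmul (vec_to_cl v) (clmul (vec_to_cl v) b) = - b.
Proof.
move=> v1; apply/ffunP => D; rewrite clmul_vec ffunE.
under eq_bigr do rewrite clmul_vec mulr_sumr.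
pose T (i k : 'I_n) := v i * v k * clsign R [set i]%SET D * clsign R [set k]%SET D
   * clsign R [set k]%SET [set i]%SET * b (symdiff [set k]%SET (symdiff [set i]%SET D)).
have -> : \sum_i \sum_k clsign R [set i]%SET (symdiff [set i]%SET D) * v i *
    (clsign R [set k]%SET (symdiff [set k]%SET (symdiff [set i]%SET D)) * v k *
      b (symdiff [set k]%SET (symdiff [set i]%SET D))) = \sum_i \sum_k T i k.
  apply: eq_bigr => i _; apply: eq_bigr => k _; rewrite /T.
  rewrite !clsignDr !clsign1 !leqnn.
  move: (clsign _ _ _) (clsign _ _ _) (if _ then _ else _) => x y t; ring.
have Tii i : T i i = - (v i ^+ 2 * b D).
  rewrite /T symdiffK clsign1 leqnn.
  have := clsign_sqr [set i]%SET D; move: (clsign _ _ _) => s ss.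
  have -> : v i * v i * s * s * -1 * b D = - (v i ^+ 2 * b D) * (s * s) by ring.
  by rewrite ss mulr1.
have Tanti i k : k != i -> T i k = - T k i.
  move=> ki; rewrite /T !clsign1 symdiffA [symdiff [set k]%SET _]symdiffC -symdiffA.
  have := ki; rewrite -val_eqE /=; case: ltngtP => // _ _; ring.
have -> : \sum_i \sum_k T i k = \sum_i T i i + \sum_i \sum_(k | k != i) T i k.
  by rewrite -big_split; apply: eq_bigr => i _; rewrite (bigD1 i).
(* Exchanging the two summations changes the sign, so the sum is its own opposite. *)
have -> : \sum_i \sum_(k | k != i) T i k = 0.
  set X := (LHS); have : X = - X.
    rewrite {1}/X (exchange_big_dep predT) //= -sumrN; apply: eq_bigr => k _.
    rewrite -sumrN; under eq_bigl do rewrite eq_sym.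
    by apply: eq_bigr => i ik; apply: Tanti; rewrite eq_sym.
  by move=> e; lra.
rewrite addr0; under eq_bigr do rewrite Tii.
by rewrite sumrN -mulr_suml v1 mul1r.
Qed.

(* Unlike [clnorm], this norm is submultiplicative with constant [1]. *)
Definition cln1 a : R := \sum_A `|a A|.

Lemma cln1_ge0 a : 0 <= cln1 a. Proof. by apply: sumr_ge0. Qed.

Lemma coef_le_cln1 a A : `|a A| <= cln1 a.
Proof. by rewrite /cln1 (bigD1 A) //= lerDl sumr_ge0. Qed.

Lemma cln1D a b : cln1 (a + b) <= cln1 a + cln1 b.
Proof. by rewrite /cln1 -big_split; apply: ler_sum => A _; rewrite ffunE ler_normD. Qed.

Lemma cln1N a : cln1 (- a) = cln1 a.
Proof. by apply: eq_bigr => A _; rewrite ffunE normrN. Qed.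

Lemma cln1B a b : cln1 (a - b) <= cln1 a + cln1 b.
Proof. by rewrite -(cln1N b) cln1D. Qed.

Lemma cln10 : cln1 0 = 0.
Proof. by apply: big1 => A _; rewrite ffunE normr0. Qed.

Lemma cln1_sum (I : Type) (r : seq I) (P : pred I) (F : I -> Cl) :
  cln1 (\sum_(i <- r | P i) F i) <= \sum_(i <- r | P i) cln1 (F i).
Proof.
elim/big_rec2: _ => [|i x y _ IH]; first by rewrite cln10.
by apply: le_trans (cln1D _ _) _; rewrite lerD2l.
Qed.

Lemma cln1Z t a : cln1 (clscale t a) = `|t| * cln1 a.
Proof. by rewrite /cln1 mulr_sumr; apply: eq_bigr => A _; rewrite ffunE normrM. Qed.

Lemma cln1M a b : cln1 (clmul a b) <= cln1 a * cln1 b.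
Proof.
rewrite {1}/cln1; apply: le_trans (_ : \sum_D \sum_A `|a A| * `|b (symdiff A D)| <= _).
  apply: ler_sum => D _; rewrite clmulE; apply: le_trans (ler_norm_sum _ _ _) _.
  by apply: ler_sum => A _; rewrite !normrM clsign_norm mul1r.
rewrite exchange_big /= mulr_suml; apply: ler_sum => A _.
by rewrite -mulr_sumr (reindex_inj (can_inj (symdiffK A))) /=; under eq_bigr do rewrite symdiffK.
Qed.

Lemma cln1_half a : cln1 (clhalf a) = cln1 a / 2.
Proof.
rewrite /cln1 mulr_suml; apply: eq_bigr => A _.
by rewrite ffunE normrM [`|2^-1|]ger0_norm ?invr_ge0.
Qed.

Lemma cln1_vec (v : 'I_n -> R) : cln1 (vec_to_cl v) <= \sum_i `|v i|.
Proof.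
apply: le_trans (_ : \sum_A \sum_(i | A == [set i]%SET) `|v i| <= _).
  by apply: ler_sum => A _; rewrite ffunE ler_norm_sum.
by rewrite (exchange_big_dep predT) //=; apply: ler_sum => i _; rewrite big_pred1_eq.
Qed.

Lemma clnorm_le_cln1 a : clnorm a <= cln1 a.
Proof.
rewrite /clnorm -[leRHS]ger0_norm ?cln1_ge0 // -sqrtr_sqr ler_wsqrtr //.
rewrite expr2 {1}/cln1 mulr_suml; apply: ler_sum => A _.
by rewrite -(real_normK (num_real (a A))) expr2 ler_wpM2l // coef_le_cln1.
Qed.

Lemma coef_le_clnorm a A : `|a A| <= clnorm a.
Proof.
rewrite -sqrtr_sqr; apply: ler_wsqrtr; rewrite (bigD1 A) //= lerDl.
by apply: sumr_ge0 => B _; apply: sqr_ge0.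
Qed.

Lemma cln1_le_clnorm a : cln1 a <= 2 ^+ n * clnorm a.
Proof.
apply: le_trans (ler_sum _ (fun A _ => coef_le_clnorm a A)) _.
rewrite sumr_const -[leLHS]mulr_natl.
suff -> : #|{set 'I_n}| = (2 ^ n)%N by rewrite natrX.
by have := card_powerset [set: 'I_n]%SET; rewrite cardsT card_ord powersetT cardsT.
Qed.

End Clifford.

(** * Slice functions *)

Opaque cser.

Section HoloClosure.
Variable R : realType.
Local Notation C := (complex R).
Implicit Types (F G : C -> C).

Lemma holo_ext F G : (forall z, F z = G z) -> holo F -> holo G.
Proof. by move=> e [a ha h]; exists a => // z; rewrite -e h. Qed.

Lemma holoD F G : holo F -> holo G -> holo (fun z => F z + G z).
Proof.
move=> [a ha hF] [b hb hG]; exists (fun k => a k + b k); first exact: entireD.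
by move=> z; rewrite hF hG cserD.
Qed.

Lemma holoZ (c : C) F : holo F -> holo (fun z => c * F z).
Proof.
move=> [a ha hF]; exists (fun k => c * a k); first exact: entireZ.
by move=> z; rewrite hF cserZ.
Qed.

Definition monoc (k i : nat) : C := if i == k then 1 else 0.

Lemma monoc_ccvg k (z : C) : ccvg (fun N => \sum_(i < N) monoc k i * z ^+ i) (z ^+ k).
Proof.
apply: (ccvg_ext (n0 := k.+1)) (ccvg_cst (z ^+ k)) => N kN.
rewrite (bigD1 (Ordinal kN)) //= /monoc eqxx mul1r big1 ?addr0 // => i.
by rewrite -val_eqE /= => /negbTE ->; rewrite mul0r.
Qed.

Lemma entire_monoc k : entire (monoc k).
Proof.
move=> r r0; exists (r ^+ k) => i; rewrite /monoc; case: eqP => [->|_].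
  by rewrite cmod1 mul1r.
by rewrite cmod0 mul0r exprn_ge0 // ltW.
Qed.

Lemma holoX k : holo (fun z : C => z ^+ k).
Proof.
by exists (monoc k); [exact: entire_monoc | move=> z; rewrite (cser_eq (monoc_ccvg k z))].
Qed.

Lemma holo_cst (c : C) : holo (fun=> c).
Proof. by apply: holo_ext (holoZ c (holoX 0)) => z; rewrite expr0 mulr1. Qed.

Lemma holo_sum (I : Type) (r : seq I) (P : pred I) (F : I -> C -> C) :
  (forall i, P i -> holo (F i)) -> holo (fun z => \sum_(i <- r | P i) F i z).
Proof.
move=> h; elim: r => [|i r IH].
  by apply: holo_ext (holo_cst 0) => z; rewrite big_nil.
have [Pi|nPi] := boolP (P i).
  by apply: holo_ext (holoD (h i Pi) IH) => z; rewrite big_cons Pi.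
by apply: holo_ext IH => z; rewrite big_cons (negbTE nPi).
Qed.

Lemma conjcM (z w : C) : ((z * w)^*)%C = (z^*)%C * (w^*)%C.
Proof. exact: rmorphM. Qed.

Lemma Re_sum (I : Type) (r : seq I) (P : pred I) (f : I -> C) :
  complex.Re (\sum_(i <- r | P i) f i) = \sum_(i <- r | P i) complex.Re (f i).
Proof. by elim/big_rec2: _ => [|i x y _ <-] //; case: (f i) y => ? ? []. Qed.

Lemma Im_sum (I : Type) (r : seq I) (P : pred I) (f : I -> C) :
  complex.Im (\sum_(i <- r | P i) f i) = \sum_(i <- r | P i) complex.Im (f i).
Proof. by elim/big_rec2: _ => [|i x y _ <-] //; case: (f i) y => ? ? []. Qed.

End HoloClosure.

Section Slice.
Variables (R : realType) (n : nat).
Local Notation C := (complex R).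
Local Notation Cl := (Cl R n).
Local Notation Pt := (Pt R n).
Local Notation slice := ({set 'I_n} -> C -> C).
Implicit Types (x y : Pt) (F G : slice) (A B D : {set 'I_n}) (z w : C).

(* [ofs F] is the slice function with components [Re F] and [Im F], seen as
   functions of [z = u + iv], where [v = |x_vec| >= 0] and [j = jdir x]. *)
Definition zof x : C := (x.1 +i* vnorm x)%C.
Definition rpart F z : Cl := [ffun A => complex.Re (F A z)].
Definition ipart F z : Cl := [ffun A => complex.Im (F A z)].
Definition ofs F x : Cl := rpart F (zof x) + clmul (jdir x) (ipart F (zof x)).
(** The reflection clause says that [Re F] is even and [Im F] odd in [v]. It forces [Im F = 0] on
    the real axis, where [jdir] takes its default value 0. *)
Definition sholo F := (forall A, holo (F A)) /\
  (forall A z, F A (z^*)%C = ((F A z)^*)%C).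

Lemma vnorm_ge0 x : 0 <= vnorm x. Proof. exact: sqrtr_ge0. Qed.

Lemma vnorm_sqr x : vnorm x ^+ 2 = \sum_i x.2 i ^+ 2.
Proof. by rewrite sqr_sqrtr // sumr_ge0 // => i _; rewrite sqr_ge0. Qed.

Lemma cmod_zof x : cmod (zof x) = ptnorm x.
Proof. by rewrite cmodE /= vnorm_sqr. Qed.

Lemma vnorm_ptof u v (j : 'I_n -> R) : in_sphere j -> vnorm (ptof u v j) = `|v|.
Proof.
move=> j1; rewrite /vnorm /=; under eq_bigr do rewrite exprMn.
by rewrite -mulr_sumr j1 mulr1 sqrtr_sqr.
Qed.

Lemma vec_scale t (v : 'I_n -> R) : vec_to_cl (fun i => t * v i) = clscale t (vec_to_cl v).
Proof. by apply/ffunP => A; rewrite !ffunE mulr_sumr. Qed.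

Lemma jdir_ptof u v (j : 'I_n -> R) : in_sphere j -> v != 0 ->
  jdir (ptof u v j) = clscale (Num.sg v) (vec_to_cl j).
Proof.
move=> j1 v0; rewrite /jdir vnorm_ptof // normr_eq0 (negbTE v0) -vec_scale.
congr vec_to_cl; apply/funext => i /=.
have nv0 : `|v| != 0 by rewrite normr_eq0.
by rewrite {1}[v]numEsg mulrAC mulfK.
Qed.

Lemma conj_swap (u v : R) : ((u +i* v)^*)%C = (u +i* - v)%C. Proof. by []. Qed.

Lemma sholo_neg F A u v : sholo F ->
  complex.Re (F A (u +i* - v)%C) = complex.Re (F A (u +i* v)%C) /\
  complex.Im (F A (u +i* - v)%C) = - complex.Im (F A (u +i* v)%C).
Proof. by move=> [_ h]; rewrite -conj_swap h; case: (F A _). Qed.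

Lemma sholo_real F A u : sholo F -> complex.Im (F A (u +i* 0)%C) = 0.
Proof. by move=> /(@sholo_neg _ A u 0)[_]; rewrite oppr0 => h; lra. Qed.

(** [ofs] only sees [|v|]; for negative [v] the direction is reversed, which the oddness of the
    imaginary part compensates. *)
Lemma ofs_ptof F u v (j : 'I_n -> R) : sholo F -> in_sphere j ->
  ofs F (ptof u v j) = rpart F (u +i* v)%C + clmul (vec_to_cl j) (ipart F (u +i* v)%C).
Proof.
move=> hF j1; rewrite /ofs /zof vnorm_ptof //=.
case: (ltrgt0P v) => v0; last first.
- have H0 : ipart F (u +i* 0)%C = 0 by apply/ffunP => A; rewrite !ffunE sholo_real.
  by rewrite v0 H0 !clmul0r.
- rewrite jdir_ptof ?lt_eqF // ltr0_sg // clscaleN1 clmulNl -clmulNr.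
  congr (_ + clmul _ _); apply/ffunP => A; rewrite !ffunE.
    by have [-> _] := sholo_neg A u v hF.
  by have [_ ->] := sholo_neg A u v hF; rewrite opprK.
- by rewrite jdir_ptof ?gt_eqF // gtr0_sg // clscale1.
Qed.

Lemma ofs_slice F : sholo F -> slice_monogenic (ofs F).
Proof.
move=> hF; exists (fun u v => rpart F (u +i* v)%C), (fun u v => ipart F (u +i* v)%C).
have rE A : (fun u v => rpart F (u +i* v)%C A) = (fun u v => complex.Re (F A (u +i* v)%C)).
  by apply/funext => u; apply/funext => v; rewrite ffunE.
have iE A : (fun u v => ipart F (u +i* v)%C A) = (fun u v => complex.Im (F A (u +i* v)%C)).
  by apply/funext => u; apply/funext => v; rewrite ffunE.
have FE A : exists2 a, entire a & F A = cser a.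
  by have [a ha h] := hF.1 A; exists a => //; apply/funext.
split; [|split; [|split]].
- by move=> u v j j1; apply: ofs_ptof.
- by move=> A; rewrite rE iE; have [a ha ->] := FE A; apply: cser_C1.
- move=> u v; split; apply/ffunP => A; rewrite !ffunE.
    by have [-> _] := sholo_neg A u v hF.
  by have [_ ->] := sholo_neg A u v hF.
- move=> u v A; have [a ha e] := FE A.
  have [/is_derive1E d1 /is_derive1E d2 /is_derive1E d3 /is_derive1E d4] := cser_derive u v ha.
  have r1 (w : R) : (fun t => rpart F (t +i* w)%C A) = (fun t => complex.Re (cser a (t +i* w)%C)).
    by apply/funext => t; rewrite [LHS]ffunE e; reflexivity.
  have r2 (w : R) : (fun t => rpart F (w +i* t)%C A) = (fun t => complex.Re (cser a (w +i* t)%C)).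
    by apply/funext => t; rewrite [LHS]ffunE e; reflexivity.
  have i1 (w : R) : (fun t => ipart F (t +i* w)%C A) = (fun t => complex.Im (cser a (t +i* w)%C)).
    by apply/funext => t; rewrite [LHS]ffunE e; reflexivity.
  have i2 (w : R) : (fun t => ipart F (w +i* t)%C A) = (fun t => complex.Im (cser a (w +i* t)%C)).
    by apply/funext => t; rewrite [LHS]ffunE e; reflexivity.
  rewrite r1 r2 i1 i2; split; first exact: etrans d1 (esym d4).
  by apply: etrans d3 _; congr (- _); apply: esym d2.
Qed.

(** The point where [n > 0] matters: over an empty sphere, slice monogenicity would put no
    constraint on [f]. *)
Lemma sphere_inhabited : (0 < n)%N -> exists j : 'I_n -> R, in_sphere j.
Proof.
move=> n0; exists (fun i => (i == Ordinal n0)%:R); rewrite /in_sphere (bigD1 (Ordinal n0)) //=.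
by rewrite expr1n big1 ?addr0 // => i /negbTE ->; rewrite expr0n.
Qed.

Lemma pt_as_ptof x (j0 : 'I_n -> R) : in_sphere j0 ->
  exists2 j, in_sphere j & x = ptof x.1 (vnorm x) j.
Proof.
move=> j01; case: (eqVneq (vnorm x) 0) => v0.
  exists j0 => //; case: x v0 => u p v0; congr pair; apply/funext => i; rewrite v0 mul0r /=.
  have := vnorm_sqr (u, p); rewrite v0 expr0n /= => /esym/eqP.
  rewrite psumr_eq0 => [/allP /(_ i) |k _]; last by rewrite sqr_ge0.
  by rewrite mem_index_enum => /(_ isT); rewrite sqrf_eq0 => /eqP.
exists (fun i => x.2 i / vnorm x).
  rewrite /in_sphere; under eq_bigr do rewrite exprMn.
  by rewrite -mulr_suml -vnorm_sqr exprVn divff // expf_neq0.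
by case: x v0 => u p v0; congr pair; apply/funext => i /=; rewrite mulrC divfK.
Qed.

(** Take the stem function [f0 + i f1] componentwise: the equations in the definition are its
    Cauchy-Riemann equations. *)
Lemma slice_ofs (f : Pt -> Cl) : (0 < n)%N -> slice_monogenic f ->
  exists2 F, sholo F & f = ofs F.
Proof.
move=> n0 [f0 [f1 [hf [hC [hs hcr]]]]].
pose F A z : C := (f0 (complex.Re z) (complex.Im z) A +i* f1 (complex.Re z) (complex.Im z) A)%C.
have hF : sholo F.
  split=> [A|A [u v]]; last first.
    have [e1 e2] := hs u v; apply/eqP; rewrite eq_complex /=.
    by rewrite e1 e2 ffunE !eqxx.
  apply: (CR_holo (hC A).1 (hC A).2) => u v; first exact: (hcr u v A).1.
  exact: (hcr u v A).2.
exists F => //; apply/funext => x; have [j0 j01] := sphere_inhabited n0.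
have [j j1 ->] := pt_as_ptof x j01.
rewrite ofs_ptof // hf //; congr (_ + clmul _ _); by apply/ffunP => A; rewrite ffunE.
Qed.

Lemma vnorm_pconj x : vnorm (pconj x) = vnorm x.
Proof. by rewrite /vnorm; congr Num.sqrt; apply: eq_bigr => i _; rewrite sqrrN. Qed.

Lemma ptnorm_pconj x : ptnorm (pconj x) = ptnorm x.
Proof. by rewrite /ptnorm; congr (Num.sqrt (_ + _)); apply: eq_bigr => i _; rewrite sqrrN. Qed.

Lemma zof_pconj x : zof (pconj x) = zof x.
Proof. by rewrite /zof vnorm_pconj. Qed.

Lemma jdir_pconj x : jdir (pconj x) = - jdir x.
Proof.
rewrite /jdir vnorm_pconj; case: ifP => _; first by rewrite oppr0.
rewrite -clscaleN1 -vec_scale; congr vec_to_cl; apply/funext => i /=.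
by rewrite mulN1r mulNr.
Qed.

Lemma jdir_sqr x b : vnorm x != 0 -> clmul (jdir x) (clmul (jdir x) b) = - b.
Proof.
move=> v0; rewrite /jdir (negbTE v0); apply: vec_sqr.
under eq_bigr do rewrite exprMn.
by rewrite -mulr_suml -vnorm_sqr exprVn divff // expf_neq0.
Qed.

Lemma cln1_jdir x : cln1 (jdir x) <= n%:R.
Proof.
rewrite /jdir; case: eqP => [_|/eqP v0]; first by rewrite cln10.
apply: le_trans (cln1_vec _) _; rewrite -[in leRHS](card_ord n) -sumr_const.
apply: ler_sum => i _; have vp : 0 < vnorm x by rewrite lt_def v0 vnorm_ge0.
rewrite normrM normfV [`|vnorm x|]gtr0_norm // ler_pdivrMr // mul1r -sqrtr_sqr.
apply: ler_wsqrtr; rewrite (bigD1 i) //= lerDl.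
by apply: sumr_ge0 => k _; apply: sqr_ge0.
Qed.

Lemma ofs_even F x : clhalf (ofs F x + ofs F (pconj x)) = rpart F (zof x).
Proof.
rewrite /ofs zof_pconj jdir_pconj clmulNl addrACA subrr addr0.
by apply/ffunP => A; rewrite !ffunE; field.
Qed.

(** Off the real axis this is [j^2 = -1]; on it both sides vanish, the left because [jdir] is 0 and
    the right by symmetry. *)
Lemma ofs_odd F x : sholo F ->
  - clmul (jdir x) (clhalf (ofs F x - ofs F (pconj x))) = ipart F (zof x).
Proof.
move=> hF; have -> : clhalf (ofs F x - ofs F (pconj x)) = clmul (jdir x) (ipart F (zof x)).
  rewrite /ofs zof_pconj jdir_pconj clmulNl; apply/ffunP => A.
  rewrite !(ffunE, clmulE) /=; move: (\sum_ _ _) => s.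
  by field.
case: (eqVneq (vnorm x) 0) => v0; last by rewrite jdir_sqr // opprK.
rewrite {1}/jdir v0 eqxx clmul0l oppr0 /zof v0.
by apply/ffunP => A; rewrite !ffunE sholo_real.
Qed.

(** The product of the complexified Clifford algebra, in which the complex unit commutes with every
    [e_A]. *)
Definition smul F G : slice := fun D z =>
  \sum_A (clsign R A (symdiff A D))%:C%C * (F A z * G (symdiff A D) z).

Lemma sholo_smul F G : sholo F -> sholo G -> sholo (smul F G).
Proof.
move=> [hF sF] [hG sG]; split=> [D|D z].
  by apply: holo_sum => A _; apply: holoZ; apply: holoM.
rewrite /smul conj_sum; apply: eq_bigr => A _.
by rewrite 2!conjcM conjc_real sF sG.
Qed.

Lemma rpart_smul F G z : rpart (smul F G) z =
  clmul (rpart F z) (rpart G z) - clmul (ipart F z) (ipart G z).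
Proof.
apply/ffunP => D; rewrite [LHS]ffunE [RHS]ffunE [X in _ = _ + X]ffunE !clmulE Re_sum -sumrB.
apply: eq_bigr => A _; rewrite !ffunE; case: (F A z) (G _ z) => ? ? [? ?] /=; ring.
Qed.

Lemma ipart_smul F G z : ipart (smul F G) z =
  clmul (ipart F z) (rpart G z) + clmul (rpart F z) (ipart G z).
Proof.
apply/ffunP => D; rewrite [LHS]ffunE [RHS]ffunE !clmulE Im_sum -big_split.
apply: eq_bigr => A _; rewrite !ffunE; case: (F A z) (G _ z) => ? ? [? ?] /=; ring.
Qed.

Lemma star_ofs F G : sholo F -> sholo G -> star (ofs F) (ofs G) = ofs (smul F G).
Proof.
move=> hF hG; apply/funext => x; rewrite /star !ofs_even !ofs_odd //.
by rewrite [RHS]/ofs rpart_smul ipart_smul.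
Qed.

(** Each factor [j] costs [n], as does each odd component. Of the four products, [f0 g0] has weight
    1 and each of the other three has weight [n^2]. *)
Lemma cln1_star (f g : Pt -> Cl) x (P Q : R) :
  cln1 (f x) <= P -> cln1 (f (pconj x)) <= P ->
  cln1 (g x) <= Q -> cln1 (g (pconj x)) <= Q ->
  cln1 (star f g x) <= (1 + 3 * n%:R ^+ 2) * P * Q.
Proof.
move=> f1 f2 g1 g2; have j1 := cln1_jdir x.
have P0 := le_trans (cln1_ge0 _) f1; have Q0 := le_trans (cln1_ge0 _) g1.
have half (a b : Cl) (M : R) : cln1 a <= M -> cln1 b <= M -> cln1 (clhalf (a + b)) <= M.
  by move=> ha hb; rewrite cln1_half; have := cln1D a b; lra.
have N0 : 0 <= n%:R :> R by [].
have odd (a b : Cl) (M : R) : cln1 a <= M -> cln1 b <= M -> cln1 (- clmul (jdir x) (clhalf (a - b))) <= n%:R * M.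
  move=> ha hb; rewrite cln1N; apply: le_trans (cln1M _ _) _; apply: ler_pM; rewrite ?cln1_ge0 //.
  by apply: half => //; rewrite cln1N.
rewrite /star.
have F0 := half _ _ _ f1 f2; have G0 := half _ _ _ g1 g2.
have F1 := odd _ _ _ f1 f2; have G1 := odd _ _ _ g1 g2.
move: (clhalf (f x + _)) (clhalf (g x + _)) F0 G0 => p q F0 G0.
move: (- clmul _ _) (- clmul _ _) F1 G1 => t s F1 G1.
have M (a b : Cl) (U V : R) : cln1 a <= U -> cln1 b <= V -> cln1 (clmul a b) <= U * V.
  by move=> ha hb; apply: le_trans (cln1M _ _) _; apply: ler_pM; rewrite ?cln1_ge0.
have h1 := cln1D (clmul p q - clmul s t) (clmul (jdir x) (clmul s q + clmul p t)).
have h2 := cln1B (clmul p q) (clmul s t).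
have h3 := M _ _ _ _ j1 (le_trans (cln1D _ _) (lerD (M _ _ _ _ F1 G0) (M _ _ _ _ F0 G1))).
have h4 := M _ _ _ _ F0 G0; have h5 := M _ _ _ _ F1 G1.
apply: le_trans h1 _.
have -> : (1 + 3 * n%:R ^+ 2) * P * Q = (P * Q + n%:R * P * (n%:R * Q)) + n%:R * (n%:R * P * Q + P * (n%:R * Q)) by ring.
by apply: lerD => //; apply: le_trans h2 (lerD h4 h5).
Qed.

End Slice.

(** * Power series with Clifford coefficients *)

Section SliceSeries.
Variables (R : realType) (n : nat).
Local Notation C := (complex R).
Local Notation Cl := (Cl R n).
Local Notation Pt := (Pt R n).
Local Notation slice := ({set 'I_n} -> C -> C).
Implicit Types (x y : Pt) (F G : slice) (A B D : {set 'I_n}) (z w : C) (a b : nat -> Cl).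

Definition pcoef a A : nat -> C := fun k => (a k A)%:C%C.
Definition sentire a := forall A, entire (pcoef a A).
Definition cpser a : slice := fun A => cser (pcoef a A).
Definition pser a := ofs (cpser a).

Lemma sholo_cpser a : sentire a -> sholo (cpser a).
Proof.
move=> ha; split=> [A|A z]; first by exists (pcoef a A) => //; exact: ha.
rewrite /cpser cser_conj; last exact: ha.
by congr cser; apply/funext => k; rewrite conjc_real.
Qed.

Lemma pser_slice a : sentire a -> slice_monogenic (pser a).
Proof. by move=> ha; apply: ofs_slice; apply: sholo_cpser. Qed.

Lemma sholo_series F : sholo F -> exists2 a, sentire a & F = cpser a.
Proof.
move=> [hF sF].
have /choice[c hc] : forall A, exists c : nat -> C, entire c /\ F A = cser c.
  by move=> A; have [c hc e] := hF A; exists c; split=> //; apply/funext.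
pose a k : Cl := [ffun A => complex.Re (c A k)].
have ca A : c A = pcoef a A.
  apply/funext => k; rewrite /pcoef ffunE.
  have := @cser_real_coefs _ (c A) (hc A).1 _ k; rewrite -(hc A).2.
  case: (c A k) => p q /(_ (sF A)) /= [e].
  by apply/eqP; rewrite eq_complex /= eqxx; apply/eqP; lra.
exists a => [A|]; first by rewrite -ca; exact: (hc A).1.
by apply/funext => A; rewrite /cpser -ca (hc A).2.
Qed.

Lemma slice_series (f : Pt -> Cl) : (0 < n)%N -> slice_monogenic f ->
  exists2 a, sentire a & f = pser a.
Proof.
move=> n0 /(slice_ofs n0)[F /sholo_series[a ha ->] ->].
by exists a.
Qed.

Definition sder a : nat -> Cl := fun k => clscale k.+1%:R (a k.+1).

Lemma pcoef_sder a A : pcoef (sder a) A = dcoefs (pcoef a A).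
Proof.
apply/funext => k; rewrite /pcoef /sder /dcoefs clscaleE rmorphM /=.
by rewrite rmorph_nat.
Qed.

Lemma sentire_sder a : sentire a -> sentire (sder a).
Proof. by move=> ha A; rewrite pcoef_sder; apply: entire_dcoefs; exact: ha. Qed.

Lemma sentire_iter a l : sentire a -> sentire (iter l sder a).
Proof. by move=> ha; elim: l => //= l; apply: sentire_sder. Qed.

Lemma iter_sderE a l k : iter l sder a k = clscale ((k + l)`!%:R / k`!%:R) (a (k + l)%N).
Proof.
elim: l k => [|l IH] k.
  by rewrite addn0 divff ?clscale1 // pnatr_eq0 -lt0n fact_gt0.
rewrite iterS /sder IH clscaleA addSnnS; congr clscale.
rewrite factS natrM.
have h1 : k`!%:R != 0 :> R by rewrite pnatr_eq0 -lt0n fact_gt0.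
have h2 : k.+1%:R != 0 :> R by rewrite pnatr_eq0.
by rewrite invfM mulrCA mulVKf.
Qed.

Lemma is_derive_sum_scal (I : Type) (r : seq I) (x : R) (c : I -> R) (f : I -> R -> R) (df : I -> R) :
  (forall i, is_derive x (1 : R) (f i) (df i)) ->
  is_derive x (1 : R) (fun t => \sum_(i <- r) c i * f i t) (\sum_(i <- r) c i * df i).
Proof.
move=> h; elim: r => [|i r IH].
  rewrite big_nil; have -> : (fun t => \sum_(i <- [::]) c i * f i t) = cst (0 : R).
    by apply/funext => t; rewrite big_nil.
  exact: is_derive_cst.
rewrite big_cons; have -> : (fun t => \sum_(i0 <- i :: r) c i0 * f i0 t)
    = (c i \*: f i) + (fun t => \sum_(i <- r) c i * f i t).
  by apply/funext => t; rewrite big_cons.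
apply: is_deriveD; apply: is_deriveZ; exact: h.
Qed.

(** Moving [x0] alone changes neither [vnorm] nor [jdir], so only the partial derivatives in [u]
    enter. *)
Lemma pdx0_pser a : sentire a -> pdx0 (pser a) = pser (sder a).
Proof.
move=> ha; apply/funext => -[u p]; apply/ffunP => D; rewrite ffunE /=.
apply: is_derive1E.
have e : (fun t => pser a (t, p) D) = (fun t => complex.Re (cser (pcoef a D) (t +i* vnorm (u, p))%C)) +
   (fun t => \sum_A (clsign R A (symdiff A D) * jdir (u, p) A)
       * complex.Im (cser (pcoef a (symdiff A D)) (t +i* vnorm (u, p))%C)).
  apply/funext => t; rewrite /pser /ofs ffunE clmulE ffunE; congr (_ + _).
  by apply: eq_bigr => A _; rewrite ffunE.
rewrite e.
have -> : pser (sder a) (u, p) D = complex.Re (cser (dcoefs (pcoef a D)) (u +i* vnorm (u, p))%C)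
   + \sum_A (clsign R A (symdiff A D) * jdir (u, p) A)
       * complex.Im (cser (dcoefs (pcoef a (symdiff A D))) (u +i* vnorm (u, p))%C).
  rewrite /pser /ofs ffunE clmulE ffunE /cpser pcoef_sder; congr (_ + _).
  by apply: eq_bigr => A _; rewrite ffunE pcoef_sder.
apply: is_deriveD; first by have [] := cser_derive u (vnorm (u, p)) (ha D).
apply: is_derive_sum_scal => A.
by have [] := cser_derive u (vnorm (u, p)) (ha (symdiff A D)).
Qed.

Lemma iter_pdx0_pser a l : sentire a -> iter l (@pdx0 R n) (pser a) = pser (iter l sder a).
Proof.
by move=> ha; elim: l => //= l ->; rewrite pdx0_pser //; apply: sentire_iter.
Qed.

Lemma cser_le (c : nat -> C) z (M : R) : entire c ->
  (forall k, cmod (c k) * cmod z ^+ k <= M / 2 ^+ k) -> cmod (cser c z) <= M * 2.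
Proof.
move=> hc h; apply: (ccvg_le (cser_cvg z hc) (n0 := 0)) => N _.
have M0 : 0 <= M.
  by have := h 0%N; rewrite !expr0 mulr1 divr1; apply: le_trans; exact: cmod_ge0.
apply: le_trans (cmod_sum _ _ _) _.
have := geo_tail 0 N M0; rewrite expr0 divr1 big_mkord; apply: le_trans.
by apply: ler_sum => k _; rewrite cmodM cmodX.
Qed.

Lemma cln1_ofs F x (M : R) : (forall A, cmod (F A (zof x)) <= M) ->
  cln1 (ofs F x) <= (1 + n%:R) * (2 ^+ n * M).
Proof.
move=> h; have card : #|{set 'I_n}| = (2 ^ n)%N.
  by have := card_powerset [set: 'I_n]%SET; rewrite cardsT card_ord powersetT cardsT.
have sM (P : {set 'I_n} -> R) : (forall A, `|P A| <= M) -> \sum_A `|P A| <= 2 ^+ n * M.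
  move=> hP; apply: le_trans (ler_sum _ (fun A _ => hP A)) _.
  by rewrite sumr_const -[leLHS]mulr_natl card natrX.
rewrite mulrDl mul1r; apply: le_trans (cln1D _ _) _; apply: lerD.
  by apply: sM => A; rewrite ffunE; apply: le_trans (h A); exact: Re_le_cmod.
apply: le_trans (cln1M _ _) _; apply: ler_pM; rewrite ?cln1_ge0 ?cln1_jdir //.
by apply: sM => A; rewrite ffunE; apply: le_trans (h A); exact: Im_le_cmod.
Qed.

Lemma cln1_pser_le a x (M : R) : sentire a ->
  (forall k A, `|a k A| * ptnorm x ^+ k <= M / 2 ^+ k) ->
  cln1 (pser a x) <= (1 + n%:R) * (2 ^+ n * (M * 2)).
Proof.
move=> ha h; apply: cln1_ofs => A; apply: cser_le; first exact: ha.
by move=> k; rewrite cmodR cmod_zof.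
Qed.

(** Both parts of [F] are recovered from the values of [ofs F] at a point and its conjugate, which
    have the same norm. [zof] reaches only the upper half plane; reflection covers the lower one. *)
Lemma sholo_cmod_le F (r M : R) A z : (0 < n)%N -> sholo F -> cmod z = r ->
  (forall x, ptnorm x = r -> cln1 (ofs F x) <= M) -> cmod (F A z) <= (1 + n%:R) * M.
Proof.
move=> n0 hF; have [j j1] := @sphere_inhabited R n n0.
suff main : forall z, 0 <= complex.Im z -> cmod z = r ->
    (forall x, ptnorm x = r -> cln1 (ofs F x) <= M) -> cmod (F A z) <= (1 + n%:R) * M.
  case: (leP 0 (complex.Im z)) => z0 zr hM; first exact: main.
  rewrite -[z]conjcK hF.2 cmodJ; apply: main; rewrite ?cmodJ //.
  by case: z z0 {zr} => p q /=; lra.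
move=> {}z z0 zr hM; pose x := ptof (complex.Re z) (complex.Im z) j.
have zx : zof x = z by rewrite /zof vnorm_ptof // ger0_norm // /x /ptof /=; case: (z).
have xr : ptnorm x = r by rewrite -cmod_zof zx.
have xr' : ptnorm (pconj x) = r by rewrite ptnorm_pconj.
have h1 := hM x xr; have h2 := hM _ xr'.
apply: le_trans (cmod_le_ReIm _) _; rewrite mulrDl mul1r; apply: lerD.
  have -> : complex.Re (F A z) = rpart F (zof x) A by rewrite ffunE zx.
  apply: le_trans (coef_le_cln1 _ _) _; rewrite -ofs_even cln1_half.
  by have := cln1D (ofs F x) (ofs F (pconj x)); lra.
have -> : complex.Im (F A z) = ipart F (zof x) A by rewrite ffunE zx.
apply: le_trans (coef_le_cln1 _ _) _; rewrite -ofs_odd // cln1N.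
apply: le_trans (cln1M _ _) _; apply: ler_pM; rewrite ?cln1_ge0 ?cln1_jdir // cln1_half.
by have := cln1B (ofs F x) (ofs F (pconj x)); lra.
Qed.

Lemma pser_coef_le a (r M : R) k A : (0 < n)%N -> sentire a -> 0 < r ->
  (forall x, ptnorm x = r -> cln1 (pser a x) <= M) -> `|a k A| * r ^+ k <= (1 + n%:R) * M.
Proof.
move=> n0 ha r0 hM; rewrite -cmodR.
have hA := ha A; apply: (@cser_coef_le _ (pcoef a A)) => // z zr.
by apply: (@sholo_cmod_le (cpser a) r) => //; apply: sholo_cpser.
Qed.

End SliceSeries.

(** * Proximate orders *)

Section Growth.
Variable R : realType.
Local Open Scope classical_set_scope.
Implicit Types (rho : R -> R) (ord : R).

Lemma growth_ge0 rho r : 0 <= growth rho r. Proof. exact: powR_ge0. Qed.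

Lemma growthE rho r : 0 < r -> growth rho r = expR (rho r * ln r).
Proof. by move=> r0; rewrite /growth /powR gt_eqF. Qed.

(** Near 0 the one-sided derivative gives right continuity at 0; away from 0 [rho] is continuous on
    a compact interval. *)
Lemma po_bounded rho ord (M : R) : proximate_order rho ord ->
  exists S, forall r, 0 <= r <= M -> rho r <= S.
Proof.
move=> hpo; have [_ [hd [h0 _]]] := hpo.
have [d d0 hS] : exists2 d, 0 < d & forall h, 0 < h < d -> rho h <= rho 0 + 1.
  case/cvg_ex: h0 => l hl.
  have : h * (h^-1 * (rho h - rho 0)) @[h --> 0^'+] --> 0 * l.
    by apply: cvgM hl; apply: cvg_at_right_filter; exact: cvg_id.
  rewrite mul0r => /cvgrPdist_lt /(_ 1 ltr01).
  rewrite /at_right /prop_near1 /within /= -nbhs_ballE => -[d /= d0 hd'].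
  exists d => // h /andP[h0 hd1].
  have := hd' h; rewrite /ball /= !sub0r !normrN gtr0_norm // => /(_ hd1 h0).
  rewrite mulVKf ?gt_eqF // => hh.
  by have := le_lt_trans (ler_norm _) hh; lra.
have d2 : 0 < d / 2 by rewrite divr_gt0.
have cw : {within `[d / 2, M], continuous rho}.
  apply: derivable_within_continuous => x; rewrite in_itv /= => /andP[x1 _].
  by apply: hd; lra.
have := continuous_compact cw (@segment_compact _ _ _).
move/compact_bounded => [B [_ /(_ (B + 1)) hB]].
exists (Num.max (rho 0 + 1) (B + 1)) => r /andP[r0 rM]; rewrite le_max.
have [rd|dr] := ltP r d.
  move: r0; rewrite le_eqVlt => /orP[/eqP <-|r0]; first by apply/orP; left; lra.
  by rewrite hS // r0.
apply/orP; right; apply: le_trans (ler_norm _) _; apply: hB; first by lra.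
by exists r => //; rewrite /= in_itv /=; apply/andP; split => //; lra.
Qed.

Lemma growth_bounded rho ord (M : R) : proximate_order rho ord ->
  exists2 D, 0 <= D & forall r, 0 <= r -> r <= M -> growth rho r <= D.
Proof.
move=> hpo; have [S hS] := po_bounded M hpo.
exists (Num.max 1 M `^ S); first exact: powR_ge0.
move=> r r0 rM; have p0 : 0 <= rho r by exact: hpo.1.
have M1 : 1 <= Num.max 1 M by rewrite le_max lexx.
apply: le_trans (_ : Num.max 1 M `^ rho r <= _).
  apply: ge0_ler_powR => //; rewrite ?nnegrE //; first by rewrite (le_trans _ M1).
  by rewrite le_max rM orbT.
by apply: ler_powR => //; apply: hS; rewrite r0.
Qed.

(** Potter-type bounds: for large arguments, [g(b)/g(a)] lies between [(b/a)^(ord/2)] and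
    [(b/a)^(2 ord)]. The derivative of [rho(r) ln r] is [(rho + rho' r ln r)/r], whose numerator
    tends to [ord]. *)
Lemma po_potter rho ord : proximate_order rho ord ->
  exists2 r0, 1 <= r0 & forall a b, r0 <= a -> a <= b ->
    ord / 2 * (ln b - ln a) <= rho b * ln b - rho a * ln a <= ord * 2 * (ln b - ln a).
Proof.
move=> [_ [hd [_ [pos [h1 h2]]]]].
have o4 : 0 < ord / 4 by rewrite divr_gt0.
move/cvgrPdist_lt: h1 => /(_ _ o4)[M1 [_ H1]].
move/cvgrPdist_lt: h2 => /(_ _ o4)[M2 [_ H2]].
pose r0 := Num.max 1 (Num.max M1 M2) + 1.
have r01 : 1 < r0.
  by rewrite /r0; have : 1 <= Num.max 1 (Num.max M1 M2) by [rewrite le_max lexx]; lra.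
have rM x : r0 <= x -> M1 < x /\ M2 < x.
  rewrite /r0 => hx; have := le_max 1 1 (Num.max M1 M2).
  have a1 : M1 <= Num.max 1 (Num.max M1 M2) by rewrite !le_max lexx orbT.
  have a2 : M2 <= Num.max 1 (Num.max M1 M2) by rewrite !le_max lexx !orbT.
  by move=> _; lra.
exists r0; first exact: ltW.
(* Subtracting [c ln t], with [c = ord/2] or [c = 2 ord], reduces each inequality to the sign of a
   derivative. *)
have der (c x : R) : r0 <= x -> is_derive x (1 : R) (fun t => rho t * ln t - c * ln t)
    ((rho x + derive1 rho x * x * ln x - c) / x).
  move=> hx; have x0 : 0 < x by lra.
  have d1 : is_derive x (1 : R) rho (derive1 rho x).
    by rewrite derive1E; apply/derivableP/hd.
  have d2 := is_derive1_ln x0.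
  have := is_deriveB (is_deriveM d1 d2) (is_deriveZ c d2).
  have -> : (rho x *: x^-1 + ln x *: derive1 rho x) - c *: x^-1 = (rho x + derive1 rho x * x * ln x - c) / x.
    rewrite -![_ *: _]/(_ * _); move: (derive1 rho x) => q; field; exact: lt0r_neq0.
  by [].
have dval x : r0 <= x -> ord / 2 <= rho x + derive1 rho x * x * ln x <= ord * 2.
  move=> /rM[/H1 a1 /H2]; rewrite sub0r normrN.
  move: a1; rewrite !ltr_norml; move: (derive1 rho x * x * ln x) => q.
  by move=> /andP[? ?] /andP[? ?]; apply/andP; split; lra.
move=> a b ra ab.
have cw c : {within `[a, b], continuous (fun t => rho t * ln t - c * ln t)}.
  apply: derivable_within_continuous => x; rewrite in_itv /= => /andP[ax _].
  by apply: ex_derive; apply: der; lra.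
have mv c : exists2 k, r0 <= k & (rho b * ln b - c * ln b) - (rho a * ln a - c * ln a)
    = (rho k + derive1 rho k * k * ln k - c) / k * (b - a).
  have hder x : x \in `]a, b[%R -> is_derive x (1 : R) (fun t => rho t * ln t - c * ln t)
    ((rho x + derive1 rho x * x * ln x - c) / x).
    by rewrite in_itv /= => /andP[ax _]; apply: der; lra.
  have [k] := MVT_segment ab hder (cw c).
  by rewrite in_itv /= => /andP[ak _] e; exists k => //; lra.
apply/andP; split.
  have [k rk e] := mv (ord / 2).
  have : 0 <= (rho k + derive1 rho k * k * ln k - ord / 2) / k * (b - a).
    apply: mulr_ge0; last by lra.
    by apply: divr_ge0; [have := dval k rk => /andP[]; lra | lra].
  by rewrite -e; move: (rho b * _) (rho a * _) => *; lra.
have [k rk e] := mv (ord * 2).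
have : (rho k + derive1 rho k * k * ln k - ord * 2) / k * (b - a) <= 0.
  apply: mulr_le0_ge0; last by lra.
  by rewrite pmulr_lle0 ?invr_gt0; [have := dval k rk => /andP[]; lra | lra].
by rewrite -e; move: (rho b * _) (rho a * _) => *; lra.
Qed.

End Growth.

(** * The inverse growth function and the numbers G *)

Section Normalized.
Variable R : realType.
Local Open Scope classical_set_scope.
Variables (rho : R -> R) (ord : R).
Hypothesis hn : normalized_po rho ord.
Local Notation g := (growth rho).

Lemma npo_ord_gt0 : 0 < ord.
Proof. by have [[_ [_ [_ []]]]] := hn. Qed.

Lemma npo_lt r s : 0 < r -> r < s -> g r < g s.
Proof. by have [_ [h _]] := hn; exact: h. Qed.

Lemma npo_le r s : 0 < r -> r <= s -> g r <= g s.
Proof.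
move=> r0; rewrite le_eqVlt => /orP[/eqP -> //|rs]; exact/ltW/npo_lt.
Qed.

(** Intermediate values between a point where [g] is small, given by the limit at 0, and one where
    it is large, given by the lower Potter bound. *)
Lemma npo_onto s : 0 < s -> exists2 r, 0 < r & g r = s.
Proof.
move=> s0; have [hpo [_ h0]] := hn; have [r0 r01 pot] := po_potter hpo.
have o0 := npo_ord_gt0.
have [a a0 ga] : exists2 a, 0 < a & g a <= s.
  move/cvgrPdist_lt: h0 => /(_ _ s0).
  rewrite /at_right /prop_near1 /within /= -nbhs_ballE => -[d /= d0 hd].
  have d2 : 0 < d / 2 by rewrite divr_gt0.
  exists (d / 2) => //; have := hd (d / 2).
  rewrite /ball /= !sub0r !normrN !ger0_norm ?growth_ge0 ?(ltW d2) // => h.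
  by apply/ltW/h => //; lra.
have r0p : 0 < r0 by lra.
have g0 : 0 < g r0 by rewrite growthE // expR_gt0.
have [b b0 gb] : exists2 b, 0 < b & s <= g b.
  (* Chosen so that [g(r0 e^t) >= g(r0) (1 + (ord/2) t) = g(r0) + s]. *)
  pose t := s / (g r0 * (ord / 2)).
  have t0 : 0 <= t by rewrite divr_ge0 ?(ltW s0) // ltW // mulr_gt0 // divr_gt0.
  have rt : r0 <= r0 * expR t by rewrite ler_peMr ?(ltW r0p) // -expR0 ler_expR.
  have bp : 0 < r0 * expR t by rewrite mulr_gt0 ?expR_gt0.
  exists (r0 * expR t) => //.
  have := pot _ _ (lexx r0) rt => /andP[h _].
  rewrite growthE //; rewrite lnM ?posrE ?expR_gt0 // expRK addrAC subrr add0r in h.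
  have e : rho (r0 * expR t) * (ln r0 + t) >= rho r0 * ln r0 + ord / 2 * t by lra.
  rewrite lnM ?posrE ?expR_gt0 // expRK.
  apply: le_trans (_ : expR (rho r0 * ln r0 + ord / 2 * t) <= _); last by rewrite ler_expR.
  rewrite expRD -growthE //.
  apply: le_trans (_ : g r0 * (1 + ord / 2 * t) <= _); last by rewrite ler_pM2l // expR_ge1Dx.
  have -> : g r0 * (1 + ord / 2 * t) = g r0 + s.
    by rewrite /t; field; rewrite !gt_eqF.
  by rewrite lerDr ltW.
have [ab|/ltW ba] := leP a b; last first.
  exists a => //; apply/eqP; rewrite eq_le ga /=; apply: le_trans gb _; exact: npo_le.
pose f r := expR (rho r * ln r).
have cf : {within `[a, b], continuous f}.
  apply: derivable_within_continuous => x; rewrite in_itv /= => /andP[ax _].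
  have x0 : 0 < x by lra.
  have d1 : is_derive x (1 : R) rho (derive1 rho x).
    by rewrite derive1E; apply/derivableP/(hpo.2.1 x x0).
  have d3 := is_deriveM d1 (is_derive1_ln x0).
  exact: (@ex_derive _ _ _ _ _ _ _ (@is_derive1_comp _ expR (rho * @ln R) x _ _ (is_derive_expR _) d3)).
have fg x : 0 < x -> f x = g x by move=> x0; rewrite /f growthE.
have [c] : exists2 c, c \in `[a, b]%R & f c = s.
  apply: IVT ab cf _; rewrite !fg // ge_min ga /= le_max gb; exact/orbT.
rewrite in_itv /= => /andP[ac _] fc; have c0 : 0 < c by lra.
by exists c => //; rewrite -fg.
Qed.

Lemma phiP s : 0 < s -> 0 < phi rho s /\ g (phi rho s) = s.
Proof.
move=> /npo_onto[r r0 gr].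
by apply: (@xgetPex _ 0 [set r | 0 < r /\ g r = s]); exists r.
Qed.

Lemma phi_le s t : 0 < s -> s <= t -> phi rho s <= phi rho t.
Proof.
move=> s0 st; have [p1 e1] := phiP s0; have [p2 e2] := phiP (lt_le_trans s0 st).
rewrite leNgt; apply/negP => h; have := npo_lt p2 h; rewrite e1 e2; lra.
Qed.

Definition Gconst : R := (expR 1 * ord) `^ ord^-1.

Lemma Gconst_gt0 : 0 < Gconst.
Proof. by apply: powR_gt0; rewrite mulr_gt0 ?expR_gt0 // npo_ord_gt0. Qed.

(** Also valid at [l = 0], where the zeroth power makes the value of [phi] immaterial. *)
Lemma GnumE l : Gnum rho ord l = (phi rho l%:R / Gconst) ^+ l.
Proof.
rewrite /Gnum; case: eqP => [->|_]; first by rewrite expr0.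
by rewrite exprMn exprVn [l%:R / _]mulrC powRrM powR_mulrn // powR_ge0.
Qed.

Lemma Gnum_gt0 l : 0 < Gnum rho ord l.
Proof.
rewrite GnumE; case: l => [|l]; first by rewrite expr0.
by rewrite exprn_gt0 // divr_gt0 ?Gconst_gt0 //; apply: (phiP _).1; rewrite ltr0n.
Qed.

(** Since [phi] increases, both bases on the left are at most the base belonging to [j + k]. *)
Lemma GnumD j k : Gnum rho ord j * Gnum rho ord k <= Gnum rho ord (j + k).
Proof.
have K0 := Gconst_gt0.
have mono j' k' : (0 < j')%N -> (j' <= k')%N -> 0 <= phi rho j'%:R / Gconst <= phi rho k'%:R / Gconst.
  move=> j0 jk; have s0 : 0 < j'%:R :> R by rewrite ltr0n.
  rewrite divr_ge0 ?(ltW K0) ?(ltW (phiP s0).1) //= ler_pM2r ?invr_gt0 //.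
  by apply: phi_le => //; rewrite ler_nat.
rewrite !GnumE; case: j => [|j]; first by rewrite expr0 mul1r.
case: k => [|k]; first by rewrite addn0 expr0 mulr1.
rewrite exprD.
have /andP[j0 jl] := mono j.+1 (j.+1 + k.+1)%N isT (leq_addr _ _).
have /andP[k0 kl] := mono k.+1 (j.+1 + k.+1)%N isT (leq_addl _ _).
apply: ler_pM; rewrite ?exprn_ge0 //.
  by rewrite lerXn2r // nnegrE // (le_trans j0).
by rewrite lerXn2r // nnegrE // (le_trans k0).
Qed.

(** Take [r = phi k]: then [g r = k] and [r^k / G_k = Gconst^k], so [B = e^s / Gconst]. The extra
    summand of [M] serves [k = 0], where [r = 1]. *)
Lemma growth_attained (s : R) : exists2 B, 0 < B & exists2 M, 0 < M &
  forall k, exists2 r, 0 < r & expR (s * g r) <= M * B ^+ k * r ^+ k / Gnum rho ord k.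
Proof.
have K0 := Gconst_gt0.
exists (expR s / Gconst); first by rewrite divr_gt0 ?expR_gt0.
exists (1 + expR (s * g 1)); first by rewrite ltr_wpDr ?expR_ge0.
case=> [|k].
  by exists 1 => //; rewrite !expr0 /Gnum eqxx divr1 !mulr1 lerDr.
have s0 : 0 < k.+1%:R :> R by rewrite ltr0n.
have [p0 pe] := phiP s0; exists (phi rho k.+1%:R) => //.
rewrite pe [s * _]mulrC expRM_natl GnumE -mulrA -mulrA -exprVn -!exprMn.
have -> : expR s / Gconst * (phi rho k.+1%:R * (phi rho k.+1%:R / Gconst)^-1) = expR s.
  by field; rewrite !gt_eqF.
by rewrite ler_peMl ?exprn_ge0 ?expR_ge0 // lerDl expR_ge0.
Qed.

(* With R' = max (phi k) r0, the bound is trivial for r <= d R', and for r > d R'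
   the factor (r / (d R'))^k is absorbed by the exponential, since k <= g R'. *)
Lemma pow_le_growth (d : R) : 0 < d -> d <= 1 -> exists2 s, 0 < s & exists2 M, 0 < M &
  forall r k, 0 <= r -> r ^+ k <= M * d ^+ k * phi rho k%:R ^+ k * expR (s * g r).
Proof.
move=> d0 d1; have [hpo _] := hn; have [r0 r01 pot] := po_potter hpo.
have o0 := npo_ord_gt0; have r0p : 0 < r0 by lra.
have p1 : 0 < phi rho 1%:R by exact: (phiP ltr01).1.
pose q := Num.max 1 (r0 / phi rho 1%:R).
have q1 : 1 <= q by rewrite le_max lexx.
pose C1 := expR (g r0 * ln q).
pose L := - ln d; have L0 : 0 <= L by rewrite oppr_ge0 ln_le0.
pose A := expR (ord * 2 * L).
(* The terms [2/ord] and [L] handle [r >= R'], the term [L A] handles [r0 <= r < R'], and 1 is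
   slack. In [M], the factor [1 + C1] pays for [phi k < r0], the exponential for [r < r0]. *)
have [s sE] : exists s, s = 2 / ord + L * (1 + A) + 1 by exists (2 / ord + L * (1 + A) + 1).
have [M ME] : exists M, M = (1 + C1) * expR (L * g (r0 / d)) by exists ((1 + C1) * expR (L * g (r0 / d))).
have A0 : 0 < A by rewrite expR_gt0.
have C10 : 0 < C1 by rewrite expR_gt0.
have gd : 0 <= g (r0 / d) by exact: growth_ge0.
have s0 : 0 < s by rewrite sE ltr_wpDl // addr_ge0 ?divr_ge0 ?(ltW o0) // mulr_ge0 //; lra.
exists s => //; exists M; first by rewrite ME mulr_gt0 ?expR_gt0 //; lra.
have eL : 1 <= expR (L * g (r0 / d)) by rewrite -expR0 ler_expR mulr_ge0.
have M1 : 1 <= M by rewrite ME; apply: mulr_ege1 => //; lra.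
move=> r [|k] rge0.
  change (1 <= M * 1 * 1 * expR (s * g r)); rewrite (mulr1 M) (mulr1 M).
  apply: mulr_ege1; first exact: M1.
  by rewrite -expR0 ler_expR mulr_ge0 ?growth_ge0 // ltW.
set N := k.+1; have N0 : 0 < N%:R :> R by rewrite ltr0n.
have [Rp gR] := phiP N0; set RR := phi rho N%:R in Rp gR *.
pose R' := Num.max RR r0.
have R'0 : 0 < R' by rewrite lt_max Rp.
have R'r0 : r0 <= R' by rewrite le_max lexx orbT.
have kg : N%:R <= g R' by rewrite -gR; apply: npo_le => //; rewrite le_max lexx.
(* If [phi k < r0] then [k <= g r0], so [q^k] is at most the constant [C1]. *)
have hR' : R' ^+ N <= (1 + C1) * RR ^+ N.
  rewrite /R'; case: (leP r0 RR) => hr.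
    by rewrite ler_peMl ?exprn_ge0 ?(ltW Rp) //; lra.
  have r0q : r0 <= q * RR.
    apply: le_trans (_ : r0 / phi rho 1%:R * RR <= _).
      rewrite -mulrA ler_peMr ?(ltW r0p) // mulrC ler_pdivlMr // mul1r.
      by apply: phi_le => //; rewrite ler1n.
    by rewrite ler_pM2r // le_max lexx orbT.
  apply: le_trans (_ : (q * RR) ^+ N <= _).
    by rewrite lerXn2r // ?nnegrE ?(ltW r0p) // (le_trans (ltW r0p)).
  rewrite exprMn ler_pM2r ?exprn_gt0 //.
  apply: le_trans (_ : C1 <= _); last by rewrite lerDr.
  have q0 : 0 < q by lra.
  rewrite -[q]lnK ?posrE // -expRM_natl /C1 ler_expR ler_wpM2r ?ln_ge0 //.
  by rewrite -gR; apply: npo_le => //; apply: ltW.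
suff key : r ^+ N <= (d * R') ^+ N * (expR (L * g (r0 / d)) * expR (s * g r)).
  apply: le_trans key _; rewrite exprMn.
  have -> : M * d ^+ N * RR ^+ N * expR (s * g r)
    = d ^+ N * ((1 + C1) * RR ^+ N) * (expR (L * g (r0 / d)) * expR (s * g r)).
    by rewrite ME; move: (1 + C1) (expR (L * _)) (expR (s * _)) => x y t; ring.
  apply: ler_wpM2r; first by rewrite mulr_ge0 ?expR_ge0.
  by apply: ler_wpM2l => //; rewrite exprn_ge0 ?ltW.
have dR : 0 < d * R' by rewrite mulr_gt0.
have [rd|dr] := leP r (d * R').
  apply: le_trans (_ : (d * R') ^+ N <= _); first by rewrite lerXn2r // nnegrE ltW.
  rewrite ler_peMr ?exprn_ge0 ?(ltW dR) //; apply: mulr_ege1; first exact: eL.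
  by rewrite -expR0 ler_expR mulr_ge0 ?growth_ge0 // ltW.
have rp : 0 < r by lra.
have lnd : ln (r / (d * R')) = ln r - ln R' + L.
  by rewrite ln_div ?posrE // lnM ?posrE // /L; ring.
have lnt : 0 <= ln (r / (d * R')) by rewrite ln_ge0 // ler_pdivlMr // mul1r ltW.
have -> : r ^+ N = (d * R') ^+ N * expR (N%:R * ln (r / (d * R'))).
  by rewrite expRM_natl lnK ?posrE ?divr_gt0 // -exprMn mulrC divfK // gt_eqF.
rewrite ler_pM2l ?exprn_gt0 // -expRD ler_expR.
apply: le_trans (_ : g R' * ln (r / (d * R')) <= _); first by rewrite ler_wpM2r.
have gr0 : 0 <= g r by exact: growth_ge0.
have gR'0 : 0 < g R' by rewrite growthE // expR_gt0.
have [Rr|rR] := leP R' r.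
  have /andP[h _] := pot _ _ R'r0 Rr.
  (* Lower Potter bound with [e^x >= 1 + x]: this controls [g R' * (ln r - ln R')] by a multiple of
     [g r]. *)
  have h1 : g R' * (1 + ord / 2 * (ln r - ln R')) <= g r.
    rewrite [g r]growthE // [g R']growthE //.
    have -> : rho r * ln r = rho R' * ln R' + (rho r * ln r - rho R' * ln R') by ring.
    rewrite expRD ler_pM2l ?expR_gt0 //; apply: le_trans (expR_ge1Dx _) _.
    by rewrite ler_expR.
  have h2 : g R' <= g r by exact: npo_le.
  have h3 : g R' * (ln r - ln R') <= 2 / ord * g r.
    rewrite -(ler_pM2l (divr_gt0 o0 (ltr0n R 2))).
    have -> : ord / 2 * (2 / ord * g r) = g r by field; rewrite gt_eqF.
    by apply: le_trans h1; move: (ltW gR'0); move: (ln r - ln R') (g R') => x y ?; lra.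
  rewrite lnd mulrDr.
  have h4 : g R' * L <= L * g r by rewrite mulrC ler_wpM2l.
  have h5 : 0 <= L * g (r0 / d) by rewrite mulr_ge0.
  have h6 : 0 <= L * A * g r by rewrite !mulr_ge0 // ltW.
  have -> : s * g r = 2 / ord * g r + L * g r + L * A * g r + g r by rewrite sE; ring.
  lra.
(* Here [d R' < r < R'], so the logarithm is at most [L]. It remains to compare [g R'] with [g r],
   by the upper Potter bound, or with a constant when [r < r0]. *)
have lnR : ln (r / (d * R')) <= L.
  by rewrite lnd gerDr subr_le0 ler_ln ?posrE // ltW.
apply: le_trans (ler_wpM2l (ltW gR'0) lnR) _.
have dR'r : R' <= r / d by rewrite ler_pdivlMr // mulrC ltW.
have h6 : 0 <= L * g r by rewrite mulr_ge0.
have h7 : 0 <= L * g (r0 / d) by rewrite mulr_ge0.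
have h8 : 0 <= 2 / ord * g r by rewrite mulr_ge0 // divr_ge0 // ltW.
have [r0r|rr0] := leP r0 r.
  have /andP[_ h] := pot _ _ r0r (ltW rR).
  have h1 : g R' <= g r * A.
    rewrite [g r]growthE // [g R']growthE // -expRD ler_expR.
    have h2 : ln R' - ln r <= L.
      have : ln R' <= ln (r / d) by rewrite ler_ln ?posrE // divr_gt0.
      by rewrite ln_div ?posrE // /L; lra.
    have := ler_wpM2l (_ : 0 <= ord * 2) h2; rewrite mulr_ge0 ?(ltW o0) // => /(_ isT).
    by move: h; move: (rho R' * _) (rho r * _) (ord * 2 * _) (ord * 2 * _) => *; lra.
  have h9 := ler_wpM2r L0 h1.
  have -> : s * g r = 2 / ord * g r + L * g r + g r * A * L + g r by rewrite sE; ring.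
  lra.
have h1 : g R' <= g (r0 / d).
  by apply: npo_le => //; apply: le_trans dR'r _; rewrite ler_pM2r ?invr_gt0 // ltW.
have h9 := ler_wpM2r L0 h1.
have h10 : 0 <= L * A * g r by rewrite !mulr_ge0 // ltW.
have -> : s * g r = 2 / ord * g r + L * g r + L * A * g r + g r by rewrite sE; ring.
lra.
Qed.

End Normalized.

Section WeightSequence.
Variable R : realType.

(* The only properties of the numbers G_{rho,l} that the argument uses. *)
Definition weight_sequence (g : R -> R) (G : nat -> R) : Prop :=
  [/\ forall k, 0 < G k, forall j k, G j * G k <= G (j + k)%N,
    forall e, 0 < e -> exists2 s, 0 < s & exists2 M, 0 < M &
      forall r k, 0 <= r -> r ^+ k <= M * e ^+ k * G k * expR (s * g r) &
    forall s, 0 <= s -> exists2 B, 0 < B & exists2 M, 0 < M &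
      forall k, exists2 r, 0 < r & expR (s * g r) <= M * B ^+ k * r ^+ k / G k].

Lemma growth_eventually_eq (rho rho' : R -> R) (ord ord' : R) :
  proximate_order rho ord -> proximate_order rho' ord' ->
  (exists M, forall r, M < r -> rho r = rho' r) ->
  exists2 D, 0 <= D & forall r, 0 <= r -> growth rho r <= growth rho' r + D.
Proof.
move=> h h' [M hM]; have [D D0 hD] := growth_bounded M h; exists D => // r r0.
have [rM|Mr] := leP r M.
  by apply: le_trans (hD r r0 rM) _; rewrite lerDr growth_ge0.
by rewrite /growth hM // lerDl.
Qed.

(** Replacing one growth function by the other costs a factor [expR (s * D)]. The choice
    [d = min(1, e / Gconst)] meets the restriction [d <= 1] and turns powers of [phi] into
    [Gnum]. *)
Lemma po_weight_sequence (rho1 rhohat : R -> R) (ord : R) :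
  proximate_order rho1 ord -> normalized_po rhohat ord ->
  (exists M, forall r, M < r -> rhohat r = rho1 r) ->
  weight_sequence (growth rho1) (Gnum rhohat ord).
Proof.
move=> h1 hn hM; have hh := hn.1.
have hM' : exists M, forall r, M < r -> rho1 r = rhohat r.
  by have [M h] := hM; exists M => r /h.
have [D D0 hD] := growth_eventually_eq hh h1 hM.
have [D' D0' hD'] := growth_eventually_eq h1 hh hM'.
have K0 := Gconst_gt0 hn.
split.
- exact: Gnum_gt0 hn.
- exact: GnumD hn.
- move=> e e0; pose d := Num.min 1 (e / Gconst ord).
  have d0 : 0 < d by rewrite lt_min ltr01 divr_gt0.
  have d1 : d <= 1 by rewrite ge_min lexx.
  have de : d <= e / Gconst ord by rewrite ge_min lexx orbT.
  have [s s0 [M M0 h]] := pow_le_growth hn d0 d1.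
  exists s => //; exists (M * expR (s * D)); first by rewrite mulr_gt0 ?expR_gt0.
  move=> r k r0; apply: le_trans (h r k r0) _.
  have E : expR (s * growth rhohat r) <= expR (s * D) * expR (s * growth rho1 r).
    by rewrite -expRD ler_expR -mulrDr ler_pM2l // addrC hD.
  have P : d ^+ k * phi rhohat k%:R ^+ k <= e ^+ k * Gnum rhohat ord k.
    rewrite GnumE -!exprMn; case: k {h} => [|k]; first by rewrite !expr0.
    have p0 : 0 <= phi rhohat k.+1%:R by rewrite ltW // (phiP hn _).1 // ltr0n.
    rewrite lerXn2r ?nnegrE //.
    - by rewrite mulr_ge0 // ltW.
    - by rewrite mulr_ge0 ?divr_ge0 // ltW.
    - have -> : e * (phi rhohat k.+1%:R / Gconst ord) = e / Gconst ord * phi rhohat k.+1%:R by ring.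
      by rewrite ler_wpM2r.
  have P0 : 0 <= d ^+ k * phi rhohat k%:R ^+ k.
    case: k {h P} => [|k]; first by rewrite !expr0 mulr1.
    by rewrite mulr_ge0 ?exprn_ge0 ?(ltW d0) // ltW // (phiP hn _).1 // ltr0n.
  rewrite -(mulrA M) -(mulrA M).
  have -> : M * expR (s * D) * e ^+ k * Gnum rhohat ord k * expR (s * growth rho1 r)
    = M * ((e ^+ k * Gnum rhohat ord k) * (expR (s * D) * expR (s * growth rho1 r))) by ring.
  by rewrite ler_pM2l // ler_pM ?expR_ge0.
- move=> s s0; have [B B0 [M M0 h]] := growth_attained hn s.
  exists B => //; exists (expR (s * D') * M); first by rewrite mulr_gt0 ?expR_gt0.
  move=> k; have [r r0 hr] := h k; exists r => //.
  apply: le_trans (_ : expR (s * D') * expR (s * growth rhohat r) <= _).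
    by rewrite -expRD ler_expR -mulrDr ler_wpM2l // addrC hD' // ltW.
  by rewrite -!mulrA ler_pM2l ?expR_gt0 // !mulrA.
Qed.

(** The summand 1 absorbs the bounded range of [r], where the growth of [rho2] may be arbitrarily
    small. *)
Lemma growth_dominated (rho1 rho2 : R -> R) (ord1 : R) :
  proximate_order rho1 ord1 ->
  (exists C M, forall r, M < r -> growth rho1 r <= C * growth rho2 r) ->
  exists2 K, 0 < K & forall r, 0 <= r -> growth rho1 r <= K * (growth rho2 r + 1).
Proof.
move=> h [C [M hM]]; have [D D0 hD] := growth_bounded M h.
exists (`|C| + D + 1); first by rewrite ltr_wpDl // addr_ge0.
move=> r r0; have g0 := growth_ge0 rho2 r; have C0 := normr_ge0 C.
have p1 : 0 <= `|C| * growth rho2 r by rewrite mulr_ge0.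
have p2 : 0 <= D * growth rho2 r by rewrite mulr_ge0.
have [rM|Mr] := leP r M.
  by have := hD r r0 rM; lra.
have := hM r Mr; have : C * growth rho2 r <= `|C| * growth rho2 r.
  by rewrite ler_wpM2r // ler_norm.
lra.
Qed.

End WeightSequence.

(** * Weighted bounds *)

Section SeriesAlgebra.
Variables (R : realType) (n : nat).
Local Notation C := (complex R).
Local Notation Cl := (Cl R n).
Local Notation Pt := (Pt R n).
Local Notation slice := ({set 'I_n} -> C -> C).
Implicit Types (x y : Pt) (F G : slice) (A B D : {set 'I_n}) (z w : C) (a b : nat -> Cl).

Lemma ReD z w : complex.Re (z + w) = complex.Re z + complex.Re w.
Proof. by case: z w => ? ? []. Qed.
Lemma ImD z w : complex.Im (z + w) = complex.Im z + complex.Im w.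
Proof. by case: z w => ? ? []. Qed.
Lemma ReZ (t : R) z : complex.Re (t%:C%C * z) = t * complex.Re z.
Proof. by case: z => p q /=; rewrite mul0r subr0. Qed.
Lemma ImZ (t : R) z : complex.Im (t%:C%C * z) = t * complex.Im z.
Proof. by case: z => p q /=; rewrite mul0r addr0. Qed.

Lemma ofs_ext F G x : (forall A, F A (zof x) = G A (zof x)) -> ofs F x = ofs G x.
Proof.
by move=> h; congr (_ + clmul _ _); apply/ffunP => A; rewrite !ffunE h.
Qed.

Lemma ofsD F G x : ofs (fun A z => F A z + G A z) x = ofs F x + ofs G x.
Proof.
rewrite /ofs addrACA -clmulDr; congr (_ + clmul _ _);
  by apply/ffunP => A; rewrite !ffunE ?ReD ?ImD.
Qed.

Lemma ofsZ (t : R) F x : ofs (fun A z => t%:C%C * F A z) x = clscale t (ofs F x).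
Proof.
rewrite /ofs clscaleD -clmulZr; congr (_ + clmul _ _);
  by apply/ffunP => A; rewrite !ffunE ?ReZ ?ImZ.
Qed.

Lemma ofs0 x : ofs (fun _ _ => 0) x = 0.
Proof.
have -> : ofs (fun _ _ => 0) x = clscale 0 (ofs (fun _ _ => 0) x).
  by rewrite -ofsZ; apply: ofs_ext => A; rewrite mul0r.
by rewrite clscale0.
Qed.

Lemma ofs_sum (I : Type) (r : seq I) (P : pred I) (F : I -> slice) x :
  ofs (fun A z => \sum_(i <- r | P i) F i A z) x = \sum_(i <- r | P i) ofs (F i) x.
Proof.
elim: r => [|i r IH].
  by rewrite big_nil -[RHS](ofs0 x); apply: ofs_ext => A; rewrite big_nil.
rewrite big_cons -IH; case Pi: (P i); last by apply: ofs_ext => A; rewrite big_cons Pi.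
by rewrite -ofsD; apply: ofs_ext => A; rewrite big_cons Pi.
Qed.

Lemma sentire_bound a :
  (forall r : R, 0 < r -> exists M, forall k A, `|a k A| * r ^+ k <= M) -> sentire a.
Proof. by move=> h A r /h[M hM]; exists M => k; rewrite cmodR. Qed.

Lemma sentireD a b : sentire a -> sentire b -> sentire (fun k => a k + b k).
Proof.
move=> ha hb A; have -> : pcoef (fun k => a k + b k) A = (fun k => pcoef a A k + pcoef b A k).
  by apply/funext => k; rewrite /pcoef ffunE rmorphD.
by apply: entireD; [exact: ha | exact: hb].
Qed.

Lemma sentireZ t a : sentire a -> sentire (fun k => clscale t (a k)).
Proof.
move=> ha A; have -> : pcoef (fun k => clscale t (a k)) A = (fun k => t%:C%C * pcoef a A k).
  by apply/funext => k; rewrite /pcoef clscaleE rmorphM.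
by apply: entireZ; exact: ha.
Qed.

Lemma pserD a b x : sentire a -> sentire b ->
  pser (fun k => a k + b k) x = pser a x + pser b x.
Proof.
move=> ha hb; rewrite /pser -ofsD; apply: ofs_ext => A; rewrite /cpser.
have -> : pcoef (fun k => a k + b k) A = (fun k => pcoef a A k + pcoef b A k).
  by apply/funext => k; rewrite /pcoef ffunE rmorphD.
by rewrite cserD.
Qed.

Lemma pserZ t a x : sentire a -> pser (fun k => clscale t (a k)) x = clscale t (pser a x).
Proof.
move=> ha; rewrite /pser -ofsZ; apply: ofs_ext => A; rewrite /cpser.
have -> : pcoef (fun k => clscale t (a k)) A = (fun k => t%:C%C * pcoef a A k).
  by apply/funext => k; rewrite /pcoef clscaleE rmorphM.
by rewrite cserZ //; exact: ha.
Qed.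

Lemma sentireB a b : sentire a -> sentire b -> sentire (fun k => a k - b k).
Proof.
move=> ha hb; have -> : (fun k => a k - b k) = (fun k => a k + clscale (-1) (b k)).
  by apply/funext => k; rewrite clscaleN1.
by apply: sentireD => //; apply: sentireZ.
Qed.

Lemma pserB a b x : sentire a -> sentire b ->
  pser (fun k => a k - b k) x = pser a x - pser b x.
Proof.
move=> ha hb; have -> : (fun k => a k - b k) = (fun k => a k + clscale (-1) (b k)).
  by apply/funext => k; rewrite clscaleN1.
by rewrite pserD ?pserZ ?clscaleN1 //; apply: sentireZ.
Qed.

Lemma sentire0 : sentire (fun=> 0 : Cl).
Proof. by apply: sentire_bound => r _; exists 0 => k A; rewrite ffunE normr0 mul0r. Qed.

Lemma pser0 x : pser (fun=> 0) x = 0.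
Proof.
have e : (fun k : nat => clscale 0 (0 : Cl)) = (fun=> 0) by apply/funext => k; rewrite clscale0.
by have := pserZ 0 x sentire0; rewrite e clscale0.
Qed.

Lemma sentire_sum (N : nat) (a : nat -> nat -> Cl) : (forall l, sentire (a l)) ->
  sentire (fun k => \sum_(l < N) a l k).
Proof.
move=> ha; elim: N => [|N IH].
  by have -> : (fun k => \sum_(l < 0) a l k) = (fun=> 0) by [apply/funext => k; rewrite big_ord0]; exact: sentire0.
have -> : (fun k => \sum_(l < N.+1) a l k) = (fun k => \sum_(l < N) a l k + a N k).
  by apply/funext => k; rewrite big_ord_recr.
exact: sentireD.
Qed.

Lemma pser_sum (N : nat) (a : nat -> nat -> Cl) x : (forall l, sentire (a l)) ->
  pser (fun k => \sum_(l < N) a l k) x = \sum_(l < N) pser (a l) x.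
Proof.
move=> ha; elim: N => [|N IH].
  have -> : (fun k => \sum_(l < 0) a l k) = (fun=> 0) by apply/funext => k; rewrite big_ord0.
  by rewrite big_ord0 pser0.
have -> : (fun k => \sum_(l < N.+1) a l k) = (fun k => \sum_(l < N) a l k + a N k).
  by apply/funext => k; rewrite big_ord_recr.
by rewrite big_ord_recr /= -IH -pserD //; exact: sentire_sum.
Qed.

Lemma iter_sderB a b l : iter l (@sder R n) (fun k => a k - b k) =
  (fun k => iter l (@sder R n) a k - iter l (@sder R n) b k).
Proof.
apply/funext => k; rewrite !iter_sderE clscaleD; congr (_ + _).
by rewrite -!clscaleN1 !clscaleA mulrC.
Qed.

Hypothesis n0 : (0 < n)%N.

Lemma slice_sub (f g : Pt -> Cl) : slice_monogenic f -> slice_monogenic g ->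
  slice_monogenic (fun x => f x - g x).
Proof.
move=> /(slice_series n0)[a ha ->] /(slice_series n0)[b hb ->].
have -> : (fun x => pser a x - pser b x) = pser (fun k => a k - b k).
  by apply/funext => x; rewrite pserB.
exact/pser_slice/sentireB.
Qed.

Lemma slice0 : slice_monogenic (fun=> 0 : Cl).
Proof.
have -> : (fun=> 0 : Cl) = pser (fun=> 0) by apply/funext => x; rewrite pser0.
exact/pser_slice/sentire0.
Qed.

Lemma slice_add (f g : Pt -> Cl) : slice_monogenic f -> slice_monogenic g ->
  slice_monogenic (fun x => f x + g x).
Proof.
move=> /(slice_series n0)[a ha ->] /(slice_series n0)[b hb ->].
have -> : (fun x => pser a x + pser b x) = pser (fun k => a k + b k).
  by apply/funext => x; rewrite pserD.
exact/pser_slice/sentireD.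
Qed.

Lemma slice_sum (N : nat) (t : nat -> Pt -> Cl) : (forall l, slice_monogenic (t l)) ->
  slice_monogenic (fun x => \sum_(l < N) t l x).
Proof.
move=> ht; elim: N => [|N IH].
  have -> : (fun x => \sum_(l < 0) t l x) = (fun=> 0) by apply/funext => x; rewrite big_ord0.
  exact: slice0.
have -> : (fun x => \sum_(l < N.+1) t l x) = (fun x => \sum_(l < N) t l x + t N x).
  by apply/funext => x; rewrite big_ord_recr.
exact: slice_add.
Qed.

Lemma slice_star (f g : Pt -> Cl) : slice_monogenic f -> slice_monogenic g ->
  slice_monogenic (star f g).
Proof.
move=> /(slice_ofs n0)[F hF ->] /(slice_ofs n0)[G hG ->].
by rewrite star_ofs //; apply/ofs_slice/sholo_smul.
Qed.

Lemma slice_iter_pdx0 l (f : Pt -> Cl) : slice_monogenic f ->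
  slice_monogenic (iter l (@pdx0 R n) f).
Proof.
move=> /(slice_series n0)[a ha ->]; rewrite iter_pdx0_pser //.
exact/pser_slice/sentire_iter.
Qed.

Lemma iter_pdx0B l (f g : Pt -> Cl) x : slice_monogenic f -> slice_monogenic g ->
  iter l (@pdx0 R n) (fun x => f x - g x) x
  = iter l (@pdx0 R n) f x - iter l (@pdx0 R n) g x.
Proof.
move=> /(slice_series n0)[a ha ->] /(slice_series n0)[b hb ->].
have -> : (fun x => pser a x - pser b x) = pser (fun k => a k - b k).
  by apply/funext => y; rewrite pserB.
rewrite !iter_pdx0_pser //; last exact: sentireB.
by rewrite iter_sderB pserB //; apply: sentire_iter.
Qed.

Lemma clhalfE (p : Cl) : clhalf p = clscale (1 / 2) p.
Proof. by apply/ffunP => A; rewrite !ffunE mul1r mulrC. Qed.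

(** Pointwise algebra: the components entering [star] are linear in the values of the second factor
    at [x] and its conjugate. *)
Lemma starD (f g h : Pt -> Cl) x : star f (fun x => g x + h x) x = star f g x + star f h x.
Proof.
rewrite /star; have -> : clhalf (g x + h x + (g (pconj x) + h (pconj x)))
   = clhalf (g x + g (pconj x)) + clhalf (h x + h (pconj x)).
  by rewrite !clhalfE -clscaleD addrACA.
have -> : clhalf (g x + h x - (g (pconj x) + h (pconj x)))
   = clhalf (g x - g (pconj x)) + clhalf (h x - h (pconj x)).
  by rewrite !clhalfE -clscaleD opprD addrACA.
rewrite [clmul (jdir x) (_ + clhalf (h x - _))]clmulDr opprD.
move: (clhalf (f x + _)) (- clmul (jdir x) (clhalf (f x - _))) => p q.
move: (clhalf (g x + _)) (clhalf (h x + _)) => a a'.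
move: (- clmul (jdir x) (clhalf (g x - _))) (- clmul (jdir x) (clhalf (h x - _))) => b b'.
rewrite (clmulDr p a) (clmulDr q b) (clmulDr q a) (clmulDr p b).
have -> : clmul q a + clmul q a' + (clmul p b + clmul p b')
    = (clmul q a + clmul p b) + (clmul q a' + clmul p b') by rewrite addrACA.
rewrite (clmulDr (jdir x) (clmul q a + clmul p b)).
move: (clmul (jdir x) _) (clmul (jdir x) _) (clmul p a) (clmul q b) (clmul p a') (clmul q b') => u v s t s' t'.
by rewrite opprD (addrACA s) (addrACA (s - t)).
Qed.

Lemma starB (f g h : Pt -> Cl) x : star f (fun x => g x - h x) x = star f g x - star f h x.
Proof.
have -> : star f g x = star f (fun x => (g x - h x) + h x) x.
  by congr star; apply/funext => y; rewrite subrK.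
by rewrite [X in _ = X - _](starD f (fun x => g x - h x) h) addrK.
Qed.

Lemma star_rmul (f g : Pt -> Cl) (c : Cl) x :
  star f (fun x => clmul (g x) c) x = clmul (star f g x) c.
Proof.
have half (p : Cl) : clhalf (clmul p c) = clmul (clhalf p) c.
  by rewrite !clhalfE clmulZl.
rewrite /star; have -> : clmul (g x) c + clmul (g (pconj x)) c = clmul (g x + g (pconj x)) c.
  by rewrite clmulDl.
have -> : clmul (g x) c - clmul (g (pconj x)) c = clmul (g x - g (pconj x)) c.
  by rewrite clmulDl clmulNl.
rewrite !half (clmulA (jdir x)) -[- clmul (clmul (jdir x) _) c]clmulNl.
move: (clhalf (f x + _)) (- clmul (jdir x) (clhalf (f x - _))) => p q.
move: (clhalf (g x + _)) (- clmul (jdir x) (clhalf (g x - _))) => a b.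
by rewrite (clmulA p a) (clmulA q b) (clmulA q a) (clmulA p b) -clmulDl (clmulA (jdir x)) -clmulNl -!clmulDl.
Qed.

End SeriesAlgebra.

(** * Weighted bounds and convergence in the inductive limit *)

Section Weighted.
Variables (R : realType) (n : nat).
Local Notation Cl := (Cl R n).
Local Notation Pt := (Pt R n).
Local Open Scope classical_set_scope.
Implicit Types (rho : R -> R) (f g : Pt -> Cl) (s M : R).

(** A bound free of suprema, in the submultiplicative norm; it agrees with a bound on [normA] up to
    the factor [2^n]. *)
Definition wbound rho s M f :=
  forall x, cln1 (f x) <= M * expR (s * growth rho (ptnorm x)).

Lemma wbound_weighted rho s M f x : wbound rho s M f -> weighted rho s f x <= M.
Proof.
move=> h; rewrite /weighted expRN ler_pdivrMr ?expR_gt0 //.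
by apply: le_trans (clnorm_le_cln1 _) _; exact: h.
Qed.

Lemma wbound_inA rho s M f : slice_monogenic f -> wbound rho s M f -> inA rho s f.
Proof. by move=> hf h; split=> //; exists M => x; apply: wbound_weighted. Qed.

Lemma weighted_ge0 rho s f x : 0 <= weighted rho s f x.
Proof. by rewrite mulr_ge0 ?expR_ge0 // sqrtr_ge0. Qed.

Definition pt0 : Pt := (0, fun=> 0).

Lemma wbound_normA rho s M f : wbound rho s M f -> normA rho s f <= M.
Proof.
move=> h; apply: ge_sup; first by exists (weighted rho s f pt0), pt0.
by move=> _ [x _ <-]; apply: wbound_weighted.
Qed.

Lemma weighted_le_normA rho s f x : inA rho s f -> weighted rho s f x <= normA rho s f.
Proof.
move=> [_ [M hM]]; apply: sup_upper_bound; last by exists x.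
split; first by exists (weighted rho s f pt0), pt0.
by exists M => _ [y _ <-].
Qed.

Lemma normA_ge0 rho s f : inA rho s f -> 0 <= normA rho s f.
Proof. by move=> /(weighted_le_normA pt0); apply: le_trans; apply: weighted_ge0. Qed.

Lemma normA_wb rho s f : inA rho s f -> wbound rho s (2 ^+ n * normA rho s f) f.
Proof.
move=> h x; apply: le_trans (cln1_le_clnorm _) _; rewrite -mulrA ler_pM2l ?exprn_gt0 //.
by have := weighted_le_normA x h; rewrite /weighted expRN ler_pdivrMr ?expR_gt0.
Qed.

Lemma wbound_ge0 rho s M f : wbound rho s M f -> 0 <= M.
Proof.
move=> /(_ pt0) h; have := le_trans (cln1_ge0 _) h.
by rewrite pmulr_lge0 ?expR_gt0.
Qed.

Lemma wbound_mono rho s s' M M' f : s <= s' -> M <= M' -> wbound rho s M f -> wbound rho s' M' f.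
Proof.
move=> ss MM h x; have M0 := wbound_ge0 h; apply: le_trans (h x) _.
by apply: ler_pM; rewrite ?expR_ge0 // ler_expR ler_wpM2r // growth_ge0.
Qed.

Lemma wboundB rho s M M' f g : wbound rho s M f -> wbound rho s M' g ->
  wbound rho s (M + M') (fun x => f x - g x).
Proof.
by move=> hf hg x; rewrite mulrDl; apply: le_trans (cln1B _ _) _; apply: lerD.
Qed.

Lemma wbound0 rho s : wbound rho s 0 (fun=> 0).
Proof. by move=> x; rewrite cln10 mul0r. Qed.

Lemma wbound_sum_geo rho s M (t : nat -> Pt -> Cl) K N : 0 <= M ->
  (forall l, wbound rho s (M / 2 ^+ l) (t l)) ->
  wbound rho s (M * 2 / 2 ^+ K) (fun x => \sum_(K <= l < N) t l x).
Proof.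
move=> M0 h x; apply: le_trans (cln1_sum _ _ _) _.
apply: le_trans (ler_wpM2r (expR_ge0 _) (geo_tail K N M0)).
by rewrite mulr_suml; apply: ler_sum => l _; exact: h.
Qed.

Definition pcvg (s : nat -> Cl) (l : Cl) := forall e : R, 0 < e ->
  exists N0, forall N, (N0 <= N)%N -> cln1 (s N - l) <= e.

Lemma pcvg_le (s : nat -> Cl) l (B : R) n0 : pcvg s l ->
  (forall n, (n0 <= n)%N -> cln1 (s n) <= B) -> cln1 l <= B.
Proof.
move=> hs hB; apply/ler_addgt0Pl => e e0.
have [N0 h] := hs _ e0; have := h _ (leq_maxl N0 n0).
have := hB _ (leq_maxr N0 n0); set N := maxn _ _ => h1 h2.
have -> : l = s N - (s N - l) by rewrite opprB addrC subrK.
by apply: le_trans (cln1B _ _) _; lra.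
Qed.

Lemma pcvgB (s t : nat -> Cl) k l : pcvg s k -> pcvg t l -> pcvg (fun n => s n - t n) (k - l).
Proof.
move=> hs ht e e0; have e2 : 0 < e / 2 by rewrite divr_gt0.
have [N1 h1] := hs _ e2; have [N2 h2] := ht _ e2.
exists (maxn N1 N2) => N; rewrite geq_max => /andP[/h1 a1 /h2 a2].
have -> : s N - t N - (k - l) = (s N - k) - (t N - l) by rewrite !opprD !opprK addrACA.
by apply: le_trans (cln1B _ _) _; lra.
Qed.

Lemma pcvg_cst l : pcvg (fun=> l) l.
Proof. by move=> e e0; exists 0%N => N _; rewrite subrr cln10 ltW. Qed.

Lemma cln1_eq0 (p : Cl) : cln1 p <= 0 -> p = 0.
Proof.
move=> h; apply/ffunP => A; rewrite ffunE; apply/eqP; rewrite -normr_eq0 eq_le normr_ge0 andbT.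
exact: le_trans (coef_le_cln1 _ _) h.
Qed.

Lemma pcvg_unique (s : nat -> Cl) k l : pcvg s k -> pcvg s l -> k = l.
Proof.
move=> hk hl; apply/eqP; rewrite -subr_eq0; apply/eqP/cln1_eq0.
apply: (pcvg_le (pcvgB hk hl) (n0 := 0)) => N _.
by rewrite subrr cln10.
Qed.

(** Pointwise convergence is enough to identify limits, and is used below whenever two operators or
    sums are to be shown equal. *)
Lemma cvgA_pcvg rho (fs : nat -> Pt -> Cl) f x : (0 < n)%N -> cvgA rho fs f ->
  pcvg (fun k => fs k x) (f x).
Proof.
move=> n0 [s [s0 [hf [hfs hc]]]] e e0.
pose E := 2 ^+ n * expR (s * growth rho (ptnorm x)).
have E0 : 0 < E by rewrite mulr_gt0 ?expR_gt0 ?exprn_gt0.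
move/cvgrPdist_le: hc => /(_ _ (divr_gt0 e0 E0))[N0 _ h]; exists N0 => N /h /=.
rewrite sub0r normrN => hN.
have hd : inA rho s (fun x => fs N x - f x).
  apply: wbound_inA (wboundB (normA_wb (hfs N)) (normA_wb hf)).
  exact: (slice_sub n0 (hfs N).1 hf.1).
apply: le_trans (normA_wb hd x) _; rewrite mulrAC -/E mulrC -ler_pdivlMr //.
exact: le_trans (ler_norm _) hN.
Qed.

(** [M'] may vary with [k]: only membership in the common space is required of the terms, while [d]
    carries the convergence. *)
Lemma wbound_cvgA rho s (fs : nat -> Pt -> Cl) f (d M' : nat -> R) M : (0 < n)%N -> 0 < s ->
  slice_monogenic f -> wbound rho s M f ->
  (forall k, slice_monogenic (fs k)) -> (forall k, wbound rho s (M' k) (fs k)) ->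
  (forall k, wbound rho s (d k) (fun x => fs k x - f x)) ->
  d @ \oo --> 0 -> cvgA rho fs f.
Proof.
move=> n0 s0 hf wf hfs wfs wd hd; exists s; split => //; split; first exact: wbound_inA wf.
split; first by move=> k; exact: wbound_inA (wfs k).
apply: (@squeeze_cvgr _ _ _ _ (fun=> 0) d); last 2 first.
- exact: cvg_cst.
- exact: hd.
apply: nearW => k; apply/andP; split; last exact: wbound_normA.
apply: normA_ge0; apply: wbound_inA (wd k); exact: slice_sub.
Qed.

End Weighted.

(** * Part (a) *)

Section SeriesLimit.
Variables (R : realType) (n : nat).
Hypothesis n0 : (0 < n)%N.
Local Notation Cl := (Cl R n).
Local Notation Pt := (Pt R n).
Local Open Scope classical_set_scope.

Lemma ptnorm_ge0 (x : Pt) : 0 <= ptnorm x. Proof. exact: sqrtr_ge0. Qed.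

Lemma rlim_le (s : nat -> R) (c l q B : R) k0 : 0 <= q ->
  (forall e : R, 0 < e -> exists N0, forall N, (N0 <= N)%N -> `|s N - l| <= e) ->
  (forall N, (k0 <= N)%N -> `|c - s N| * q <= B) -> `|c - l| * q <= B.
Proof.
move=> q0 hs hB; apply/ler_addgt0Pl => e e0; have q1 : 0 < q + 1 by lra.
have [N0 h] := hs _ (divr_gt0 e0 q1); have := h _ (leq_maxl N0 k0).
have := hB _ (leq_maxr N0 k0); set N := maxn _ _ => h1 h2.
have -> : c - l = (c - s N) + (s N - l) by ring.
apply: le_trans (ler_wpM2r q0 (ler_normD _ _)) _; rewrite mulrDl addrC; apply: lerD => //.
apply: le_trans (ler_wpM2r q0 h2) _; rewrite mulrAC ler_pdivrMr // ler_wpM2l ?(ltW e0) //; lra.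
Qed.

Lemma pow2_cvg (M : R) : (M / 2 ^+ N) @[N --> \oo] --> (0 : R).
Proof.
apply/cvgrPdist_le => e e0; have [N0 h] := pow2_small `|M| e0; exists N0 => // N /h.
by rewrite sub0r normrN normrM normfV [`|2 ^+ N|]ger0_norm // exprn_ge0.
Qed.

(** Completeness, for geometrically dominated series. The limit is built coefficient by coefficient:
    Cauchy's estimate makes each coefficient series geometric, and the limits obey the same
    estimates at every radius, so the sum is again slice monogenic. *)
Lemma series_limit (rho : R -> R) (s M : R) (t : nat -> Pt -> Cl) : 0 <= M ->
  (forall l, slice_monogenic (t l)) -> (forall l, wbound rho s (M / 2 ^+ l) (t l)) ->
  exists2 g, slice_monogenic g &
    forall K, wbound rho s (M * 2 / 2 ^+ K) (fun x => \sum_(l < K) t l x - g x).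
Proof.
move=> M0 ht wt.
have /choice[b hb] : forall l, exists b, sentire b /\ t l = pser b.
  by move=> l; have [b hb e] := slice_series n0 (ht l); exists b.
have bE l : sentire (b l) by exact: (hb l).1.
pose E r := expR (s * growth rho r).
have N1 : 0 < 1 + n%:R :> R by rewrite ltr_wpDr.
have cb l k A r : 0 < r -> `|b l k A| * r ^+ k <= (1 + n%:R) * E r * M / 2 ^+ l.
  move=> r0; have -> : (1 + n%:R) * E r * M / 2 ^+ l = (1 + n%:R) * (M / 2 ^+ l * E r) by ring.
  by apply: pser_coef_le => // x xr; rewrite -(hb l).2 /E -xr; exact: wt.
have E0 r : 0 < (1 + n%:R) * E r by rewrite mulr_gt0 ?expR_gt0.
have diff K N k A r : 0 < r -> (K <= N)%N ->
    `|\sum_(l < K) b l k A - \sum_(l < N) b l k A| * r ^+ k <= (1 + n%:R) * E r * M * 2 / 2 ^+ K.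
  move=> r0 KN; rewrite distrC -!(big_mkord xpredT (fun l => b l k A)).
  rewrite (@big_cat_nat _ _ _ K 0 N) //= [X in `|X - _|]addrC addrK.
  apply: le_trans (ler_wpM2r _ (ler_norm_sum _ _ _)) _; first by rewrite exprn_ge0 ?ltW.
  have EM0 : 0 <= (1 + n%:R) * E r * M by rewrite mulr_ge0 // ltW.
  apply: le_trans (geo_tail K N EM0); rewrite mulr_suml; apply: ler_sum => l _.
  exact: cb.
have /choice[c hc] : forall p : nat * {set 'I_n}, exists c, forall e : R, 0 < e ->
    exists N0, forall N, (N0 <= N)%N -> `|\sum_(l < N) b l p.1 p.2 - c| <= e.
  move=> [k A]; apply: cauchy_real => e e0.
  have [K hK] := pow2_small ((1 + n%:R) * E 1 * M * 2) e0; exists K => N KN.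
  have := diff K N k A 1 ltr01 KN; rewrite expr1n mulr1 distrC => h.
  exact: le_trans h (hK K (leqnn _)).
pose g k : Cl := [ffun A => c (k, A)].
have lim K k A r : 0 < r ->
    `|\sum_(l < K) b l k A - g k A| * r ^+ k <= (1 + n%:R) * E r * M * 2 / 2 ^+ K.
  move=> r0; rewrite ffunE; apply: (@rlim_le (fun N => \sum_(l < N) b l k A) _ _ _ _ K) => //.
  - by rewrite exprn_ge0 ?ltW.
  - exact: hc (k, A).
  - by move=> N KN; exact: diff.
have hg : sentire g.
  apply: sentire_bound => r r0; exists ((1 + n%:R) * E r * M * 2 / 2 ^+ 0) => k A.
  by have := lim 0%N k A r r0; rewrite big_ord0 sub0r normrN.
have tE N x : \sum_(l < N) t l x = pser (fun k => \sum_(l < N) b l k) x.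
  by rewrite pser_sum //; apply: eq_bigr => l _; rewrite (hb l).2.
(* Use the coefficient estimates at radius [2 r] to sum over [k] at norm less than [r]; their factor
   [2^-N] gives convergence. *)
have pw x : pcvg (fun N => \sum_(l < N) t l x) (pser g x).
  move=> e e0; pose r := ptnorm x + 1.
  have r0 : 0 < r by rewrite ltr_wpDl ?ptnorm_ge0.
  have r2 : 0 < r * 2 by rewrite mulr_gt0.
  pose D := (1 + n%:R) * E (r * 2) * M * 2.
  have [N0 hN0] := pow2_small ((1 + n%:R) * (2 ^+ n * (D * 2))) e0.
  exists N0 => N /hN0; apply: le_trans.
  have -> : (1 + n%:R) * (2 ^+ n * (D * 2)) / 2 ^+ N = (1 + n%:R) * (2 ^+ n * (D / 2 ^+ N * 2)) by ring.
  have hs : sentire (fun k => \sum_(l < N) b l k) by exact: sentire_sum.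
  rewrite tE -pserB //; apply: cln1_pser_le; first exact: sentireB.
  move=> k A; rewrite ler_pdivlMr ?exprn_gt0 // -mulrA -exprMn.
  apply: le_trans (lim N k A _ r2); rewrite !ffunE sum_ffunE.
  apply: ler_wpM2l => //; rewrite lerXn2r ?nnegrE ?mulr_ge0 ?ptnorm_ge0 ?(ltW r0) //.
  by rewrite ler_pM2r // lerDl.
exists (pser g); first exact: pser_slice.
move=> K x; apply: (pcvg_le (pcvgB (pcvg_cst (\sum_(l < K) t l x)) (pw x)) (n0 := K)) => N KN.
rewrite -cln1N opprB -!(big_mkord xpredT (fun l => t l x)).
rewrite (@big_cat_nat _ _ _ K 0 N) //= [X in cln1 (X - _)]addrC addrK.
exact: (wbound_sum_geo K N M0 wt).
Qed.

End SeriesLimit.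

(** * The operator defined by a coefficient sequence *)

Section Operators.
Variables (R : realType) (n : nat) (rho1 rho2 : R -> R) (G : nat -> R) (K : R).
Hypothesis n0 : (0 < n)%N.
Hypothesis HG : weight_sequence (growth rho1) G.
Hypothesis K0 : 0 < K.
Hypothesis HK : forall r, 0 <= r -> growth rho1 r <= K * (growth rho2 r + 1).
Local Notation Cl := (Cl R n).
Local Notation Pt := (Pt R n).
Local Notation D l := (iter l (@pdx0 R n)).
Local Open Scope classical_set_scope.
Implicit Types (f g h : Pt -> Cl) (a : nat -> Cl) (s m : R).

Let G0 k : 0 < G k. Proof. by have [h _ _ _] := HG. Qed.

(** Cauchy's estimate on the circle supplied by the last clause of [weight_sequence]. [B] depends on
    the type [s] only, and the bound is linear in [m]. *)
Lemma series_coef_bound s : 0 <= s -> exists2 B, 0 < B & exists2 M, 0 < M &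
  forall a m, sentire a -> wbound rho1 s m (pser a) ->
    forall k A, `|a k A| <= M * m * B ^+ k / G k.
Proof.
move=> s0; have [_ _ _ /(_ s s0)[B B0 [M M0 h]]] := HG.
have N1 : 0 < 1 + n%:R :> R by rewrite ltr_wpDr.
exists B => //; exists ((1 + n%:R) * M); first by rewrite mulr_gt0.
move=> a m ha wa k A; have [r r0 hr] := h k.
have m0 := wbound_ge0 wa.
rewrite -(ler_pM2r (exprn_gt0 k r0)).
apply: le_trans (_ : (1 + n%:R) * (m * expR (s * growth rho1 r)) <= _).
  apply: (@pser_coef_le _ _ a r (m * expR (s * growth rho1 r)) k A n0 ha r0) => x xr.
  by rewrite -xr; exact: wa.
have -> : (1 + n%:R) * M * m * B ^+ k / G k * r ^+ k
   = (1 + n%:R) * (m * (M * B ^+ k * r ^+ k / G k)) by ring.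
by rewrite ler_pM2l // ler_wpM2l.
Qed.

Lemma bin_le2X k l : ('C(k, l) <= 2 ^ k)%N.
Proof.
elim: k l => [|k IH] [|l]; rewrite ?bin0 ?expn_gt0 //.
by rewrite binS expnS mul2n -addnn leq_add.
Qed.

Lemma fact_ratio_le k l : (k + l)`!%:R / k`!%:R <= 2 ^+ (k + l) * l`!%:R :> R.
Proof.
have k0 : 0 < k`!%:R :> R by rewrite ltr0n fact_gt0.
rewrite ler_pdivrMr // -natrX -!natrM ler_nat.
have := bin_fact (leq_addr l k); rewrite addKn => <-.
by rewrite -mulnA [(l`! * _)%N]mulnC leq_mul2r bin_le2X orbT.
Qed.

(** [(k+l)!/k!] costs [2^(k+l) l!], and [G (k+l)] is split into [G k * G l]. With [(4B)^-k] in the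
    bound for [r^k], the powers [B^k] and one [2^k] cancel; the other [2^-k] makes the series
    geometric. *)
Lemma deriv_bound B : 0 < B -> exists2 s, 0 < s & exists2 M, 0 < M &
  forall a m, 0 <= m -> sentire a -> (forall k A, `|a k A| <= m * B ^+ k / G k) ->
    forall l, wbound rho1 s (M * m * l`!%:R * (B *+ 2) ^+ l / G l) (D l (pser a)).
Proof.
move=> B0; have [_ GD hpow _] := HG.
have B4 : 0 < (B *+ 4)^-1 by rewrite invr_gt0 pmulrn_lgt0.
have [s s0 [M M0 h]] := hpow _ B4.
have N1 : 0 < 1 + n%:R :> R by rewrite ltr_wpDr.
exists s => //; exists ((1 + n%:R) * (2 ^+ n * (M * 2))).
  by rewrite !mulr_gt0 ?exprn_gt0.
move=> a m m0 ha bound l x; rewrite iter_pdx0_pser //.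
set E := expR _; have E0 : 0 < E by exact: expR_gt0.
pose Q := M * m * l`!%:R * (B *+ 2) ^+ l / G l * E.
have -> : (1 + n%:R) * (2 ^+ n * (M * 2)) * m * l`!%:R * (B *+ 2) ^+ l / G l * E
   = (1 + n%:R) * (2 ^+ n * (Q * 2)) by rewrite /Q; ring.
apply: cln1_pser_le; first exact: sentire_iter.
move=> k A; rewrite iter_sderE clscaleE normrM.
have rat0 : 0 <= (k + l)`!%:R / k`!%:R :> R by rewrite divr_ge0.
rewrite ger0_norm //.
have xk := h (ptnorm x) k (ptnorm_ge0 x); rewrite -/E in xk.
have xk0 : 0 <= ptnorm x ^+ k by rewrite exprn_ge0 ?ptnorm_ge0.
apply: le_trans (_ : (2 ^+ (k + l) * l`!%:R) * (m * B ^+ (k + l) / (G k * G l))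
    * (M * (B *+ 4)^-1 ^+ k * G k * E) <= _).
  apply: ler_pM => //.
  apply: ler_pM => //; first exact: fact_ratio_le.
  apply: le_trans (bound _ _) _; apply: ler_wpM2l; first by rewrite mulr_ge0 // exprn_ge0 // ltW.
  by rewrite lef_pV2 ?posrE ?mulr_gt0 // GD.
rewrite le_eqVlt; apply/orP; left; apply/eqP.
have Gk := lt0r_neq0 (G0 k); have Gl := lt0r_neq0 (G0 l).
have e4 : (B *+ 4)^-1 ^+ k = (B ^+ k)^-1 / (2 ^+ k * 2 ^+ k).
  rewrite -exprMn -!exprVn -exprMn; congr (_ ^+ _); rewrite -mulr_natr; field.
  exact: lt0r_neq0.
have e2 : (B *+ 2) ^+ l = 2 ^+ l * B ^+ l by rewrite -[B *+ 2]mulr_natl exprMn.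
rewrite /Q e4 e2 !exprD.
have Bk : B ^+ k != 0 by rewrite expf_neq0 // lt0r_neq0.
have tk : 2 ^+ k != 0 :> R by rewrite expf_neq0 // pnatr_eq0.
move: (B ^+ k) (B ^+ l) (2 ^+ k) (2 ^+ l) (G k) (G l) (l`!%:R) Gk Gl Bk tk => p q u v gk gl w *.
by field; do ?[apply/andP; split].
Qed.

(** The choice [(4B)^-1] leaves [4^-k]; for [k >= N] one half of it gives [2^-N], the other sums the
    series. *)
Lemma tail_bound B : 0 < B -> exists2 s, 0 < s & exists2 M, 0 < M &
  forall a m, 0 <= m -> (forall k A, `|a k A| <= m * B ^+ k / G k) ->
    forall N, sentire (fun k => if (k < N)%N then 0 else a k) ->
    wbound rho1 s (M * m / 2 ^+ N) (pser (fun k => if (k < N)%N then 0 else a k)).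
Proof.
move=> B0; have [_ GD hpow _] := HG.
have B4 : 0 < (B *+ 4)^-1 by rewrite invr_gt0 pmulrn_lgt0.
have [s s0 [M M0 h]] := hpow _ B4.
have N1 : 0 < 1 + n%:R :> R by rewrite ltr_wpDr.
exists s => //; exists ((1 + n%:R) * (2 ^+ n * (M * 2))).
  by rewrite !mulr_gt0 ?exprn_gt0.
move=> a m m0 bound N ha x.
set E := expR _; have E0 : 0 < E by exact: expR_gt0.
pose Q := M * m / 2 ^+ N * E.
have -> : (1 + n%:R) * (2 ^+ n * (M * 2)) * m / 2 ^+ N * E
   = (1 + n%:R) * (2 ^+ n * (Q * 2)) by rewrite /Q; ring.
apply: cln1_pser_le => // k A.
have Q0 : 0 <= Q by rewrite !mulr_ge0 ?invr_ge0 ?exprn_ge0 // ltW.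
case: ltnP => kN; first by rewrite ffunE normr0 mul0r divr_ge0 ?exprn_ge0.
have xk := h (ptnorm x) k (ptnorm_ge0 x); rewrite -/E in xk.
have xk0 : 0 <= ptnorm x ^+ k by rewrite exprn_ge0 ?ptnorm_ge0.
apply: le_trans (ler_pM (normr_ge0 _) xk0 (bound k A) xk) _.
have Gk := lt0r_neq0 (G0 k).
have e4 : (B *+ 4)^-1 ^+ k = (B ^+ k)^-1 / (2 ^+ k * 2 ^+ k).
  rewrite -exprMn -!exprVn -exprMn; congr (_ ^+ _); rewrite -mulr_natr; field.
  exact: lt0r_neq0.
have Bk : B ^+ k != 0 by rewrite expf_neq0 // lt0r_neq0.
have tk : 2 ^+ k != 0 :> R by rewrite expf_neq0 // pnatr_eq0.
have -> : m * B ^+ k / G k * (M * (B *+ 4)^-1 ^+ k * G k * E) = M * m * E / 2 ^+ k / 2 ^+ k.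
  rewrite e4; move: (B ^+ k) (2 ^+ k) (G k) Gk Bk tk => p u gk *.
  by field; do ?[apply/andP; split].
rewrite ler_pM2r ?invr_gt0 ?exprn_gt0 // /Q [leRHS]mulrAC.
apply: ler_wpM2l; first by rewrite !mulr_ge0 // ltW.
by rewrite lef_pV2 ?posrE ?exprn_gt0 // ler_eXn2l // ltr1n.
Qed.

Lemma wbound_dominated s m f : 0 <= s -> wbound rho1 s m f -> wbound rho2 (s * K) (m * expR (s * K)) f.
Proof.
move=> s0 h x; have m0 := wbound_ge0 h; apply: le_trans (h x) _.
rewrite -mulrA -expRD ler_wpM2l // ler_expR -mulrA -mulrDr ler_wpM2l //.
by have := HK (ptnorm_ge0 x); rewrite mulrDr mulr1; lra.
Qed.

Lemma wbound_star s s' m m' f g : wbound rho2 s m f -> wbound rho2 s' m' g ->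
  wbound rho2 (s + s') ((1 + 3 * n%:R ^+ 2) * m * m') (star f g).
Proof.
move=> hf hg x.
have -> : (1 + 3 * n%:R ^+ 2) * m * m' * expR ((s + s') * growth rho2 (ptnorm x))
   = (1 + 3 * n%:R ^+ 2) * (m * expR (s * growth rho2 (ptnorm x)))
     * (m' * expR (s' * growth rho2 (ptnorm x))) by rewrite [(s + s') * _]mulrDl expRD; ring.
have hf' := hf (pconj x); have hg' := hg (pconj x); rewrite ptnorm_pconj in hf' hg'.
by apply: cln1_star.
Qed.

Variable ord1 : R.
Variable rhohat : R -> R.
Hypothesis GE : G = Gnum rhohat ord1.
Variable u : nat -> Pt -> Cl.
Hypothesis hu : forall l, slice_monogenic (u l).
Hypothesis hcoef : coef_cond rho2 rhohat ord1 u.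

(** The derivative contributes [l! (2B)^l / G_l] and [u_l] contributes [G_l / l! (4B)^-l], which
    leaves [2^-l]. [B] comes from [s] alone, so [eps] is fixed before [f] and the estimate is
    uniform on bounded sets. *)
Lemma term_bound s : 0 < s -> exists2 s', 0 < s' & exists2 M, 0 < M &
  forall f m, slice_monogenic f -> wbound rho1 s m f ->
    forall l, wbound rho2 s' (M * m / 2 ^+ l) (star (u l) (D l f)).
Proof.
move=> s0; have [B B0 [M1 M10 h1]] := series_coef_bound (ltW s0).
have [s1 s10 [M2 M20 h2]] := deriv_bound B0.
have B4 : 0 < (B *+ 4)^-1 by rewrite invr_gt0 pmulrn_lgt0.
have [s2 [C [s20 [C0 h3]]]] := hcoef B4.
exists (s2 + s1 * K); first by rewrite addr_gt0 // mulr_gt0.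
have N1 : 0 < 1 + 3 * n%:R ^+ 2 :> R by rewrite ltr_wpDr // mulr_ge0 ?exprn_ge0.
exists ((1 + 3 * n%:R ^+ 2) * 2 ^+ n * C * M2 * M1 * expR (s1 * K)).
  by rewrite !mulr_gt0 ?expR_gt0 ?exprn_gt0.
move=> f m hf wf l; have m0 := wbound_ge0 wf.
have [a ha fa] := slice_series n0 hf; rewrite fa in wf *.
have Mm0 : 0 <= M1 * m by rewrite mulr_ge0 // ltW.
have w1 := wbound_dominated (ltW s10) (h2 a (M1 * m) Mm0 ha (h1 a m ha wf) l).
have [uA un] := h3 l.
have w2 : wbound rho2 s2 (2 ^+ n * (C * G l / l`!%:R * (B *+ 4)^-1 ^+ l)) (u l).
  apply: wbound_mono (normA_wb uA); first exact: lexx.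
  by rewrite ler_pM2l ?exprn_gt0 // GE.
apply: wbound_mono (wbound_star w2 w1); first exact: lexx.
rewrite le_eqVlt; apply/orP; left; apply/eqP.
have Gl := lt0r_neq0 (G0 l).
have e4 : (B *+ 4)^-1 ^+ l = (B ^+ l)^-1 / (2 ^+ l * 2 ^+ l).
  rewrite -exprMn -!exprVn -exprMn; congr (_ ^+ _); rewrite -mulr_natr; field.
  exact: lt0r_neq0.
have e2 : (B *+ 2) ^+ l = 2 ^+ l * B ^+ l by rewrite -[B *+ 2]mulr_natl exprMn.
have Bl : B ^+ l != 0 by rewrite expf_neq0 // lt0r_neq0.
have tl : 2 ^+ l != 0 :> R by rewrite expf_neq0 // pnatr_eq0.
have fl : l`!%:R != 0 :> R by rewrite pnatr_eq0 -lt0n fact_gt0.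
rewrite e4 e2.
move: (B ^+ l) (2 ^+ l) (G l) (l`!%:R) (1 + 3 * n%:R ^+ 2) (2 ^+ n) (expR _) Gl Bl tl fl => p q gl w v1 v2 v3 *.
by field; do ?[apply/andP; split].
Qed.

Lemma inAU_wb f : inAU rho1 f -> exists2 s, 0 < s & exists2 m, 0 <= m & wbound rho1 s m f.
Proof.
move=> [s [s0 hf]]; exists s => //; exists (2 ^+ n * normA rho1 s f); last exact: normA_wb.
by rewrite mulr_ge0 ?exprn_ge0 // normA_ge0.
Qed.

Lemma inAU_slice (rho : R -> R) f : inAU rho f -> slice_monogenic f.
Proof. by move=> [s [_ []]]. Qed.

Lemma star_term_slice f l : slice_monogenic f -> slice_monogenic (star (u l) (D l f)).
Proof. by move=> hf; apply: slice_star => //; apply: slice_iter_pdx0. Qed.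

Lemma operator_series_cvg f : inAU rho1 f -> exists g, series_cvgA rho2 u f g.
Proof.
move=> hf; have [s s0 [m m0 wf]] := inAU_wb hf.
have sf := inAU_slice hf.
have [s' s'0 [M M0 h]] := term_bound s0.
have Mm0 : 0 <= M * m by rewrite mulr_ge0 // ltW.
have [g hg wg] := series_limit n0 Mm0 (fun l => star_term_slice l sf) (h f m sf wf).
exists g; apply: (wbound_cvgA (d := fun N => M * m * 2 / 2 ^+ N) (M' := fun=> M * m * 2)
  (M := M * m * 2) n0 s'0 hg).
- move=> x; have := wg 0%N x; rewrite big_ord0 sub0r cln1N expr0 divr1; exact.
- by move=> N; apply: (@slice_sum _ _ n0 N (fun l => star (u l) (D l f))) => l; exact: star_term_slice.
- move=> N x; have := wbound_sum_geo 0 N Mm0 (h f m sf wf) x.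
  by rewrite expr0 divr1 big_mkord.
- exact: wg.
- exact: pow2_cvg.
Qed.

Variable T : (Pt -> Cl) -> Pt -> Cl.
Hypothesis hT : forall f, inAU rho1 f -> series_cvgA rho2 u f (T f).

Lemma operator_pcvg f x : inAU rho1 f ->
  pcvg (fun N => \sum_(l < N) star (u l) (D l f) x) (T f x).
Proof. by move=> /hT/(cvgA_pcvg x n0). Qed.

Lemma operator_slice f : inAU rho1 f -> slice_monogenic (T f).
Proof. by move=> /hT[s [_ [[]]]]. Qed.

Lemma wbound_inAU s m f : 0 < s -> slice_monogenic f -> wbound rho1 s m f -> inAU rho1 f.
Proof. by move=> s0 hf wf; exists s; split => //; exact: wbound_inA wf. Qed.

Lemma operator_bound s : 0 < s -> exists2 s', 0 < s' & exists2 M, 0 < M &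
  forall f m, slice_monogenic f -> wbound rho1 s m f -> wbound rho2 s' (M * m) (T f).
Proof.
move=> s0; have [s' s'0 [M M0 h]] := term_bound s0; exists s' => //.
exists (M * 2); first by rewrite mulr_gt0.
move=> f m hf wf x; have Mm0 : 0 <= M * m by rewrite mulr_ge0 ?(wbound_ge0 wf) // ltW.
apply: (pcvg_le (operator_pcvg x (wbound_inAU s0 hf wf)) (n0 := 0)) => N _.
have := wbound_sum_geo 0 N Mm0 (h f m hf wf) x; rewrite expr0 divr1 big_mkord.
by rewrite [M * 2 * m]mulrAC.
Qed.

Lemma inAU_sub f g : inAU rho1 f -> inAU rho1 g -> inAU rho1 (fun x => f x - g x).
Proof.
move=> hf hg; have [s s0 [m m0 wf]] := inAU_wb hf; have [s' s'0 [m' m0' wg]] := inAU_wb hg.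
have sl := slice_sub n0 (inAU_slice hf) (inAU_slice hg).
apply: (wbound_inAU (s := Num.max s s')) sl (wboundB (wbound_mono _ _ wf) (wbound_mono _ _ wg)); rewrite ?lexx //.
- by rewrite lt_max s0.
- by rewrite le_max lexx.
- by rewrite le_max lexx orbT.
Qed.

(** [T] is known only as a limit, so the identity is proved for partial sums and transferred by
    uniqueness of pointwise limits. *)
Lemma operator_sub f g x : inAU rho1 f -> inAU rho1 g ->
  T (fun x => f x - g x) x = T f x - T g x.
Proof.
move=> hf hg; have := pcvgB (operator_pcvg x hf) (operator_pcvg x hg).
apply: pcvg_unique => e /(operator_pcvg x (inAU_sub hf hg))[N0 h]; exists N0 => N /h.
rewrite -sumrB; congr (cln1 (_ - _) <= _); apply: eq_bigr => l _.
rewrite -starB //; congr (star (u l) _ x); apply/funext => y.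
by rewrite iter_pdx0B //; [exact: inAU_slice hf | exact: inAU_slice hg].
Qed.

Lemma operator_cont : contA rho1 rho2 T.
Proof.
move=> fs f [s [s0 [hf [hfs hc]]]].
have [s' s'0 [M M0 h]] := operator_bound s0.
have A0 g : inA rho1 s g -> inAU rho1 g by move=> hg; exists s.
have wd k : wbound rho1 s (2 ^+ n * normA rho1 s (fun x => fs k x - f x)) (fun x => fs k x - f x).
  apply: normA_wb; apply: wbound_inA (wboundB (normA_wb (hfs k)) (normA_wb hf)).
  exact: slice_sub (hfs k).1 hf.1.
apply: (wbound_cvgA (d := fun k => M * (2 ^+ n * normA rho1 s (fun x => fs k x - f x)))
  (M' := fun k => M * (2 ^+ n * normA rho1 s (fs k))) (M := M * (2 ^+ n * normA rho1 s f))
  n0 s'0 (operator_slice (A0 _ hf))).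
- exact: h hf.1 (normA_wb hf).
- by move=> k; exact: operator_slice (A0 _ (hfs k)).
- by move=> k; exact: h (hfs k).1 (normA_wb (hfs k)).
- move=> k x; rewrite -operator_sub; [|exact: A0|exact: A0].
  by apply: h (wd k) x; exact: slice_sub (hfs k).1 hf.1.
- have -> : (0 : R) = M * (2 ^+ n * 0) by rewrite !mulr0.
  by apply: cvgM; [exact: cvg_cst | apply: cvgM; [exact: cvg_cst | exact: hc]].
Qed.

End Operators.

(** * Part (b) *)

Section BinomialInversion.
Variable R : realType.
Local Notation C := (complex R).

(* The coefficients of the inverse of the triangular system
   [T(x^m) = \sum_(l <= m) m! / (m - l)! (u_l * x^(m - l))]. *)
Definition ucoef (l k : nat) : R := (-1) ^+ (l - k) / ((l - k)`!%:R * k`!%:R).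

Lemma fact_neq0 k : k`!%:R != 0 :> R.
Proof. by rewrite pnatr_eq0 -lt0n fact_gt0. Qed.

(** With [l = k + i] and [p = m - k], the sum is a binomial coefficient times [(1 - 1)^p]. *)
Lemma alternating_sum m k : (k <= m)%N ->
  \sum_(l < m.+1 | (k <= l)%N) (m`!%:R / (m - l)`!%:R * ucoef l k) = (k == m)%:R.
Proof.
move=> km; rewrite -(subnKC km) -addnS; set p := (m - k)%N.
rewrite big_mkcond big_split_ord /= big1 ?add0r; last first.
  by move=> i _; rewrite leqNgt ltn_ord.
have -> : (k == k + p)%N%:R = (1 - 1) ^+ p / p`!%:R * ((k + p)`!%:R / k`!%:R) :> R.
  rewrite subrr expr0n -{1}[k]addn0 eqn_add2l [(0 == p)%N]eq_sym.
  by case: eqP => [->|_]; rewrite ?mul0r // addn0 fact0 divr1 mul1r divff // fact_neq0.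
rewrite exprDn !mulr_suml; apply: eq_bigr => i _.
have ip : (i <= p)%N by rewrite -ltnS ltn_ord.
rewrite leq_addr subnDl /ucoef addKn expr1n mul1r -[_ *+ 'C(p, i)]mulr_natr -(bin_fact ip) !natrM.
have := fact_neq0 i; have := fact_neq0 (p - i); have := fact_neq0 k.
have : 'C(p, i)%:R != 0 :> R by rewrite pnatr_eq0 -lt0n bin_gt0.
move: 'C(p, i)%:R i`!%:R (p - i)`!%:R k`!%:R (k + p)`!%:R => c u v w t *.
by field; do ?[apply/andP; split].
Qed.

Lemma triangular_sum (V : nmodType) m (F : nat -> nat -> V) :
  \sum_(l < m) \sum_(k < l.+1) F l k = \sum_(k < m) \sum_(l < m | (k <= l)%N) F l k.
Proof.
under eq_bigr => l _ do rewrite (big_ord_widen_cond m predT (F l)) //.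
by rewrite (exchange_big_dep predT) //=; apply: eq_bigr => k _; apply: eq_bigl => l; rewrite ltnS.
Qed.

(** [(1 + 1)^l] divided by [l!]: the total mass of the coefficients [ucoef l k]. *)
Lemma binomial_fact_sum l :
  \sum_(k < l.+1) 1 / ((l - k)`!%:R * k`!%:R) = 2 ^+ l / l`!%:R :> R.
Proof.
rewrite -[2]/(1 + 1) exprDn mulr_suml; apply: eq_bigr => k _.
have kl : (k <= l)%N by rewrite -ltnS ltn_ord.
rewrite !expr1n mul1r -[_ *+ 'C(l, k)]mulr_natr -(bin_fact kl) !natrM.
have := fact_neq0 k; have := fact_neq0 (l - k).
have : 'C(l, k)%:R != 0 :> R by rewrite pnatr_eq0 -lt0n bin_gt0.
move: 'C(l, k)%:R k`!%:R (l - k)`!%:R => c u v *.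
by field; do ?[apply/andP; split].
Qed.

End BinomialInversion.

(** * Monomials *)

Section Monomials.
Variables (R : realType) (n : nat).
Hypothesis n0 : (0 < n)%N.
Local Notation C := (complex R).
Local Notation Cl := (Cl R n).
Local Notation Pt := (Pt R n).
Local Notation slice := ({set 'I_n} -> C -> C).
Implicit Types (c : Cl) (x : Pt) (A B : {set 'I_n}) (F : slice).

Definition mono (k : nat) c : Pt -> Cl := pser (fun i => if i == k then c else 0).
Definition xpow (k : nat) : Pt -> Cl := mono k (clone R n).

Lemma pcoef_mono k c A : pcoef (fun i => if i == k then c else 0) A = fun i => (c A)%:C%C * monoc R k i.
Proof.
apply/funext => i; rewrite /pcoef /monoc; case: eqP => _; rewrite ?mulr1 ?mulr0 //.
by rewrite ffunE.
Qed.

Lemma sentire_mono k c : sentire (fun i => if i == k then c else 0).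
Proof. by move=> A; rewrite pcoef_mono; apply: entireZ; apply: entire_monoc. Qed.

Lemma cpser_mono k c : cpser (fun i => if i == k then c else 0) = fun A z => (c A)%:C%C * z ^+ k.
Proof.
apply/funext => A; apply/funext => z; rewrite /cpser pcoef_mono cserZ.
  by rewrite (cser_eq (monoc_ccvg k z)).
exact: entire_monoc.
Qed.

Lemma monoE k c : mono k c = ofs (fun A z => (c A)%:C%C * z ^+ k).
Proof. by rewrite /mono /pser cpser_mono. Qed.

Lemma sholo_mono k c : sholo (fun A z => (c A)%:C%C * z ^+ k).
Proof. by rewrite -cpser_mono; apply: sholo_cpser; apply: sentire_mono. Qed.

Lemma slice_mono k c : slice_monogenic (mono k c).
Proof. exact/pser_slice/sentire_mono. Qed.

Lemma mono_rmul k c x : mono k c x = clmul (xpow k x) c.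
Proof.
have r (d : Cl) z : rpart (fun A z => (d A)%:C%C * z ^+ k) z = clscale (complex.Re (z ^+ k)) d.
  by apply/ffunP => A; rewrite !ffunE ReZ mulrC.
have i (d : Cl) z : ipart (fun A z => (d A)%:C%C * z ^+ k) z = clscale (complex.Im (z ^+ k)) d.
  by apply/ffunP => A; rewrite !ffunE ImZ mulrC.
rewrite /xpow !monoE /ofs !r !i clmulDl -clmulA !clmulZl !clmulZr.
by rewrite !clmul1l.
Qed.

Lemma iter_mono (l k : nat) c : (l <= k)%N ->
  iter l (@pdx0 R n) (mono k c) = mono (k - l)%N (clscale (k`!%:R / (k - l)%N`!%:R : R) c).
Proof.
move=> lk; rewrite /mono iter_pdx0_pser; last exact: sentire_mono.
congr pser; apply/funext => i; rewrite iter_sderE.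
have -> : (i + l == k)%N = (i == k - l)%N by rewrite -[in LHS](subnK lk) eqn_add2r.
by case: eqP => [->|_]; [rewrite subnK | apply/ffunP => A; rewrite !ffunE mulr0].
Qed.

Lemma iter_mono_gt (l k : nat) c : (k < l)%N -> iter l (@pdx0 R n) (mono k c) = fun=> 0.
Proof.
move=> kl; rewrite /mono iter_pdx0_pser; last exact: sentire_mono.
apply/funext => x; rewrite -[RHS](pser0 x); congr (pser _ x); apply/funext => i.
rewrite iter_sderE; case: eqP => [e|_]; last by apply/ffunP => A; rewrite !ffunE mulr0.
by move: kl; rewrite -e ltnNge leq_addl.
Qed.

Lemma sholo_xpow (m : nat) F : sholo F -> sholo (fun A z => z ^+ m * F A z).
Proof.
move=> [hF sF]; split=> [A|A z]; first by apply: holoM => //; exact: holoX.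
by rewrite sF conjcM; congr (_ * _); rewrite rmorphXn.
Qed.

Lemma clscale_suml (I : Type) (r : seq I) (P : pred I) (t : I -> R) c :
  clscale (\sum_(i <- r | P i) t i) c = \sum_(i <- r | P i) clscale (t i) c.
Proof.
by apply/ffunP => A; rewrite ffunE sum_ffunE mulr_suml; apply: eq_bigr => i _; rewrite ffunE.
Qed.

Lemma cln1_xpow k x : cln1 (xpow k x) <= (1 + n%:R) * (2 ^+ n * ptnorm x ^+ k).
Proof.
rewrite /xpow monoE; apply: cln1_ofs => A.
rewrite cmodM cmodX cmod_zof cmodR ffunE ler_piMl ?exprn_ge0 ?ptnorm_ge0 //.
by case: (_ == _); rewrite ?normr1 ?normr0.
Qed.

(** The stem function of [x^m] has only the scalar component [z^m], so [x^m] is central for the star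
    product; the right-hand version gives the same result. *)
Lemma star_xpowl m F : sholo F -> star (xpow m) (ofs F) = ofs (fun A z => z ^+ m * F A z).
Proof.
move=> hF; rewrite /xpow monoE star_ofs //; last exact: sholo_mono.
apply/funext => x; apply: ofs_ext => B; rewrite /smul (bigD1 finset.set0) //= big1 ?addr0.
  by rewrite symdiffC symdiff0 clsign0 ffunE eqxx !mul1r.
by move=> A /negbTE A0; rewrite ffunE A0 mul0r mul0r mulr0.
Qed.

Lemma star_xpowr m F : sholo F -> star (ofs F) (xpow m) = ofs (fun A z => z ^+ m * F A z).
Proof.
move=> hF; rewrite /xpow monoE star_ofs //; last exact: sholo_mono.
apply/funext => x; apply: ofs_ext => B; rewrite /smul (bigD1 B) //= big1 ?addr0.
  rewrite symdiffv ffunE eqxx clsignE big1 ?mul1r; last by move=> i _; rewrite big_set0.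
  by rewrite mulrC.
move=> A AB; rewrite ffunE; case: eqP => [e|_]; last by rewrite mul0r mulr0 mulr0.
by case/eqP: AB; rewrite -[A]symdiff0 -e symdiffK.
Qed.

Lemma star0 (f : Pt -> Cl) x : star f (fun=> 0) x = 0.
Proof.
have e : star f (fun=> 0) x = star f (fun=> 0) x - star f (fun=> 0) x.
  by rewrite -starB; congr (star f _ x); apply/funext => y; rewrite subrr.
by rewrite e subrr.
Qed.

Lemma wbound_clscale (rho : R -> R) s m t (f : Pt -> Cl) : wbound rho s m f ->
  wbound rho s (`|t| * m) (fun x => clscale t (f x)).
Proof. by move=> h x; rewrite cln1Z -mulrA ler_wpM2l. Qed.

Lemma clmul_clscale_clone t (p : Cl) : clmul p (clscale t (clone R n)) = clscale t p.
Proof. by rewrite clmulZr clmul1r. Qed.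

Lemma wbound_xpow (rho : R -> R) (G : nat -> R) (e : R) : weight_sequence (growth rho) G -> 0 < e ->
  exists2 s, 0 < s & exists2 M, 0 < M & forall k, wbound rho s (M * e ^+ k * G k) (xpow k).
Proof.
move=> [_ _ h _] /h[s s0 [M M0 {}h]]; exists s => //.
have N1 : 0 < 1 + n%:R :> R by rewrite ltr_wpDr.
exists ((1 + n%:R) * (2 ^+ n * M)); first by rewrite !mulr_gt0 ?exprn_gt0.
move=> k x; apply: le_trans (cln1_xpow k x) _.
have -> : (1 + n%:R) * (2 ^+ n * M) * e ^+ k * G k * expR (s * growth rho (ptnorm x))
  = (1 + n%:R) * (2 ^+ n * (M * e ^+ k * G k * expR (s * growth rho (ptnorm x)))) by ring.
by rewrite ler_pM2l // ler_pM2l ?exprn_gt0 // h // ptnorm_ge0.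
Qed.

End Monomials.

(** * Recovering the coefficients from the operator *)

Section Converse.
Variables (R : realType) (n : nat) (rho1 rho2 : R -> R) (G : nat -> R) (K : R).
Hypothesis n0 : (0 < n)%N.
Hypothesis HG : weight_sequence (growth rho1) G.
Hypothesis K0 : 0 < K.
Hypothesis HK : forall r, 0 <= r -> growth rho1 r <= K * (growth rho2 r + 1).
Local Notation C := (complex R).
Local Notation Cl := (Cl R n).
Local Notation Pt := (Pt R n).
Local Notation slice := ({set 'I_n} -> C -> C).
Local Open Scope classical_set_scope.
Implicit Types (f g h : Pt -> Cl) (a : nat -> Cl) (s m e : R).

Let G0 k : 0 < G k. Proof. by have [h _ _ _] := HG. Qed.

Lemma mono_inAU k (c : Cl) : inAU rho1 (mono k c).
Proof.
have [s s0 [M M0 h]] := wbound_xpow n HG ltr01.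
have w : wbound rho1 s (M * 1 ^+ k * G k * cln1 c) (mono k c).
  move=> x; rewrite mono_rmul mulrAC; apply: le_trans (cln1M _ _) _.
  by rewrite ler_wpM2r ?cln1_ge0 // h.
exact: (wbound_inAU s0 (slice_mono k c) w).
Qed.

Lemma inAU_sum N (f : nat -> Pt -> Cl) : (forall k, inAU rho1 (f k)) ->
  inAU rho1 (fun x => \sum_(k < N) f k x).
Proof.
move=> hf; have h0 : inAU rho1 (fun=> 0 : Cl).
  by apply: (wbound_inAU ltr01 (slice0 R n)); exact: wbound0.
elim: N => [|N IH].
  by have -> : (fun x => \sum_(k < 0) f k x) = (fun=> 0) by apply/funext => x; rewrite big_ord0.
have -> : (fun x => \sum_(k < N.+1) f k x) = (fun x => \sum_(k < N) f k x - (0 - f N x)).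
  by apply/funext => x; rewrite big_ord_recr sub0r opprK.
apply: (inAU_sub n0 IH); exact: (inAU_sub n0 h0 (hf N)).
Qed.

(** Only subtractivity is assumed, so that the lemma covers both the given right linear operator and
    the sum of a series. *)
Lemma subtractive_sum (T : (Pt -> Cl) -> Pt -> Cl) N (f : nat -> Pt -> Cl) x :
  (forall f g x, inAU rho1 f -> inAU rho1 g -> T (fun x => f x - g x) x = T f x - T g x) ->
  (forall k, inAU rho1 (f k)) ->
  T (fun x => \sum_(k < N) f k x) x = \sum_(k < N) T (f k) x.
Proof.
move=> hT hf; have h0 : inAU rho1 (fun=> 0 : Cl).
  by apply: (wbound_inAU ltr01 (slice0 R n)); exact: wbound0.
have T0 : T (fun=> 0) x = 0.
  have e : T (fun=> 0) x = T (fun=> 0) x - T (fun=> 0) x.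
    by rewrite -hT //; congr (T _ x); apply/funext => y; rewrite subrr.
  by rewrite e subrr.
elim: N => [|N IH].
  rewrite big_ord0 -[RHS]T0; congr (T _ x); apply/funext => y; exact: big_ord0.
have -> : (fun x => \sum_(k < N.+1) f k x) = (fun x => \sum_(k < N) f k x - (0 - f N x)).
  by apply/funext => y; rewrite big_ord_recr sub0r opprK.
rewrite hT //; last exact: (inAU_sub n0 h0 (hf N)); last exact: inAU_sum.
by rewrite hT // T0 sub0r opprK IH big_ord_recr.
Qed.

Lemma taylor_tail a N x : sentire a ->
  pser a x - \sum_(k < N) mono k (a k) x = pser (fun k => if (k < N)%N then 0 else a k) x /\
  sentire (fun k => if (k < N)%N then 0 else a k).
Proof.
move=> ha; pose t k i : Cl := if i == k then a k else 0.
have ht k : sentire (t k) by exact: sentire_mono.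
have -> : (fun k => if (k < N)%N then 0 else a k) = (fun i => a i - \sum_(k < N) t k i).
  apply/funext => i; case: ltnP => iN.
    rewrite (bigD1 (Ordinal iN)) //= /t eqxx big1 ?addr0 ?subrr // => j.
    by rewrite -val_eqE eq_sym => /negbTE ->.
  rewrite big1 ?subr0 // => j _; rewrite /t; case: eqP => // e.
  by move: (ltn_ord j); rewrite -e ltnNge iN.
split; last by apply: sentireB => //; exact: sentire_sum.
by rewrite pserB ?pser_sum //; exact: sentire_sum.
Qed.

(** Density of polynomials. The tails may need a larger type than [f], hence the maximum of the two
    types. *)
Lemma taylor_cvgA a : sentire a -> inAU rho1 (pser a) ->
  cvgA rho1 (fun N x => \sum_(k < N) mono k (a k) x) (pser a).
Proof.
move=> ha /inAU_wb[s s0 [m m0 wf]].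
have [B B0 [M M0 h]] := series_coef_bound n0 HG (ltW s0).
have [s' s'0 [M' M'0 h']] := tail_bound n HG B0.
have Mm0 : 0 <= M * m by rewrite mulr_ge0 // ltW.
have tl N := h' a (M * m) Mm0 (h a m ha wf) N (taylor_tail N (pt0 R n) ha).2.
have wd N : wbound rho1 (Num.max s s') (M' * (M * m) / 2 ^+ N)
    (fun x => \sum_(k < N) mono k (a k) x - pser a x).
  move=> x; rewrite -cln1N opprB (taylor_tail N x ha).1.
  by apply: (wbound_mono _ _ (tl N) x); rewrite ?lexx // le_max lexx orbT.
have wf' : wbound rho1 (Num.max s s') m (pser a).
  by apply: wbound_mono wf; rewrite ?lexx // le_max lexx.
have sp N : slice_monogenic (fun x => \sum_(k < N) mono k (a k) x).
  by apply: (@slice_sum _ _ n0 N (fun k => mono k (a k))) => k; exact: slice_mono.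
apply: (wbound_cvgA (d := fun N => M' * (M * m) / 2 ^+ N)
  (M' := fun N => m + M' * (M * m) / 2 ^+ N) (M := m) n0 (s := Num.max s s')) => //.
- by rewrite lt_max s0.
- exact: pser_slice.
- move=> N x; have wd' : wbound rho1 (Num.max s s') (M' * (M * m) / 2 ^+ N)
      (fun x => pser a x - \sum_(k < N) mono k (a k) x).
    by move=> y; rewrite -cln1N opprB; exact: wd.
  by have := wboundB wf' wd' x; rewrite opprB addrC subrK.
- exact: pow2_cvg.
Qed.

Lemma cvg0_bounded (b : nat -> R) : b @ \oo --> 0 -> exists2 B, 0 < B & forall k, b k <= B.
Proof.
move=> /cvgrPdist_le /(_ 1 ltr01)[N _ h].
have S0 : 0 <= \sum_(i < N) `|b i| by exact: sumr_ge0.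
exists (\sum_(i < N) `|b i| + 1); first by rewrite ltr_wpDl.
move=> k; apply: le_trans (ler_norm _) _; case: (ltnP k N) => kN.
  rewrite (bigD1 (Ordinal kN)) //= -addrA lerDl addr_ge0 //; exact: sumr_ge0.
have := h k kN; rewrite /= sub0r normrN => h'.
by apply: le_trans h' _; rewrite lerDr.
Qed.

Variable T : (Pt -> Cl) -> Pt -> Cl.
Hypothesis hlin : right_linear rho1 T.
Hypothesis hcont : contA rho1 rho2 T.

Lemma right_linear_rmul f c : inAU rho1 f -> T (fun x => clmul (f x) c) = (fun x => clmul (T f x) c).
Proof.
move=> hf; have E h : (fun x => clmul (h x) c + clmul (h x) 0) = (fun x => clmul (h x) c).
  by apply/funext => x; rewrite clmul0r addr0.
by have := hlin c 0 hf hf; rewrite !E.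
Qed.

Lemma right_linear_sub f g x : inAU rho1 f -> inAU rho1 g ->
  T (fun x => f x - g x) x = T f x - T g x.
Proof.
move=> hf hg; have E h h' : (fun x => clmul (h x) (clone R n) + clmul (h' x) (- clone R n))
    = (fun x => h x - h' x).
  by apply/funext => y; rewrite clmulNr !clmul1r.
by have := hlin (clone R n) (- clone R n) hf hg; rewrite !E => ->.
Qed.

(** The functions [x^k / (e^k G_k)] are bounded by [M / 2^k] in one weighted norm, by [wbound_xpow]
    at [e / 2], so they form a null sequence. Their images converge, hence are bounded, in one
    weighted norm; undoing the scaling gives the claim for all [k] at once. *)
Lemma image_bound e : 0 < e -> exists2 s, 0 < s & exists2 M, 0 < M &
  forall k, wbound rho2 s (M * e ^+ k * G k) (T (xpow k)).
Proof.
move=> e0; have e2 : 0 < e / 2 by rewrite divr_gt0.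
have [s s0 [M M0 h]] := wbound_xpow n HG e2.
pose t (k : nat) := (e ^+ k * G k)^-1; have t0 k : 0 < t k by rewrite invr_gt0 mulr_gt0 ?exprn_gt0.
pose f k : Pt -> Cl := fun x => clscale (t k) (xpow k x).
have wf k : wbound rho1 s (M / 2 ^+ k) (f k).
  have := wbound_clscale (t k) (h k); congr (wbound rho1 s _ _); rewrite gtr0_norm // /t.
  have ek : e ^+ k != 0 by rewrite expf_neq0 // lt0r_neq0.
  have tk : 2 ^+ k != 0 :> R by rewrite expf_neq0 // pnatr_eq0.
  have Gk := lt0r_neq0 (G0 k); rewrite expr_div_n.
  by move: (e ^+ k) (2 ^+ k) (G k) ek tk Gk => p q r *; field; do ?[apply/andP; split].
have fr k : f k = (fun x => clmul (xpow k x) (clscale (t k) (clone R n))).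
  by apply/funext => x; rewrite clmul_clscale_clone.
have sf k : slice_monogenic (f k).
  have -> : f k = mono k (clscale (t k) (clone R n)); last exact: slice_mono.
  by apply/funext => x; rewrite fr mono_rmul.
have cf : cvgA rho1 f (fun=> 0).
  apply: (wbound_cvgA (d := fun k => M / 2 ^+ k) (M' := fun k => M / 2 ^+ k) (M := 0) n0 s0) => //.
  - exact: slice0.
  - exact: wbound0.
  - by move=> k x; rewrite subr0; exact: wf.
  - exact: pow2_cvg.
have T0 x : T (fun=> 0) x = 0.
  have h0 : inAU rho1 (fun=> 0 : Cl) by apply: (wbound_inAU ltr01 (slice0 R n)); exact: wbound0.
  have E : T (fun=> 0) x = T (fun=> 0) x - T (fun=> 0) x.
    by rewrite -right_linear_sub //; congr (T _ x); apply/funext => y; rewrite subrr.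
  by rewrite E subrr.
have [s2 [s20 [h0 [hf /cvg0_bounded[B B0 hB]]]]] := hcont cf.
exists s2 => //; exists (2 ^+ n * B); first by rewrite mulr_gt0 ?exprn_gt0.
move=> k; have tk : t k != 0 by rewrite lt0r_neq0.
have TE x : T (xpow k) x = clscale (t k)^-1 (T (f k) x).
  rewrite fr right_linear_rmul; last exact: mono_inAU.
  by rewrite clmul_clscale_clone clscaleA mulVf // clscale1.
have w : wbound rho2 s2 (2 ^+ n * B) (T (f k)).
  apply: wbound_mono (normA_wb (hf k)) => //; rewrite ler_pM2l ?exprn_gt0 //.
  have -> : T (f k) = (fun x => T (f k) x - T (fun=> 0) x); last exact: hB.
  by apply/funext => x; rewrite T0 subr0.
move=> x; rewrite TE; apply: le_trans (wbound_clscale (t k)^-1 w x) _.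
have tE : (t k)^-1 = e ^+ k * G k by exact: invrK.
rewrite tE gtr0_norm ?mulr_gt0 ?exprn_gt0 // le_eqVlt; apply/orP; left; apply/eqP; ring.
Qed.

Variable tau : nat -> slice.
Hypothesis htau : forall k, sholo (tau k).
Hypothesis Ttau : forall k, T (xpow k) = ofs (tau k).

(** Written for stem functions, where the star product with [x^(l-k)] is multiplication by
    [z^(l-k)]. *)
Definition symbol_slice l : slice := fun A z =>
  \sum_(k < l.+1) (ucoef R l k)%:C%C * (z ^+ (l - k) * tau k A z).
Definition symbol l : Pt -> Cl := ofs (symbol_slice l).

Lemma sholo_symbol l : sholo (symbol_slice l).
Proof.
have h k := sholo_xpow (l - k)%N (htau k).
split=> [A|A z]; first by apply: holo_sum => k _; apply: holoZ; exact: (h k).1.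
rewrite /symbol_slice conj_sum; apply: eq_bigr => k _.
by rewrite (h k).2 [RHS]conjcM conjc_real.
Qed.

Lemma symbolE l x : symbol l x =
  \sum_(k < l.+1) clscale (ucoef R l k) (star (xpow (l - k)%N) (T (xpow k)) x).
Proof.
rewrite /symbol /symbol_slice ofs_sum; apply: eq_bigr => k _.
by rewrite ofsZ Ttau star_xpowl.
Qed.

Lemma normr_ucoef l k : `|ucoef R l k| = 1 / ((l - k)`!%:R * k`!%:R).
Proof. by rewrite normrM normrX normrN1 expr1n ger0_norm // invr_ge0 mulr_ge0. Qed.

(** Take [e = eps / 2] for both factors: [G (l-k) * G k <= G l] makes the products uniform in [k],
    and the coefficients sum to [2^l / l!], which turns [e^l] into [eps^l]. *)
Lemma symbol_bound eps : 0 < eps -> exists2 s, 0 < s & exists2 M, 0 < M &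
  forall l, wbound rho2 s (M * G l / l`!%:R * eps ^+ l) (symbol l).
Proof.
move=> eps0; have e0 : 0 < eps / 2 by rewrite divr_gt0.
set e := eps / 2 in e0.
have [s1 s10 [M1 M10 h1]] := wbound_xpow n HG e0.
have [s2 s20 [M2 M20 h2]] := image_bound e0.
have N1 : 0 < 1 + 3 * n%:R ^+ 2 :> R by rewrite ltr_wpDr // mulr_ge0 ?exprn_ge0.
exists (s1 * K + s2); first by rewrite addr_gt0 // mulr_gt0.
pose Q := (1 + 3 * n%:R ^+ 2) * M1 * expR (s1 * K) * M2.
have Q0 : 0 < Q by rewrite !mulr_gt0 ?expR_gt0.
exists Q => // l x; rewrite symbolE; apply: le_trans (cln1_sum _ _ _) _.
set E := expR _; have E0 : 0 < E by exact: expR_gt0.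
have -> : Q * G l / l`!%:R * eps ^+ l * E = (2 ^+ l / l`!%:R) * (Q * (e ^+ l * G l) * E).
  have -> : eps ^+ l = 2 ^+ l * e ^+ l by rewrite -exprMn /e mulrC divfK // pnatr_eq0.
  by ring.
rewrite -binomial_fact_sum mulr_suml; apply: ler_sum => k _.
rewrite cln1Z normr_ucoef; apply: ler_wpM2l; first by rewrite divr_ge0 ?mulr_ge0.
have kl : (k <= l)%N by rewrite -ltnS ltn_ord.
apply: le_trans (wbound_star (wbound_dominated HK (ltW s10) (h1 (l - k)%N)) (h2 k) x) _.
rewrite -/E ler_pM2r //.
have -> : (1 + 3 * n%:R ^+ 2) * (M1 * e ^+ (l - k) * G (l - k) * expR (s1 * K)) * (M2 * e ^+ k * G k)
   = Q * ((e ^+ (l - k) * e ^+ k) * (G (l - k) * G k)) by rewrite /Q; ring.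
rewrite -exprD subnK // ler_pM2l // ler_pM2l ?exprn_gt0 //.
by have [_ GD _ _] := HG; have := GD (l - k)%N k; rewrite subnK.
Qed.

(** Derivatives of [x^m] of order above [m] vanish, so the series is this finite sum. Exchanging the
    sums over [l] and [k] leaves an alternating sum that selects [k = m]. *)
Lemma symbol_mono (m : nat) c x :
  \sum_(l < m.+1) star (symbol l) (iter l (@pdx0 R n) (mono m c)) x = T (mono m c) x.
Proof.
pose V k := clmul (ofs (fun A z => z ^+ (m - k) * tau k A z) x) c.
pose q l k := m`!%:R / (m - l)%N`!%:R * ucoef R l k.
have -> : T (mono m c) x = clmul (ofs (tau m) x) c.
  have -> : mono m c = (fun x => clmul (xpow m x) c) by apply/funext => y; exact: mono_rmul.
  by rewrite right_linear_rmul ?Ttau //; exact: mono_inAU.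
transitivity (\sum_(l < m.+1) \sum_(k < l.+1) clscale (q l k) (V k)).
  apply: eq_bigr => l _; have lm : (l <= m)%N by rewrite -ltnS ltn_ord.
  rewrite iter_mono //.
  have -> : mono (m - l)%N (clscale (m`!%:R / (m - l)%N`!%:R) c) = (fun x => clmul (xpow (m - l)%N x)
      (clscale (m`!%:R / (m - l)%N`!%:R) c)) by apply/funext => y; exact: mono_rmul.
  rewrite star_rmul star_xpowr; last exact: sholo_symbol.
  have -> : ofs (fun A z => z ^+ (m - l) * symbol_slice l A z) x
      = \sum_(k < l.+1) clscale (ucoef R l k) (ofs (fun A z => z ^+ (m - k) * tau k A z) x).
    under eq_bigr do rewrite -ofsZ.
    rewrite -ofs_sum; apply: ofs_ext => A; rewrite mulr_sumr; apply: eq_bigr => k _.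
    have kl : (k <= l)%N by rewrite -ltnS ltn_ord.
    (* The powers [z^(m-l)] and [z^(l-k)] combine to [z^(m-k)], independent of [l]; hence the sum
       over [l] concerns scalars only. *)
    have -> : (m - k = (m - l) + (l - k))%N by rewrite addnBA // subnK.
    by rewrite exprD; ring.
  rewrite clmul_suml; apply: eq_bigr => k _.
  by rewrite clmulZr clmulZl clscaleA.
rewrite (triangular_sum m.+1 (fun l k => clscale (q l k) (V k))).
transitivity (\sum_(k < m.+1) clscale (k == m :> nat)%:R (V k)).
  apply: eq_bigr => k _; rewrite -(clscale_suml _ _ (fun l : 'I_m.+1 => q l k)).
  have km : (k <= m)%N by rewrite -ltnS ltn_ord.
  by rewrite /q (alternating_sum R km).
rewrite (bigD1 ord_max) //= big1 ?addr0 => [|k]; last first.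
  by rewrite -val_eqE /= => /negbTE ->; rewrite clscale0.
rewrite eqxx clscale1 /V subnn; congr (clmul _ c); apply: ofs_ext => A.
by rewrite expr0 mul1r.
Qed.

(** [S] stands for the sum of the series, not yet known to be [T]. Both respect finite sums and are
    continuous, so agreement on monomials extends along Taylor polynomials. *)
Lemma symbol_series (S : (Pt -> Cl) -> Pt -> Cl) f :
  (forall l, slice_monogenic (symbol l)) ->
  (forall f, inAU rho1 f -> series_cvgA rho2 symbol f (S f)) ->
  contA rho1 rho2 S ->
  inAU rho1 f -> T f = S f.
Proof.
move=> hs hS cS hf.
have Sm (m : nat) c x : S (mono m c) x = T (mono m c) x.
  apply: pcvg_unique (operator_pcvg n0 hS x (mono_inAU m c)) _ => e e0.
  exists m.+1 => N mN; rewrite -symbol_mono.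
  rewrite -!(big_mkord xpredT (fun l => star (symbol l) (iter l (@pdx0 R n) (mono m c)) x)).
  rewrite (@big_cat_nat _ _ _ m.+1 0 N) //= [X in cln1 (X - _)]addrC addrK.
  rewrite big1_seq ?cln10 ?ltW //.
  by move=> l /andP[_]; rewrite mem_index_iota => /andP[ml _]; rewrite iter_mono_gt ?star0.
have [a ha fa] := slice_series n0 (inAU_slice hf); rewrite fa in hf *.
have tc := taylor_cvgA ha hf.
apply/funext => x; apply: pcvg_unique (cvgA_pcvg x n0 (hcont tc)) _ => e e0.
have [N0 h] := cvgA_pcvg x n0 (cS _ _ tc) e0; exists N0 => N /h.
have hm k : inAU rho1 (mono k (a k)) by exact: mono_inAU.
rewrite (subtractive_sum N x right_linear_sub hm) (subtractive_sum N x _ hm).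
  by under eq_bigr do rewrite Sm.
by move=> g g' y; exact: (operator_sub n0 hS).
Qed.

Lemma exists_symbol rhohat ord1 : G = Gnum rhohat ord1 ->
  (forall l, slice_monogenic (symbol l)) /\ coef_cond rho2 rhohat ord1 symbol /\
  (forall f, inAU rho1 f -> series_cvgA rho2 symbol f (T f)).
Proof.
move=> GE; have hs l : slice_monogenic (symbol l) by exact/ofs_slice/sholo_symbol.
have hc : coef_cond rho2 rhohat ord1 symbol.
  move=> eps eps0; have [s s0 [M M0 h]] := symbol_bound eps0.
  exists s, M; do 2![split => //]; move=> l; rewrite -GE.
  by split; [exact: wbound_inA (h l) | exact: wbound_normA (h l)].
split => //; split => // f hf.
have /choice[S hS] : forall f, exists g, inAU rho1 f -> series_cvgA rho2 symbol f g.
  move=> g; case: (pselect (inAU rho1 g)) => [hg|]; last by exists g.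
  by have [h hh] := operator_series_cvg n0 HG K0 HK GE hs hc hg; exists h.
rewrite (symbol_series hs hS _ hf); first exact: hS.
exact: (operator_cont n0 HG K0 HK GE hc hS).
Qed.

End Converse.

Theorem theorem4p3 (R : realType) (n : nat) (hn : (0 < n)%N)
    (rho1 rho2 rhohat : R -> R) (ord1 ord2 : R) :
  proximate_order rho1 ord1 -> proximate_order rho2 ord2 ->
  (exists C M : R, forall r, M < r -> growth rho1 r <= C * growth rho2 r) ->
  normalized_po rhohat ord1 ->
  (exists M : R, forall r, M < r -> rhohat r = rho1 r) ->
  (forall u : nat -> Pt R n -> Cl R n,
     (forall l, slice_monogenic (u l)) -> coef_cond rho2 rhohat ord1 u ->
     exists T : (Pt R n -> Cl R n) -> (Pt R n -> Cl R n),
       (forall f, inAU rho1 f -> series_cvgA rho2 u f (T f)) /\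
       contA rho1 rho2 T)
  /\
  (forall T : (Pt R n -> Cl R n) -> (Pt R n -> Cl R n),
     (forall f, inAU rho1 f -> inAU rho2 (T f)) ->
     right_linear rho1 T -> contA rho1 rho2 T ->
     exists u : nat -> Pt R n -> Cl R n,
       (forall l, slice_monogenic (u l)) /\ coef_cond rho2 rhohat ord1 u /\
       (forall f, inAU rho1 f -> series_cvgA rho2 u f (T f))).
Proof.
move=> p1 p2 dom nh eqr.
have HG := po_weight_sequence p1 nh eqr.
have [K K0 HK] := growth_dominated (rho2 := rho2) p1 dom.
split=> [u hu hc|T hTU hlin hcont].
  (* The sums are assembled into a total operator by choice; outside [A_rho1] the requirement is
     vacuous. *)
  have /choice[T hT] : forall f, exists g, inAU rho1 f -> series_cvgA rho2 u f g.
    move=> g; case: (pselect (inAU rho1 g)) => [hg|]; last by exists g.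
    by have [h hh] := operator_series_cvg hn HG K0 HK erefl hu hc hg; exists h.
  exists T; split; first exact: hT.
  exact: (operator_cont hn HG K0 HK erefl hc hT).
(* Stem functions of the images of the monomials, available because [T] maps into [A_rho2]. *)
have /choice[tau htau] : forall k, exists F, sholo F /\ T (xpow k) = ofs F.
  move=> k; have hk := hTU _ (mono_inAU HG k (clone R n)).
  by have [F hF e] := slice_ofs hn (inAU_slice hk); exists F.
exists (symbol tau).
exact: (exists_symbol hn HG K0 HK hlin hcont (fun k => (htau k).1) (fun k => (htau k).2) erefl).
Qed.
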